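(* Suppose that $$\liminf_{n\to\infty}\frac{\bar n I}{\log n}>1,$$ and that $\alpha-\beta$ is a positive constant. Then there is a positive sequence $\eta_n\to 0$ such that, for all large $n$, $$\mathbb{E}\big[\Pi(Z\in\Gamma(Z^* )\mid A)\big]\ \ge\ 1-n\exp\big(-(1-\eta_n)\bar n I\big)=1-o(1),$$ where $\Pi(Z\in\Gamma(Z^* )\mid A)=\sum_{Z\in\Gamma(Z^* )}\Pi(Z\mid A)$ and the expectation is with respect to the data-generating process (the law of $A$ under the true model).
   Context: Model. $K\ge 2$ is a fixed known integer, $[K]=\{1,\dots,K\}$, and $\beta\ge 1$ is an absolute constant. For each $n$, $Z^*\in[K]^n$ is a (deterministic) true label vector with $\frac{n}{\beta K}\le |\{i: Z_i^*=k\}|\le \frac{\beta n}{K}$ for all $k\in[K]$. The numbers $0<q<p<1$ depend on $n$, with $p,q\to 0$ and $p\asymp q$ (i.e. $p/q$ stays bounded) as $n\to\infty$. $B\in[0,1]^{K\times K}$ has $B_{aa}=p$ and $B_{ab}=q$ for $a\ne b$. The adjacency matrix $A\in\{0,1\}^{n\times n}$ is symmetric with zero diagonal, and $A_{ij}$, $i<j$, are independent $\mathrm{Bernoulli}(B_{Z_i^*Z_j^*})$. Quantities. $I=-2\log(\sqrt{pq}+\sqrt{(1-p)(1-q)})$. $\bar n=n/2$ if $K=2$ and $\bar n=n/(K\beta)$ if $K>2$. $\Gamma(Z)=\{\sigma\circ Z:\sigma \text{ a permutation of }[K]\}$. For a constant $\alpha>\beta$, $S_\alpha=\{Z\in[K]^n:\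 |\{i:Z_i=k\}|\in[\frac{n}{\alpha K},\frac{\alpha n}{K}]\ \forall k\in[K]\}$. Posterior. The prior on $Z$ is uniform on $S_\alpha$, and independently the connectivity probabilities $B_{ab}$, $1\le a\le b\le K$, receive i.i.d. $\mathrm{Beta}(\kappa_1,\kappa_2)$ priors with constants $\kappa_1,\kappa_2>0$. With $n_a(Z)=|\{i:Z_i=a\}|$, $n_{ab}(Z)=n_a(Z)n_b(Z)$ for $a\neq b$, $n_{aa}(Z)=n_a(Z)(n_a(Z)-1)/2$, $O_{ab}(Z)=\sum_{i,j}A_{ij}\mathbf 1\{Z_i=a,Z_j=b\}$ for $a\ne b$, $O_{aa}(Z)=\sum_{i<j}A_{ij}\mathbf 1\{Z_i=Z_j=a\}$, the posterior is the probability distribution on $S_\alpha$ with $$\Pi(Z\mid A)\propto\prod_{1\le a\le b\le K}\mathrm{Beta}\big(O_{ab}(Z)+\kappa_1,\ n_{ab}(Z)-O_{ab}(Z)+\kappa_2\big),\qquad Z\in S_\alpha,$$ where $\mathrm{Beta}(\cdot,\cdot)$ is the Beta function. *)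

(* Defs.v *)
From mathcomp Require Import all_boot all_order all_algebra all_fingroup.
From mathcomp Require Import all_classical all_reals all_analysis.

Set Implicit Arguments.
Unset Strict Implicit.
Unset Printing Implicit Defensive.

Import Order.TTheory GRing.Theory Num.Theory.
Import numFieldNormedType.Exports.

Local Open Scope classical_set_scope.
Local Open Scope ring_scope.

(* The label set [K] is 'I_K; a label vector is a {ffun 'I_n -> 'I_K}. *)

Section Labels.
Variables (R : realType) (n K : nat).
Implicit Types Z Zs : {ffun 'I_n -> 'I_K}.

Definition class_size Z (a : 'I_K) : nat := #|[pred i | Z i == a]|.

(* With g = beta this is the standing condition on the true labels, and with
   g = alpha it is membership in S_alpha. *)
Definition balanced (g : R) Z : bool :=
  [forall a, n%:R / (g * K%:R) <= (class_size Z a)%:R <= g * n%:R / K%:R].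

Definition Gamma Zs : {set {ffun 'I_n -> 'I_K}} :=
  [set [ffun i => s (Zs i)] | s : {perm 'I_K}]%SET.

Definition num_pairs Z (a b : 'I_K) : R :=
  let m c := (class_size Z c)%:R in
  if a == b then m a * (m a - 1) / 2 else m a * m b.

Definition num_edges (A : 'M[bool]_n) Z (a b : 'I_K) : nat :=
  if a == b
  then (\sum_(i < n) \sum_(j < n | i < j) [&& A i j, Z i == a & Z j == a])%N
  else (\sum_(i < n) \sum_(j < n) [&& A i j, Z i == a & Z j == b])%N.

End Labels.

(* The library's beta_fun only takes natural number arguments. *)
Definition Beta {R : realType} (x y : R) : R :=
  \int[lebesgue_measure]_(t in `]0, 1[) (t `^ (x - 1) * (1 - t) `^ (y - 1)).

Section Posterior.
Variables (R : realType) (n K : nat) (alpha kappa1 kappa2 : R).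
Implicit Types (A : 'M[bool]_n) (Z : {ffun 'I_n -> 'I_K}).

Definition posterior_weight A Z : R :=
  \prod_(ab : 'I_K * 'I_K | (ab.1 <= ab.2)%N)
    Beta ((num_edges A Z ab.1 ab.2)%:R + kappa1)
         (num_pairs R Z ab.1 ab.2 - (num_edges A Z ab.1 ab.2)%:R + kappa2).

Definition posterior A Z : R :=
  if balanced alpha Z
  then posterior_weight A Z /
       \sum_(Z' : {ffun 'I_n -> 'I_K} | balanced alpha Z') posterior_weight A Z'
  else 0.

Definition posterior_mass A (D : {set {ffun 'I_n -> 'I_K}}) : R :=
  \sum_(Z in D) posterior A Z.

End Posterior.

(* Mutual independence of the random variables X i, i \in D: the product rule
   for every finite subfamily and all measurable events. *)
Definition mutually_independent {d d'} {Om : measurableType d}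
    {T : measurableType d'} {R : realType} (P : probability Om R)
    {I : finType} (D : {set I}) (X : I -> {RV P >-> T}) : Prop :=
  forall (J : {set I}) (E : I -> set T), J \subset D ->
    (forall i, measurable (E i)) ->
    (P (\bigcap_(i in [set` J]) (X i @^-1` E i)) =
     \prod_(i in J) P (X i @^-1` E i))%E.

Definition sbm_conn {R : realType} (K : nat) (p q : R) : 'M[R]_K :=
  \matrix_(a, b) if a == b then p else q.

Definition sbm_adjacency {d} {Om : measurableType d} {R : realType}
    (P : probability Om R) {n K : nat} (B : 'M[R]_K)
    (Zs : {ffun 'I_n -> 'I_K}) (A : 'I_n -> 'I_n -> {RV P >-> bool}) : Prop :=
  [/\ forall i j w, A i j w = A j i w,
      forall i w, A i i w = false,
      forall i j : 'I_n, (i < j)%N ->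
        distribution P (A i j) = bernoulli_prob (B (Zs i) (Zs j))
    & mutually_independent [set ij : 'I_n * 'I_n | (ij.1 < ij.2)%N]%SET
        (fun ij => A ij.1 ij.2)].

Definition adjacency_mx {d} {Om : measurableType d} {R : realType}
    {P : probability Om R} {n : nat} (A : 'I_n -> 'I_n -> {RV P >-> bool})
    (w : Om) : 'M[bool]_n := \matrix_(i, j) A i j w.

Definition renyi_div {R : realType} (p q : R) : R :=
  - 2 * ln (Num.sqrt (p * q) + Num.sqrt ((1 - p) * (1 - q))).

Definition nbar {R : realType} (K : nat) (beta : R) (n : nat) : R :=
  if K == 2 then n%:R / 2 else n%:R / (K%:R * beta).

Definition error_bound {R : realType} (K : nat) (beta : R) (p q eta : nat -> R)
    (n : nat) : R :=
  n%:R * expR (- ((1 - eta n) * nbar K beta n * renyi_div (p n) (q n))).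

(* Main.v *)
(* The posterior mass missing from Gamma(Zs) is at most the sum over balanced
   Z outside Gamma(Zs) of E min(1, W_Z / W_Zs), where W_Z is the product over
   blocks of Beta integrals of Bernoulli likelihoods, and min(1, u) <= sqrt u
   reduces this to Hellinger affinities, so no concentration bound is needed.
   Bounding the integrals by a grid of mesh 1/M from above and by the true
   connectivity from below costs factors polynomial in n. This is affordable
   when some class of Z meets two true classes in order n vertices, for then the
   affinity is exp(-c n^2 I) while there are only K^n labellings Z.
   Otherwise Z agrees with Zs up to a permutation and m <= eps n vertices, and
   each integral is split into a window of width delta (p - q) around the true
   connectivity and the rest. Outside the window the affinity is again
   exp(-c n^2 I). Inside, pairs that do not change block cancel exactly, so no
   polynomial factor appears, and each of the about 2 m nbar pairs moving between
   the levels p and q contributes the affinity exp(-I/2). Summing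
   exp(-m (1 - kappa) nbar I) over all labellings at distance m from Zs gives
   n exp(-(1 - 2 kappa) nbar I) for every kappa, and eta is found by a diagonal
   choice of kappa. *)
Require Import Defs.
From mathcomp Require Import all_boot all_order all_algebra all_fingroup.
From mathcomp Require Import all_classical all_reals all_analysis.
From mathcomp Require Import measurable_realfun.
From mathcomp Require Import ring lra zify.

Import Order.TTheory GRing.Theory Num.Theory.
Import numFieldNormedType.Exports.

Set Implicit Arguments.
Unset Strict Implicit.
Unset Printing Implicit Defensive.

Local Open Scope classical_set_scope.
Local Open Scope ring_scope.

(** * Beta integrals of Bernoulli likelihoods *)

Section BetaIntegral.
Context {R : realType}.
Notation mu := (@lebesgue_measure R).

(** The target n exp(-(1 - eta) nbar I) may vanish as slowly as a small power of n, so labellings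
    with few mismatches leave no room for a polynomial factor. This forces the comparison of
    integrands at one common connectivity inside a window. The likelihood ratio of the moved pairs
    still depends on the offset u from the true level, but only through exp(u z); bounding it by the
    two ends of the window costs a factor 2 per block. The score has mean zero, so the first-order
    effect of the offset nearly cancels and, p/q being bounded, the window costs O(delta I) per
    moved pair. At most m n pairs are moved and n <= K beta nbar, so a delta proportional to kappa
    suffices. The number nbar arises from one mislabelled vertex: its pairs with correctly labelled
    vertices of its true and of its assigned class change level, and two classes hold at least 2
    nbar vertices, which is all n of them when K = 2. The crude bounds are affordable because n I is
    at least of order log n, so n^2 I dominates n. *)

Lemma integrable_bounded_primitive (f F : R -> R) (B : R) :
  (forall x : R, 0 < x < 1 -> 0 <= f x) ->
  (forall x : R, 0 < x < 1 -> is_derive x 1 F (f x)) ->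
  (forall x : R, 0 < x < 1 -> {for x, continuous f}) ->
  (forall x : R, 0 < x < 1 -> `|F x| <= B) ->
  mu.-integrable `]0%R, 1%R[ (EFin \o f).
Proof.
move=> f0 dF cf FB.
(* Exhaustion of the open interval by compacts [S k], nondegenerate thanks to the [+3]. On each one
   the integral is a difference of values of [F], at most [2 B], and monotone convergence concludes;
   [f] may be unbounded near 0 and 1. *)
pose a k : R := k.+3%:R^-1.
have a0 k : 0 < a k by rewrite invr_gt0.
have a3 k : a k < 1 - a k.
  have : a k <= 3^-1 by rewrite lef_pV2 ?posrE ?ltr0n// ler_nat.
  by lra.
pose S k : set R := `[a k, 1 - a k]%classic.
have S01 k x : S k x -> 0 < x < 1.
  by rewrite /S/= in_itv/= => /andP[? ?]; have := a0 k; lra.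
have US : \bigcup_k S k = `]0%R, 1%R[%classic.
  apply/seteqP; split=> [x [k _ /S01 //]|x].
  rewrite /= in_itv/= => /andP[x0 x1].
  have mx : 0 < Num.min x (1 - x) by rewrite lt_min; lra.
  exists (Num.truncn (Num.min x (1 - x))^-1) => //.
  set k := Num.truncn _.
  have ak : a k <= Num.min x (1 - x).
    rewrite -[leRHS]invrK lef_pV2 ?posrE ?invr_gt0 ?ltr0n//.
    apply/ltW/(lt_le_trans (truncnS_gt _)).
    by rewrite ler_nat ltnS (leq_trans (leqnSn _)).
  move: ak; rewrite le_min /S/= in_itv/=; lra.
have mf : measurable_fun (`]0, 1[%classic : set R) f.
  apply: open_continuous_measurable_fun => //.
  by move=> x; rewrite inE/= in_itv/=; exact: cf.
apply/integrableP; split; first exact/measurable_EFinP.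
have absE : (\int[mu]_(x in `]0%R, 1%R[) `|(EFin \o f) x| =
             \int[mu]_(x in `]0%R, 1%R[) (f x)%:E)%E.
  apply: eq_integral => x; rewrite inE/= in_itv/= => x01.
  by rewrite ger0_norm// f0.
rewrite absE -US.
have mS k : measurable (S k) by exact: measurable_itv.
have Sf k : measurable_fun (S k) (EFin \o f).
  apply/measurable_EFinP; apply: measurable_funS mf => // x /S01.
  by rewrite /= in_itv.
have nS : nondecreasing_seq S.
  move=> m n mn; rewrite subsetEset => x; rewrite /S/= !in_itv/=.
  have : a n <= a m by rewrite lef_pV2 ?posrE ?ltr0n// ler_nat.
  by lra.
have cvS : (\int[mu]_(x in S i) (f x)%:E)%E @[i --> \oo] -->
           (\int[mu]_(x in \bigcup_i S i) (f x)%:E)%E.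
  apply: ge0_nondecreasing_set_cvg_integral => //.
  by move=> i x Six; rewrite lee_fin; exact: f0 (S01 i x Six).
rewrite -(cvg_lim _ cvS)//.
apply: (@le_lt_trans _ _ (B + B)%:E); last exact: ltry.
apply: lime_le; first by apply: cvgP; exact: cvS.
near=> k.
have -> : (\int[mu]_(x in S k) (EFin \o f) x = (F (1 - a k))%:E - (F (a k))%:E)%E.
  apply: continuous_FTC2 => //.
  - apply: continuous_in_subspaceT => x; rewrite inE => /S01; exact: cf.
  - have cF (x : R) : 0 < x < 1 -> {for x, continuous F}.
      move=> /dF dFx; apply: differentiable_continuous.
      by apply/derivable1_diffP; exact: ex_derive.
    have := a0 k; have := a3 k => ? ?.
    split.
    + move=> x; rewrite in_itv/= => /andP[? ?].
      have : 0 < x < 1 by lra.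
      by move=> /dF dFx; exact: ex_derive.
    + apply: cvg_at_right_filter; apply: cF; lra.
    + apply: cvg_at_left_filter; apply: cF; lra.
  - move=> x; rewrite in_itv/= => /andP[? ?].
    have x01 : 0 < x < 1 by have := a0 k; lra.
    have ? := dF _ x01.
    by rewrite derive1E derive_val.
rewrite -EFinB lee_fin.
have := a0 k; have := a3 k => ? ?.
have := FB (a k); have := FB (1 - a k).
have -> : 0 < 1 - a k < 1 by lra.
have -> : 0 < a k < 1 by lra.
move=> /(_ isT) + /(_ isT).
rewrite !ler_norml; lra.
Unshelve. all: by end_near. Qed.

Variables k1 k2 : R.
Hypotheses (k1_gt0 : 0 < k1) (k2_gt0 : 0 < k2).

Definition beta_density (t : R) : R := t `^ (k1 - 1) * (1 - t) `^ (k2 - 1).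

Lemma beta_density_ge0 t : 0 <= beta_density t.
Proof. by rewrite mulr_ge0// powR_ge0. Qed.

Lemma is_derive_powR_div (k x : R) : k != 0 -> 0 < x ->
  is_derive x 1 (fun t => t `^ k / k) (x `^ (k - 1)).
Proof.
move=> k0 x0; have d := is_derive1_powR k x0.
have := @is_deriveZ _ _ _ (fun t => t `^ k) k^-1 x 1 _ d.
rewrite scalerA mulVf// scale1r.
rewrite (_ : k^-1 \*: _ = (fun t => t `^ k / k))//.
by apply/funext => t; rewrite mulrC.
Qed.

Lemma continuous_powR_gt0 (k x : R) : 0 < x ->
  {for x, continuous (fun t : R => t `^ k)}.
Proof.
move=> x0; apply: differentiable_continuous; apply/derivable1_diffP.
by have ? := is_derive1_powR k x0; exact: ex_derive.
Qed.

Lemma powR_le1 (k x : R) : 0 < k -> 0 < x < 1 -> x `^ k <= 1.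
Proof.
move=> k0 /andP[x0 x1]; rewrite -(powRr0 x).
by apply: ger_powR; rewrite ?x0 ltW.
Qed.

Lemma integrable_powR_left (k : R) : 0 < k ->
  mu.-integrable `]0%R, 1%R[ (fun t => (t `^ (k - 1))%:E).
Proof.
move=> k0.
apply: (@integrable_bounded_primitive _ (fun t => t `^ k / k) k^-1).
- by move=> x _; exact: powR_ge0.
- by move=> x /andP[x0 x1]; apply: is_derive_powR_div; rewrite ?gt_eqF.
- by move=> x /andP[x0 x1]; exact: continuous_powR_gt0.
- move=> x x01; rewrite ger0_norm; last by rewrite divr_ge0 ?powR_ge0// ltW.
  by rewrite ler_piMl ?invr_ge0 ?(ltW k0)// powR_le1.
Qed.

Lemma integrable_powR_right (k : R) : 0 < k ->
  mu.-integrable `]0%R, 1%R[ (fun t => ((1 - t) `^ (k - 1))%:E).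
Proof.
move=> k0.
apply: (@integrable_bounded_primitive _ (fun t => - ((1 - t) `^ k / k)) k^-1).
- by move=> x _; exact: powR_ge0.
- move=> x /andP[x0 x1].
  have x10 : 0 < 1 - x by lra.
  have d := is_derive_powR_div (lt0r_neq0 k0) x10.
  have d1 : is_derive x 1 (fun t : R => 1 - t) (-1).
    have := is_deriveB (is_derive_cst (1 : R) x 1) (is_derive_id x (1 : R)).
    by rewrite sub0r.
  have := is_deriveN (@is_derive1_comp _ (fun t => t `^ k / k) (fun t => 1 - t) x
    _ _ d d1).
  by rewrite mulrN1 opprK.
- move=> x /andP[x0 x1].
  apply: (@continuous_comp _ _ _ (fun t : R => 1 - t) (fun t => t `^ (k - 1)));
    last by apply: continuous_powR_gt0; lra.
  by apply: continuousB; [exact: cst_continuous|exact: cvg_id].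
- move=> x x01; rewrite normrN ger0_norm; last by rewrite divr_ge0 ?powR_ge0// ltW.
  by rewrite ler_piMl ?invr_ge0 ?(ltW k0)// powR_le1//; lra.
Qed.

Lemma measurable_beta_density (S : set R) : measurable_fun S beta_density.
Proof.
apply: (@measurable_funS _ _ _ _ setT) => //.
apply: measurable_funM; first exact: measurable_powR.
apply: (@measurableT_comp _ _ _ _ _ _ (fun t : R => t `^ (k2 - 1))).
  exact: measurable_powR.
exact: measurable_funB.
Qed.

Lemma powR_le2 (k x : R) : 0 < k -> 2^-1 <= x < 1 -> x `^ (k - 1) <= 2.
Proof.
move=> k0 /andP[x2 x1].
have x0 : 0 < x by rewrite (lt_le_trans _ x2).
apply: (@le_trans _ _ (x `^ (-1))).
  by apply: ger_powR; rewrite ?x0 ?ltW//; lra.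
by rewrite powR_inv1 ?(ltW x0)// invf_ple ?posrE.
Qed.

(** The two possible singularities are kept apart: on each half of the interval the factor that is
    regular there is at most 2 by [powR_le2], so a sum of two one-sided powers dominates. *)
Lemma integrable_beta_density :
  mu.-integrable `]0%R, 1%R[ (EFin \o beta_density).
Proof.
have i1 : mu.-integrable `]0%R, 1%R[ (fun t => 2%:E * (t `^ (k1 - 1))%:E)%E.
  by apply: integrableZl => //; exact: integrable_powR_left.
have i2 : mu.-integrable `]0%R, 1%R[
    (fun t => 2%:E * ((1 - t) `^ (k2 - 1))%:E)%E.
  by apply: integrableZl => //; exact: integrable_powR_right.
have : mu.-integrable `]0%R, 1%R[
    (fun t => 2%:E * (t `^ (k1 - 1))%:E + 2%:E * ((1 - t) `^ (k2 - 1))%:E)%E.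
  exact: integrableD.
apply: le_integrable => //.
  by apply/measurable_EFinP; exact: measurable_beta_density.
move=> x; rewrite /= in_itv/= => /andP[x0 x1].
rewrite lee_fin (ger0_norm (beta_density_ge0 _)) ger0_norm; last first.
  by rewrite addr_ge0// mulr_ge0// powR_ge0.
rewrite /beta_density; have [xh|xh] := leP x 2^-1.
- rewrite ler_wpDr ?mulr_ge0 ?powR_ge0// mulrC.
  by rewrite ler_wpM2r ?powR_ge0// powR_le2//; lra.
- rewrite ler_wpDl ?mulr_ge0 ?powR_ge0//.
  by rewrite ler_wpM2r ?powR_ge0// powR_le2//; lra.
Qed.

Definition beta_int (S : set R) (g : R -> R) : R :=
  \int[mu]_(t in S) (g t * beta_density t).

(** The bounds concern the open interval only, since a likelihood may leave [0, 1] elsewhere. *)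
Definition unit_fun (g : R -> R) : Prop :=
  measurable_fun setT g /\ forall t, 0 < t < 1 -> 0 <= g t <= 1.

Section Admissible.
Variable S : set R.
Hypotheses (mS : measurable S) (S01 : S `<=` `]0, 1[).

Let S01P t : S t -> 0 < t < 1.
Proof. by move=> /S01; rewrite /= in_itv. Qed.

Lemma integrable_beta_int g : unit_fun g ->
  mu.-integrable S (fun t => (g t * beta_density t)%:E).
Proof.
move=> [mg g01].
have iS : mu.-integrable S (EFin \o beta_density).
  by apply: integrableS integrable_beta_density.
apply: le_integrable iS => //.
  apply/measurable_EFinP; apply: measurable_funM.
    exact: measurable_funS mg.
  exact: measurable_beta_density.
move=> t /S01P t01; rewrite lee_fin normrM.
rewrite ger0_norm; last by case/andP: (g01 _ t01).
by rewrite ler_piMl//; case/andP: (g01 _ t01).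
Qed.

Lemma beta_int_ge0 g : unit_fun g -> 0 <= beta_int S g.
Proof.
move=> [_ g01]; apply: Rintegral_ge0 => t /S01P /g01 /andP[g0 _].
by rewrite mulr_ge0// beta_density_ge0.
Qed.

Lemma beta_int_le g h u : unit_fun g -> unit_fun h ->
  (forall t, S t -> g t <= u * h t) -> beta_int S g <= u * beta_int S h.
Proof.
move=> ug uh guh; rewrite /beta_int -RintegralZl//; last first.
  exact: integrable_beta_int.
apply: le_Rintegral => //.
- exact: integrable_beta_int.
- have : mu.-integrable S (fun t => u%:E * (h t * beta_density t)%:E)%E.
    by apply: integrableZl => //; exact: integrable_beta_int.
  by [].
- by move=> t St; rewrite mulrA ler_wpM2r ?beta_density_ge0// guh.
Qed.

Lemma beta_int_bound g u : unit_fun g ->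
  (forall t, S t -> g t <= u) -> beta_int S g <= u * beta_int S (cst 1).
Proof.
move=> ug gu; apply: beta_int_le => //.
  split; [exact: measurable_cst|by move=> t _; rewrite ler01 lexx].
by move=> t St; rewrite mulr1 gu.
Qed.

End Admissible.

Lemma beta_int_split (S : set R) g : measurable S -> S `<=` `]0, 1[ ->
  unit_fun g ->
  beta_int `]0, 1[ g = beta_int S g + beta_int (`]0, 1[ `\` S) g.
Proof.
move=> mS S01 ug.
have m01 : measurable (`]0, 1[%classic : set R) by exact: measurable_itv.
rewrite /beta_int -Rintegral_setU//.
- by rewrite setDUK.
- exact: measurableD.
- rewrite setDUK//; exact: integrable_beta_int.
- by rewrite disj_set2E setDIK.
Qed.

Lemma beta_int_subset (S : set R) g : measurable S -> S `<=` `]0, 1[ ->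
  unit_fun g -> beta_int S g <= beta_int `]0, 1[ g.
Proof.
move=> mS S01 ug; rewrite (beta_int_split mS S01 ug) lerDl.
by apply: beta_int_ge0 => // t [].
Qed.

(** Raising the exponent from [k - 1] to [k] gives one bound for both signs of [k - 1]. *)
Lemma powR_ge_base (k a x : R) : 0 < k -> 0 < a -> a <= x <= 1 ->
  a `^ k <= x `^ (k - 1).
Proof.
move=> k0 a0 /andP[ax x1].
have x0 : 0 < x by rewrite (lt_le_trans a0).
apply: (@le_trans _ _ (x `^ k)).
  by apply: ge0_ler_powR => //; rewrite ?nnegrE ltW.
by apply: ger_powR; rewrite ?x0//; lra.
Qed.

Lemma beta_int_lower (g : R -> R) (a b c v : R) : unit_fun g ->
  0 <= v -> 0 < c -> c <= a -> a <= b -> b <= 1 - c ->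
  (forall t, a < t < b -> v <= g t) ->
  v * (c `^ k1 * c `^ k2) * (b - a) <= beta_int `]0, 1[ g.
Proof.
move=> ug v0 c0 ca ab b1 vg.
have S01 : `]a, b[%classic `<=` (`]0, 1[%classic : set R).
  move=> x; rewrite /= !in_itv/=; lra.
apply: le_trans (beta_int_subset _ S01 ug); last exact: measurable_itv.
have -> : v * (c `^ k1 * c `^ k2) * (b - a) =
    \int[mu]_(t in `]a, b[) (v * (c `^ k1 * c `^ k2)).
  rewrite Rintegral_cst; last exact: measurable_itv.
  have := @lebesgue_measure_itv R `]a, b[; rewrite /= lte_fin => mab.
  by congr (_ * _); rewrite mab; case: ltP => //= ba; lra.
apply: le_Rintegral.
- exact: measurable_itv.
- apply: measurable_bounded_integrable => //.
  + by have := @lebesgue_measure_itv R `]a, b[; rewrite /= => ->; case: ifP; rewrite ?ltry// -EFinD ltry.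
  + exact: bounded_cst.
- exact: integrable_beta_int.
- move=> t; rewrite /= in_itv/= => /andP[at_ tb].
  rewrite ler_pM//; first by rewrite mulr_ge0// powR_ge0.
    by apply: vg; rewrite at_ tb.
  by rewrite ler_pM ?powR_ge0// powR_ge_base//; lra.
Qed.

(** * Bernoulli likelihoods and their values on a grid *)

Definition bern (t : R) (x : bool) : R := if x then t else 1 - t.

Definition lik (I : finType) (Q : pred I) (x : I -> bool) (t : R) : R :=
  \prod_(i | Q i) bern t (x i).

Lemma bern01 t x : 0 <= t <= 1 -> 0 <= bern t x <= 1.
Proof. by move=> t01; rewrite /bern; case: x; lra. Qed.

Lemma bern_gt0 t x : 0 < t < 1 -> 0 < bern t x.
Proof. by move=> t01; rewrite /bern; case: x; lra. Qed.

Lemma bernoulli_ineq (h : R) (N : nat) : 0 <= h <= 1 ->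
  1 - N%:R * h <= (1 - h) ^+ N.
Proof.
move=> h01; elim: N => [|N IH]; first by rewrite mul0r subr0 expr0.
rewrite exprS -natr1.
have h0 : 0 <= h by case/andP: h01.
have : 0 <= N%:R * h * h by rewrite !mulr_ge0.
have : (1 - h) * (1 - N%:R * h) <= (1 - h) * (1 - h) ^+ N.
  by rewrite ler_wpM2l//; lra.
by lra.
Qed.

Section Likelihood.
Variables (I : finType) (Q : pred I) (x : I -> bool).

Lemma lik01 t : 0 <= t <= 1 -> 0 <= lik Q x t <= 1.
Proof.
move=> t01; rewrite /lik prodr_ge0/=; last first.
  by move=> i _; case/andP: (bern01 (x i) t01).
by apply: prodr_ile1 => i _; exact: bern01.
Qed.

Lemma lik_gt0 t : 0 < t < 1 -> 0 < lik Q x t.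
Proof. by move=> t01; apply: prodr_gt0 => i _; exact: bern_gt0. Qed.

Lemma lik_count t :
  lik Q x t = t ^+ (\sum_(i | Q i) x i) * (1 - t) ^+ (\sum_(i | Q i) ~~ x i).
Proof.
rewrite /lik !expr_sum -big_split/=; apply: eq_bigr => i _.
by rewrite /bern; case: (x i); rewrite ?expr1 ?expr0 ?mulr1 ?mul1r.
Qed.

Lemma unit_fun_lik : unit_fun (lik Q x).
Proof.
split; last by move=> t t01; apply: lik01; lra.
have -> : lik Q x = (fun t => t ^+ (\sum_(i | Q i) x i)) \*
    (fun t => (1 - t) ^+ (\sum_(i | Q i) ~~ x i)).
  by apply/funext => t; exact: lik_count.
apply: measurable_funM; first exact: measurable_funX.
by apply: measurable_funX; exact: measurable_funB.
Qed.

(** [bern] is affine in its parameter, so moving [t] by a fraction [h] towards any [u] of the unit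
    interval keeps at least [1 - h] of each factor, whatever the data. With [h = 1 / M] and [M] at
    least twice the number of factors, half of the product survives. *)
Lemma lik_contract (h t u : R) : 0 <= h <= 1 -> 0 <= t <= 1 -> 0 <= u <= 1 ->
  (1 - h) ^+ #|Q| * lik Q x t <= lik Q x ((1 - h) * t + h * u).
Proof.
move=> h01 t01 u01; rewrite /lik -prodr_const -big_split/=.
apply: ler_prod => i _; apply/andP; split.
  by rewrite mulr_ge0 ?subr_ge0//; [lra|case/andP: (bern01 (x i) t01)].
have ? : 0 <= h * u by apply: mulr_ge0; lra.
have ? : 0 <= h * (1 - u) by apply: mulr_ge0; lra.
by rewrite /bern; case: (x i); lra.
Qed.

Variables (M : nat).
Hypothesis QM : (0 < M)%N /\ (2 * #|Q| <= M)%N.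
Let h : R := M%:R^-1.

Let h_gt0 : 0 < h.
Proof. by rewrite invr_gt0 ltr0n; case: QM. Qed.

Let h_le1 : h <= 1.
Proof. by rewrite invf_le1 ?ltr0n ?ler1n; case: QM. Qed.

Let hQ : 2^-1 <= (1 - h) ^+ #|Q|.
Proof.
apply: le_trans (bernoulli_ineq _ _); last by rewrite h_le1 ltW.
have [M0 QM2] := QM.
have : #|Q|%:R / M%:R <= 2^-1 :> R.
  by rewrite ler_pdivrMr ?ltr0n// ler_pdivlMl// -natrM ler_nat.
by rewrite -/h; lra.
Qed.

Lemma lik_le_double (t u : R) : 0 <= t <= 1 -> 0 <= u <= 1 ->
  lik Q x t <= 2 * lik Q x ((1 - h) * t + h * u).
Proof.
move=> t01 u01.
have h01 : 0 <= h <= 1 by rewrite h_le1 ltW.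
have := lik_contract h01 t01 u01.
have := ler_wpM2r (proj1 (andP (lik01 t01))) hQ.
by lra.
Qed.

Lemma beta_int_lik_ge (r : R) : 0 <= r <= 1 ->
  (h / 4) `^ k1 * (h / 4) `^ k2 * (h / 4) * lik Q x r
    <= beta_int `]0, 1[ (lik Q x).
Proof.
move=> r01.
have h0 := h_gt0; have h1 := h_le1; have l0 := proj1 (andP (lik01 r01)).
have hr : 0 <= (1 - h) * r by apply: mulr_ge0; lra.
have hr1 : 0 <= (1 - h) * (1 - r) by apply: mulr_ge0; lra.
(* The points [(1 - h) r + h u] with [u] between 1/4 and 3/4 stay [h / 4] away from 0 and 1 and form
   an interval of length [h / 2], on which the likelihood is at least half its value at [r]. *)
have := @beta_int_lower (lik Q x) ((1 - h) * r + h / 4)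
  ((1 - h) * r + h * (3 / 4)) (h / 4) (lik Q x r / 2) unit_fun_lik.
move=> H; apply: le_trans (H _ _ _ _ _ _); try lra.
move=> t tab.
have ht : (t - (1 - h) * r) / h * h = t - (1 - h) * r.
  by rewrite mulfVK// gt_eqF.
have u01 : 0 <= (t - (1 - h) * r) / h <= 1.
  rewrite divr_ge0/=; [|lra|lra].
  by rewrite ler_pdivrMr//; lra.
have := lik_le_double r01 u01.
by rewrite [h * _]mulrC ht addrC subrK; lra.
Qed.

Lemma beta_int_lik_le (S : set R) (G : pred R) :
  measurable S -> S `<=` `]0, 1[ ->
  (forall s t, S t -> `|s - t| <= h -> G s) ->
  beta_int S (lik Q x) <= 2 * beta_int `]0, 1[ (cst 1) *
    \sum_(k < M.+1 | G (k%:R / M%:R)) lik Q x (k%:R / M%:R).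
Proof.
move=> mS S01 SG; set T := \sum_(_ < _ | _) _.
have h0 := h_gt0; have h1 := h_le1.
have M0 : 0 < M%:R :> R by rewrite ltr0n; case: QM.
have kM (k : 'I_M.+1) : 0 <= (k%:R / M%:R : R) <= 1.
  by rewrite divr_ge0//= ler_pdivrMr// mul1r ler_nat -ltnS.
have T0 : 0 <= T by apply: sumr_ge0 => k _; case/andP: (lik01 (kM k)).
have u1 : unit_fun (cst 1).
  by split; [exact: measurable_cst|move=> t _; rewrite ler01 lexx].
apply: (@le_trans _ _ (2 * T * beta_int S (cst 1))); last first.
  rewrite [leRHS]mulrAC; apply: ler_wpM2l; first by rewrite mulr_ge0.
  exact: beta_int_subset.
apply: beta_int_bound => // [|t St]; first exact: unit_fun_lik.
have t01 : 0 < t < 1 by move: (S01 _ St); rewrite /= in_itv.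
pose v := M%:R * ((1 - h) * t + h).
have Mh : M%:R * h = 1 by rewrite mulfV// gt_eqF.
have vE : v = (M%:R - 1) * t + 1 by rewrite /v mulrDr mulrA mulrBr mulr1 Mh.
have M1 : 1 <= M%:R :> R by rewrite ler1n; case: QM.
have Mt : 0 <= (M%:R - 1) * t by apply: mulr_ge0; lra.
have Mt' : 0 <= (M%:R - 1) * (1 - t) by apply: mulr_ge0; lra.
have v0 : 0 <= v by lra.
have /andP[kv vk] := truncn_itv v0.
set k := Num.truncn v in kv vk.
have kM1 : (k < M.+1)%N.
  rewrite ltnS -(ler_nat R); apply: (le_trans kv); rewrite vE; lra.
pose k' := Ordinal kM1.
pose u := k%:R - (M%:R - 1) * t.
have ukE : (1 - h) * t + h * u = k%:R / M%:R.
  rewrite /u mulrBr mulrA mulrBr mulr1 [h * M%:R]mulrC Mh -/h [_ * h]mulrC.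
  by rewrite addrCA subrr addr0.
have u01 : 0 <= u <= 1.
  by rewrite /u; move: vk; rewrite vE -natr1; lra.
have t01' : 0 <= t <= 1 by lra.
have := lik_le_double t01' u01; rewrite ukE => /le_trans; apply.
rewrite ler_wpM2l// /T (bigD1 k')/=; last first.
  apply: (SG _ _ St); rewrite -ukE.
  have -> : (1 - h) * t + h * u - t = h * (u - t) by lra.
  rewrite normrM gtr0_norm// ler_piMr ?(ltW h0)// ler_norml.
  by case/andP: u01 => *; case/andP: t01 => *; apply/andP; split; lra.
by rewrite lerDl; apply: sumr_ge0 => j _; case/andP: (lik01 (kM j)).
Qed.

End Likelihood.

End BetaIntegral.

(** * Hellinger bounds for block weights *)

Section SqrtFacts.
Context {R : realType}.

Lemma sqrt_prod (I : finType) (Q : pred I) (F : I -> R) :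
  (forall i, Q i -> 0 <= F i) ->
  Num.sqrt (\prod_(i | Q i) F i) = \prod_(i | Q i) Num.sqrt (F i).
Proof.
move=> F0; suff [//] : Num.sqrt (\prod_(i | Q i) F i) =
    \prod_(i | Q i) Num.sqrt (F i) /\ 0 <= \prod_(i | Q i) F i.
apply: (big_ind2 (fun x y => Num.sqrt x = y /\ 0 <= x)).
- by rewrite sqrtr1.
- by move=> x1 x2 y1 y2 [<- x0] [<- y0]; rewrite sqrtrM// mulr_ge0.
- by move=> i /F0.
Qed.

Lemma sqrt_add_le (x y : R) : 0 <= x -> 0 <= y ->
  Num.sqrt (x + y) <= Num.sqrt x + Num.sqrt y.
Proof.
move=> x0 y0.
have s0 := sqrtr_ge0 x; have t0 := sqrtr_ge0 y.
rewrite -[leRHS]ger0_norm ?addr_ge0// -sqrtr_sqr ler_wsqrtr// sqrrD !sqr_sqrtr//.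
have : 0 <= Num.sqrt x * Num.sqrt y by rewrite mulr_ge0.
by lra.
Qed.

Lemma sqrt_sum_le (I : finType) (Q : pred I) (F : I -> R) :
  (forall i, Q i -> 0 <= F i) ->
  Num.sqrt (\sum_(i | Q i) F i) <= \sum_(i | Q i) Num.sqrt (F i).
Proof.
move=> F0; suff [//] : Num.sqrt (\sum_(i | Q i) F i) <=
    \sum_(i | Q i) Num.sqrt (F i) /\ 0 <= \sum_(i | Q i) F i.
apply: (big_ind2 (fun x y => Num.sqrt x <= y /\ 0 <= x)).
- by rewrite sqrtr0.
- move=> x1 x2 y1 y2 [h1 x0] [h2 y0]; split; last exact: addr_ge0.
  by apply: le_trans (sqrt_add_le x0 y0) _; exact: lerD.
- by move=> i /F0.
Qed.

Lemma sqrt_div (x y : R) : 0 <= x -> 0 <= y ->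
  Num.sqrt (x / y) = Num.sqrt x / Num.sqrt y.
Proof. by move=> x0 y0; rewrite sqrtrM// sqrtrV. Qed.

End SqrtFacts.

Section BlockModel.
Context {R : realType}.
Variables (k1 k2 : R).
Hypotheses (k1_gt0 : 0 < k1) (k2_gt0 : 0 < k2).
Variables (E T : finType) (r : T -> R) (bs : E -> T).
Hypothesis r01 : forall c, 0 < r c < 1.
Implicit Types (b : E -> T) (S : T -> set R) (x : {ffun E -> bool}).

Definition law x : R := \prod_e bern (r (bs e)) (x e).

(** Bhattacharyya coefficient of two Bernoulli laws. *)
Definition affinity (s t : R) : R :=
  Num.sqrt (s * t) + Num.sqrt ((1 - s) * (1 - t)).

Definition block b (c : T) : pred E := fun e => b e == c.

Definition weight_on b S x : R :=
  \prod_c beta_int k1 k2 (S c) (lik (block b c) x).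

Definition unit_itv : T -> set R := fun=> `]0, 1[%classic.

Lemma prod_blocks b (F : T -> E -> R) :
  \prod_c \prod_(e | block b c e) F c e = \prod_e F (b e) e.
Proof.
rewrite [RHS](partition_big b predT)//=; apply: eq_bigr => c _.
by apply: eq_bigr => e /eqP ->.
Qed.

Lemma sum_configs_prod (g : E -> bool -> R) :
  \sum_(x : {ffun E -> bool}) \prod_e g e (x e) = \prod_e (g e true + g e false).
Proof.
rewrite -bigA_distr_bigA; apply: eq_bigr => e _.
by rewrite big_bool.
Qed.

Lemma law_gt0 x : 0 < law x.
Proof. by apply: prodr_gt0 => e _; exact: bern_gt0. Qed.

Lemma sum_law : \sum_x law x = 1.
Proof.
rewrite (sum_configs_prod (fun e y => bern (r (bs e)) y)).
by rewrite big1// => e _; rewrite /bern; lra.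
Qed.

Definition lower_cst (M : nat) : R :=
  (M%:R^-1 / 4) `^ k1 * (M%:R^-1 / 4) `^ k2 * (M%:R^-1 / 4).

(** Loss per block: the square root of the constant of [beta_int_lik_le] over that of
    [beta_int_lik_ge], times the number of grid points. *)
Definition poly_cst (M : nat) : R :=
  Num.sqrt (2 * beta_int k1 k2 `]0, 1[ (cst 1) / lower_cst M) * M.+1%:R.

Lemma lower_cst_gt0 M : (0 < M)%N -> 0 < lower_cst M.
Proof.
by move=> M0; rewrite /lower_cst !mulr_gt0// ?powR_gt0 ?divr_gt0 ?invr_gt0 ?ltr0n.
Qed.

(** * Grid bound: arbitrary labellings, at a polynomial cost *)

Section Crude.
Variables (M : nat).
Hypothesis EM : (0 < M)%N /\ (2 * #|E| <= M)%N.

Let QM (Q : pred E) : (0 < M)%N /\ (2 * #|Q| <= M)%N.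
Proof.
case: EM => M0 EM2; split=> //; apply: leq_trans EM2.
by rewrite leq_mul2l/= max_card.
Qed.

Let r01w c : 0 <= r c <= 1.
Proof. by have := r01 c; lra. Qed.

Lemma weight_true_ge x : lower_cst M ^+ #|T| * law x <= weight_on bs unit_itv x.
Proof.
rewrite /law -(prod_blocks bs (fun c e => bern (r c) (x e))).
rewrite -prodr_const -big_split/=; apply: ler_prod => c _.
have l0 : 0 < lower_cst M by apply: lower_cst_gt0; case: EM.
rewrite (beta_int_lik_ge k1_gt0 k2_gt0 x (QM (block bs c)) (r01w c)) andbT.
by rewrite mulr_ge0 ?(ltW l0)// prodr_ge0// => e _; case/andP: (bern01 (x e) (r01w c)).
Qed.

Lemma weight_true_gt0 x : 0 < weight_on bs unit_itv x.
Proof.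
apply: lt_le_trans (weight_true_ge x).
by rewrite mulr_gt0 ?law_gt0// exprn_gt0// lower_cst_gt0//; case: EM.
Qed.

Variables (b : E -> T) (S : T -> set R) (G : T -> pred R) (Lam : R).
Hypothesis mS : forall c, measurable (S c).
Hypothesis S01 : forall c, S c `<=` `]0, 1[.
Hypothesis SG : forall c s t, S c t -> `|s - t| <= M%:R^-1 -> G c s.
Hypothesis Lam_ge0 : 0 <= Lam.
Hypothesis affLam : forall t : T -> R,
  (forall c, G c (t c) /\ 0 <= t c <= 1) ->
  \prod_e affinity (t (b e)) (r (bs e)) <= Lam.

(* [sqrt (sum of grid terms) <= sum of sqrt] turns the expectation into a sum over
   grid points [t] of products of affinities. *)
Lemma sqrt_weight_ratio_le :
  \sum_x law x * Num.sqrt (weight_on b S x / weight_on bs unit_itv x)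
    <= poly_cst M ^+ #|T| * Lam.
Proof.
have M0 : (0 < M)%N by case: EM.
have l0 : 0 < lower_cst M by exact: lower_cst_gt0.
set B := 2 * beta_int k1 k2 `]0, 1[ (cst 1).
have B0 : 0 <= B.
  rewrite mulr_ge0//; apply: beta_int_ge0 => //.
  by split; [exact: measurable_cst|move=> t _; rewrite ler01 lexx].
pose gr (k : 'I_M.+1) : R := k%:R / M%:R.
have gr01 k : 0 <= gr k <= 1.
  by rewrite divr_ge0//= ler_pdivrMr ?ltr0n// mul1r ler_nat -ltnS.
have lk0 b' c x k : 0 <= lik (block b' c) x (gr k) by case/andP: (lik01 (block b' c) x (gr01 k)).
have be0 t y : 0 <= t <= 1 -> 0 <= bern t y :> R by move=> /(bern01 y) /andP[].
have step x : law x * Num.sqrt (weight_on b S x / weight_on bs unit_itv x) <=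
   Num.sqrt (B / lower_cst M) ^+ #|T| *
   \sum_(f : {ffun T -> 'I_M.+1} | [forall c, G c (gr (f c))])
     \prod_e Num.sqrt (bern (r (bs e)) (x e) * bern (gr (f (b e))) (x e)).
  have W0 : 0 <= weight_on b S x.
    by apply: prodr_ge0 => c _; apply: beta_int_ge0 => //; exact: unit_fun_lik.
  have lw : 0 < law x := law_gt0 x.
  have up : weight_on b S x <=
      B ^+ #|T| * \prod_c \sum_(k | G c (gr k)) lik (block b c) x (gr k).
    rewrite -prodr_const -big_split/=; apply: ler_prod => c _.
    rewrite beta_int_ge0//=; last exact: unit_fun_lik.
    exact: (beta_int_lik_le k1_gt0 k2_gt0 x (QM _) (mS c) (@S01 c) (@SG c)).
  (* Bounding the true weight below by a multiple of [law x] leaves the square root of [law x] times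
     a likelihood at grid points; such a term sums over configurations to a product of
     affinities. *)
  apply: (@le_trans _ _ (law x * Num.sqrt ((B ^+ #|T| *
      \prod_c \sum_(k | G c (gr k)) lik (block b c) x (gr k)) /
      (lower_cst M ^+ #|T| * law x)))).
    rewrite ler_wpM2l ?(ltW lw)// ler_wsqrtr// ler_pM ?invr_ge0 ?(ltW (weight_true_gt0 x))//.
    rewrite lef_pV2 ?posrE ?weight_true_gt0 ?weight_true_ge//.
    by rewrite mulr_gt0// exprn_gt0.
  set PS := \prod_c _.
  have PS0 : 0 <= PS by apply: prodr_ge0 => c _; apply: sumr_ge0 => k _; exact: lk0.
  have -> : B ^+ #|T| * PS / (lower_cst M ^+ #|T| * law x) =
      (B / lower_cst M) ^+ #|T| * (PS / law x).
    by rewrite expr_div_n; field; rewrite !gt_eqF ?exprn_gt0.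
  rewrite sqrtrM; last by rewrite exprn_ge0// divr_ge0// ltW.
  rewrite -(prodr_const (fun=> true)) sqrt_prod; last first.
    by move=> i _; rewrite divr_ge0// ltW.
  rewrite prodr_const mulrCA ler_wpM2l ?exprn_ge0 ?sqrtr_ge0//.
  rewrite sqrt_div ?(ltW lw)//.
  have -> : law x * (Num.sqrt PS / Num.sqrt (law x)) = Num.sqrt (law x) * Num.sqrt PS.
    rewrite -{1}(sqr_sqrtr (ltW lw)); field.
    by rewrite gt_eqF// sqrtr_gt0.
  rewrite /PS sqrt_prod; last by move=> c _; apply: sumr_ge0 => k _; exact: lk0.
  apply: (@le_trans _ _ (Num.sqrt (law x) *
     \prod_c \sum_(k | G c (gr k)) Num.sqrt (lik (block b c) x (gr k)))).
    rewrite ler_wpM2l ?sqrtr_ge0//; apply: ler_prod => c _.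
    by rewrite sqrtr_ge0/=; apply: sqrt_sum_le => k _; exact: lk0.
  rewrite bigA_distr_big_dep/= mulr_sumr le_eqVlt; apply/orP; left; apply/eqP.
  apply: eq_big => [f|f _].
    by apply/familyP/forallP => H c; have := H c; rewrite ?inE.
  rewrite /law sqrt_prod; last by move=> e _; rewrite be0.
  have -> : \prod_c Num.sqrt (lik (block b c) x (gr (f c))) =
      \prod_c \prod_(e | block b c e) Num.sqrt (bern (gr (f c)) (x e)).
    by apply: eq_bigr => c _; rewrite sqrt_prod// => e _; rewrite be0.
  rewrite (prod_blocks b (fun c e => Num.sqrt (bern (gr (f c)) (x e)))).
  rewrite -big_split/=; apply: eq_bigr => e _.
  by rewrite sqrtrM// be0.
apply: (le_trans (ler_sum _ (fun x _ => step x))).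
rewrite -mulr_sumr exchange_big/= /poly_cst exprMn -[leRHS]mulrA.
rewrite ler_wpM2l ?exprn_ge0 ?sqrtr_ge0//.
apply: (@le_trans _ _ (\sum_(f : {ffun T -> 'I_M.+1}) Lam)); last first.
  rewrite sumr_const card_ffun card_ord -natrX mulr_natl.
  by [].
rewrite big_mkcond/=; apply: ler_sum => f _; case: ifP => // /forallP Gf.
rewrite (sum_configs_prod (fun e y => Num.sqrt (bern (r (bs e)) y * bern (gr (f (b e))) y))).
rewrite (eq_bigr (fun e => affinity (gr (f (b e))) (r (bs e)))).
  exact: (affLam (fun c => conj (Gf c) (gr01 (f c)))).
by move=> e _; rewrite /affinity /bern ![r _ * _]mulrC ![(1 - r _) * _]mulrC.
Qed.

End Crude.

(** * Window bound: no polynomial cost *)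

Section Near.
Variables (b : E -> T) (w : R) (V : E -> R).
Hypothesis w_ge0 : 0 <= w.
Hypothesis w_small : forall c, 2 * w <= r c /\ 2 * w <= 1 - r c.

Definition window (c : T) : set R := [set t | `|t - r c| <= w].

(** Derivative in [t] of the logarithm of [bern t y]. *)
Definition score (t : R) (y : bool) : R := if y then t^-1 else - (1 - t)^-1.

Definition sgn (s : bool) : R := if s then 1 else -1.

(** Share of a moved pair with outcome [y] that enters a block of level [t] and leaves one of level
    [t']. The bits [s] and [s'] choose a window end for each of the two blocks; the quadratic term
    is the price of the lower bound [bern_window_ge] in the block left. *)
Definition edge_factor (s s' : bool) (t t' : R) (y : bool) : R :=
  Num.sqrt (bern t y * bern t' y) *
  expR ((sgn s * (w * score t y) - sgn s' * (w * score t' y)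
         + 2 * (w * score t' y) ^+ 2) / 2).

Hypothesis V_ge : forall e s s', b e != bs e ->
  edge_factor s s' (r (b e)) (r (bs e)) true +
  edge_factor s s' (r (b e)) (r (bs e)) false <= V e.

Lemma window_sub c : window c `<=` `]0, 1[.
Proof.
move=> t; rewrite /window/= in_itv/= ler_norml => /andP[? ?].
have [? ?] := w_small c; have := r01 c; lra.
Qed.

Lemma measurable_window c : measurable (window c).
Proof.
rewrite (_ : window c = `[r c - w, r c + w]%classic); first exact: measurable_itv.
apply/seteqP; split=> t; rewrite /window/= in_itv/= ler_norml => /andP[? ?].
  by apply/andP; split; lra.
by apply/andP; split; lra.
Qed.

Lemma bern_shift t u y : 0 < t < 1 -> bern (t + u) y = bern t y * (1 + u * score t y).
Proof.
move=> t01; rewrite /bern /score; case: y; field; lra.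
Qed.

(** Inverse of [1 + z <= expR z] at [z = 2 y^2 - y], where [(1 + y) (1 + z) = 1 + y^2 (1 + 2 y)] is
    at least 1 for [y >= - 1/2]. *)
Lemma expR_le_1D (y : R) : `|y| <= 2^-1 -> expR (y - 2 * y ^+ 2) <= 1 + y.
Proof.
rewrite ler_norml => /andP[yl yu].
have z0 : 0 < 1 + (2 * y ^+ 2 - y) by have := sqr_ge0 y; lra.
have : 1 + (2 * y ^+ 2 - y) <= expR (2 * y ^+ 2 - y) by exact: expR_ge1Dx.
rewrite -[y - _]opprB expRN => ez.
apply: (@le_trans _ _ (1 + (2 * y ^+ 2 - y))^-1).
  by rewrite lef_pV2// posrE// expR_gt0.
rewrite -[_^-1]mul1r ler_pdivrMr//.
have : 0 <= y ^+ 2 * (1 + 2 * y) by rewrite mulr_ge0 ?sqr_ge0//; lra.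
by lra.
Qed.

Lemma wscore_le c y : `|w * score (r c) y| <= 2^-1.
Proof.
have [h1 h2] := w_small c; have r1 := r01 c.
rewrite normrM ger0_norm// /score; case: y.
  by rewrite gtr0_norm ?invr_gt0; [rewrite ler_pdivrMr|]; lra.
by rewrite normrN gtr0_norm ?invr_gt0; [rewrite ler_pdivrMr|]; lra.
Qed.

Lemma bern_window_le c u y : `|u| <= w ->
  bern (r c + u) y <= bern (r c) y * expR (u * score (r c) y).
Proof.
move=> uw; rewrite bern_shift// ler_wpM2l ?(ltW (bern_gt0 _ _))//.
exact: expR_ge1Dx.
Qed.

(** The quadratic loss is taken at the width [w] instead of [u], which keeps the dependence on [u]
    purely exponential, as [out_factorE] requires. *)
Lemma bern_window_ge c u y : `|u| <= w ->
  bern (r c) y * expR (u * score (r c) y - 2 * (w * score (r c) y) ^+ 2)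
    <= bern (r c + u) y.
Proof.
move=> uw; rewrite bern_shift// ler_wpM2l ?(ltW (bern_gt0 _ _))//.
have us : `|u * score (r c) y| <= `|w * score (r c) y|.
  by rewrite !normrM ler_wpM2r// (ger0_norm w_ge0).
apply: (@le_trans _ _ (expR (u * score (r c) y - 2 * (u * score (r c) y) ^+ 2))).
  by rewrite ler_expR lerD2l lerN2 ler_pM2l// -[leLHS]real_normK ?num_real// -[leRHS]real_normK ?num_real// ler_sqr ?nnegrE.
by apply: expR_le_1D; rewrite (le_trans us)// wscore_le.
Qed.

(* Factors of the pairs entering and leaving block [c]; both depend on [u] through
   [expR (u * z)], and [expR (u * z) <= expR (w * z) + expR (- w * z)] on the window.
   The signs [s] and [s'] record the choice made for each block. *)
Definition in_factor (c : T) (x : {ffun E -> bool}) (u : R) : R :=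
  \prod_(e | (b e == c) && (b e != bs e))
    (Num.sqrt (bern (r c) (x e)) * expR (u * score (r c) (x e) / 2)).

Definition out_factor (c : T) (x : {ffun E -> bool}) (u : R) : R :=
  \prod_(e | (bs e == c) && (b e != bs e))
    (Num.sqrt (bern (r c) (x e)) *
     expR ((u * score (r c) (x e) - 2 * (w * score (r c) (x e)) ^+ 2) / 2)).

Lemma in_factor_gt0 c x u : 0 < in_factor c x u.
Proof.
by apply: prodr_gt0 => e _; rewrite mulr_gt0 ?expR_gt0// sqrtr_gt0 bern_gt0.
Qed.

Lemma out_factor_gt0 c x u : 0 < out_factor c x u.
Proof.
by apply: prodr_gt0 => e _; rewrite mulr_gt0 ?expR_gt0// sqrtr_gt0 bern_gt0.
Qed.

Lemma sqr_sqrt_expR (a z : R) : 0 <= a ->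
  (Num.sqrt a * expR (z / 2)) ^+ 2 = a * expR z.
Proof.
move=> a0; rewrite exprMn sqr_sqrtr// -expRM_natl.
by congr (_ * expR _); lra.
Qed.

(** A pair with the same block under [b] and [bs] occurs in both likelihoods and cancels, for every
    [u]. There remain the pairs entering block [c], bounded above, over those leaving it, bounded
    below. *)
Lemma lik_window_le c x u : `|u| <= w ->
  lik (block b c) x (r c + u) <=
  (in_factor c x u / out_factor c x u) ^+ 2 * lik (block bs c) x (r c + u).
Proof.
move=> uw.
have tu01 : 0 < r c + u < 1.
  have /window_sub : window c (r c + u) by rewrite /window/= addrC addKr.
  by rewrite /= in_itv.
have split_lik b1 : lik (block b1 c) x (r c + u) =
    \prod_(e | (b1 e == c) && (b e != bs e)) bern (r c + u) (x e) *
    \prod_(e | (b1 e == c) && (b e == bs e)) bern (r c + u) (x e).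
  by rewrite /lik (bigID (fun e => b e != bs e))/=; congr (_ * _);
    apply: eq_bigl => e; rewrite /block/= ?negbK.
have same : \prod_(e | (b e == c) && (b e == bs e)) bern (r c + u) (x e) =
    \prod_(e | (bs e == c) && (b e == bs e)) bern (r c + u) (x e).
  by apply: eq_bigl => e; case: (eqVneq (b e) (bs e)) => [->|]; rewrite ?andbF.
rewrite !split_lik same mulrA ler_wpM2r//.
  by apply: prodr_ge0 => e _; exact/ltW/bern_gt0.
have in_ge : \prod_(e | (b e == c) && (b e != bs e)) bern (r c + u) (x e)
    <= in_factor c x u ^+ 2.
  rewrite /in_factor -prodrXl; apply: ler_prod => e _.
  rewrite (ltW (bern_gt0 _ _))//= sqr_sqrt_expR ?(ltW (bern_gt0 _ _))//.
  exact: bern_window_le.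
have out_le : out_factor c x u ^+ 2 <=
    \prod_(e | (bs e == c) && (b e != bs e)) bern (r c + u) (x e).
  rewrite /out_factor -prodrXl; apply: ler_prod => e _.
  rewrite sqr_ge0/= sqr_sqrt_expR ?(ltW (bern_gt0 _ _))//.
  exact: bern_window_ge.
apply: (le_trans in_ge); rewrite expr_div_n -mulrA.
rewrite ler_peMr ?sqr_ge0// mulrC ler_pdivlMr ?mul1r//.
by rewrite exprn_gt0// out_factor_gt0.
Qed.

Lemma in_factorE c x u : in_factor c x u = in_factor c x 0 *
  expR (u * (\sum_(e | (b e == c) && (b e != bs e)) score (r c) (x e) / 2)).
Proof.
rewrite mulr_sumr expR_sum -big_split/=; apply: eq_bigr => e _.
by rewrite !mul0r expR0 mulr1 mulrA.
Qed.

Lemma out_factorE c x u : out_factor c x u = out_factor c x 0 *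
  expR (u * (\sum_(e | (bs e == c) && (b e != bs e)) score (r c) (x e) / 2)).
Proof.
rewrite mulr_sumr expR_sum -big_split/=; apply: eq_bigr => e _.
by rewrite -mulrA -expRD; congr (_ * expR _); lra.
Qed.

Lemma expR_le_sign (u z : R) : `|u| <= w -> expR (u * z) <= expR (w * z) + expR (- w * z).
Proof.
move=> uw; have : u * z <= w * `|z|.
  by rewrite (le_trans (ler_norm _))// normrM ler_wpM2r.
rewrite -ler_expR => /le_trans; apply.
have [z0|z0] := leP 0 z; first by rewrite ger0_norm// lerDl expR_ge0.
by rewrite ltr0_norm// mulrN -mulNr lerDr expR_ge0.
Qed.

Lemma factor_ratio_le c x u : `|u| <= w ->
  in_factor c x u / out_factor c x u <=
  \sum_(s : bool) in_factor c x (sgn s * w) / out_factor c x (sgn s * w).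
Proof.
move=> uw; rewrite big_bool/= mul1r mulN1r.
have ratioE v : in_factor c x v / out_factor c x v =
    in_factor c x 0 / out_factor c x 0 *
    expR (v * (\sum_(e | (b e == c) && (b e != bs e)) score (r c) (x e) / 2 -
               \sum_(e | (bs e == c) && (b e != bs e)) score (r c) (x e) / 2)).
  rewrite in_factorE out_factorE mulrBr expRD expRN; field.
  by rewrite !gt_eqF ?expR_gt0 ?out_factor_gt0.
rewrite (ratioE u) (ratioE w) (ratioE (- w)) -mulrDr ler_wpM2l ?expR_le_sign//.
by rewrite divr_ge0 ?ltW ?in_factor_gt0 ?out_factor_gt0.
Qed.

(** The two integrands are compared at the same [t], so the pointwise bound on their ratio passes to
    the integrals, and the denominator only grows from the window to the whole interval. [M] serves
    to see that the denominator is positive. *)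
Lemma sqrt_block_ratio_le c x (M : nat) : (0 < M)%N /\ (2 * #|E| <= M)%N ->
  Num.sqrt (beta_int k1 k2 (window c) (lik (block b c) x) /
            beta_int k1 k2 `]0, 1[ (lik (block bs c) x)) <=
  \sum_(s : bool) in_factor c x (sgn s * w) / out_factor c x (sgn s * w).
Proof.
move=> EM; set K := \sum_(s : bool) _.
have K0 : 0 <= K.
  by apply: sumr_ge0 => s _; rewrite divr_ge0 ?ltW ?in_factor_gt0 ?out_factor_gt0.
have bpos : 0 < beta_int k1 k2 `]0, 1[ (lik (block bs c) x).
  have QM : (0 < M)%N /\ (2 * #|block bs c| <= M)%N.
    case: EM => M0 EM2; split=> //; apply: leq_trans EM2.
    by rewrite leq_mul2l/= max_card.
  have r01w : 0 <= r c <= 1 by have := r01 c; lra.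
  apply: lt_le_trans (beta_int_lik_ge k1_gt0 k2_gt0 x QM r01w).
  apply: mulr_gt0; first by apply: lower_cst_gt0; case: EM.
  exact: lik_gt0.
rewrite -[leRHS]ger0_norm// -sqrtr_sqr ler_wsqrtr// ler_pdivrMr//.
apply: (@le_trans _ _ (K ^+ 2 * beta_int k1 k2 (window c) (lik (block bs c) x))).
  apply: beta_int_le => //; try exact: unit_fun_lik.
  - exact: measurable_window.
  - exact: window_sub.
  - move=> t; rewrite /window/= => tw.
    have -> : t = r c + (t - r c) by lra.
    apply: le_trans (lik_window_le c x tw) _.
    rewrite ler_wpM2r//.
      have /window_sub : window c t by [].
      rewrite /= in_itv/= => t01.
      by rewrite addrC subrK; apply: ltW; exact: lik_gt0.
    rewrite ler_sqr ?nnegrE//; first exact: factor_ratio_le.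
    by rewrite divr_ge0 ?ltW ?in_factor_gt0 ?out_factor_gt0.
rewrite ler_wpM2l ?sqr_ge0//; apply: beta_int_subset => //.
- exact: measurable_window.
- exact: window_sub.
- exact: unit_fun_lik.
Qed.

(** Expanding the product over blocks of sums over two signs gives [2 ^+ #|T|] sign vectors. For
    each of them the summand factorises over pairs: a moved pair sums to at most [V e], an unmoved
    one to 1, being a Bernoulli law. *)
Lemma sqrt_weight_window_le (M : nat) : (0 < M)%N /\ (2 * #|E| <= M)%N ->
  \sum_x law x * Num.sqrt (weight_on b window x / weight_on bs unit_itv x)
    <= 2 ^+ #|T| * \prod_(e | b e != bs e) V e.
Proof.
move=> EM.
pose gf (s : {ffun T -> bool}) e y : R := if b e != bs e
  then edge_factor (s (b e)) (s (bs e)) (r (b e)) (r (bs e)) y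
  else bern (r (bs e)) y.
have step x : law x * Num.sqrt (weight_on b window x / weight_on bs unit_itv x)
    <= \sum_(s : {ffun T -> bool}) \prod_e gf s e (x e).
  have -> : weight_on b window x / weight_on bs unit_itv x =
      \prod_c (beta_int k1 k2 (window c) (lik (block b c) x) /
               beta_int k1 k2 `]0, 1[ (lik (block bs c) x)).
    by rewrite /weight_on -prodf_div.
  rewrite sqrt_prod; last first.
    move=> c _; rewrite divr_ge0//; apply: beta_int_ge0 => //; try exact: unit_fun_lik.
      exact: window_sub.
  apply: (@le_trans _ _ (law x * \prod_c \sum_(s : bool)
     in_factor c x (sgn s * w) / out_factor c x (sgn s * w))).
    rewrite ler_wpM2l ?(ltW (law_gt0 x))//; apply: ler_prod => c _.
    by rewrite sqrtr_ge0/=; exact: (sqrt_block_ratio_le c x EM).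
  rewrite bigA_distr_bigA mulr_sumr; apply: ler_sum => s _.
  have inE : \prod_c in_factor c x (sgn (s c) * w) =
      \prod_(e | b e != bs e) (Num.sqrt (bern (r (b e)) (x e)) *
        expR (sgn (s (b e)) * w * score (r (b e)) (x e) / 2)).
    rewrite (partition_big b predT)//=; apply: eq_bigr => c _.
    apply: eq_big => [e|e /andP[/eqP -> _]//]; by rewrite andbC.
  have outE : \prod_c out_factor c x (sgn (s c) * w) =
      \prod_(e | b e != bs e) (Num.sqrt (bern (r (bs e)) (x e)) *
        expR ((sgn (s (bs e)) * w * score (r (bs e)) (x e) -
               2 * (w * score (r (bs e)) (x e)) ^+ 2) / 2)).
    rewrite (partition_big bs predT)//=; apply: eq_bigr => c _.
    apply: eq_big => [e|e /andP[/eqP -> _]//]; by rewrite andbC.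
  rewrite prodf_div inE outE /law (bigID (fun e => b e != bs e))/=.
  rewrite [leRHS](bigID (fun e => b e != bs e))/=.
  rewrite mulrAC; apply: ler_pM.
  - by rewrite mulr_ge0 ?divr_ge0// ?prodr_ge0// => e _;
      rewrite ?(ltW (bern_gt0 _ _))// mulr_ge0 ?sqrtr_ge0 ?expR_ge0.
  - by apply: prodr_ge0 => e _; rewrite (ltW (bern_gt0 _ _)).
  - rewrite -prodf_div -big_split/= le_eqVlt; apply/orP; left; apply/eqP.
    apply: eq_bigr => e De; rewrite /gf De /edge_factor sqrtrM ?(ltW (bern_gt0 _ _))//.
    rewrite -{1}(sqr_sqrtr (ltW (bern_gt0 (x e) (r01 (bs e))))).
    rewrite -!mulrA [RHS]mulrCA.
    have sb : Num.sqrt (bern (r (bs e)) (x e)) != 0 by rewrite gt_eqF ?sqrtr_gt0 ?bern_gt0.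
    set A := Num.sqrt (bern (r (bs e)) (x e)) in sb *.
    set B := Num.sqrt (bern (r (b e)) (x e)).
    rewrite (_ : (sgn _ * _ - _ + _) / 2 =
      (sgn (s (b e)) * (w * (score (r (b e)) (x e) / 2))) -
      (sgn (s (bs e)) * (w * score (r (bs e)) (x e)) -
               2 * (w * score (r (bs e)) (x e)) ^+ 2) / 2); last by lra.
    rewrite expRD expRN; field.
    by rewrite sb gt_eqF ?expR_gt0.
  - rewrite le_eqVlt; apply/orP; left; apply/eqP; apply: eq_bigr => e De.
    by rewrite /gf (negbTE De).
apply: (le_trans (ler_sum _ (fun x _ => step x))).
rewrite exchange_big/=.
apply: (@le_trans _ _ (\sum_(s : {ffun T -> bool}) \prod_(e | b e != bs e) V e)); last first.
  by rewrite sumr_const card_ffun card_bool -natrX mulr_natl.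
apply: ler_sum => s _; rewrite sum_configs_prod [leRHS]big_mkcond/=.
have gf0 e y : 0 <= gf s e y.
  rewrite /gf; case: ifP => _; last exact/ltW/bern_gt0.
  by rewrite mulr_ge0 ?sqrtr_ge0 ?expR_ge0.
apply: ler_prod => e _; rewrite addr_ge0//= /gf; case: ifP => De.
  exact: V_ge.
by rewrite /bern; lra.
Qed.

End Near.
End BlockModel.

(** * Hellinger affinity and the Renyi divergence *)

Section Affinity.
Context {R : realType}.
Implicit Types s t : R.

Lemma affinityE s t : 0 <= s <= 1 -> 0 <= t <= 1 ->
  affinity s t = 1 - ((Num.sqrt s - Num.sqrt t) ^+ 2 +
    (Num.sqrt (1 - s) - Num.sqrt (1 - t)) ^+ 2) / 2.
Proof.
move=> s01 t01; rewrite /affinity !sqrtrM; [|lra|lra].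
rewrite !sqrrB !sqr_sqrtr; lra.
Qed.

Lemma affinity_le s t : 0 <= s <= 1 -> 0 <= t <= 1 ->
  affinity s t <= expR (- ((Num.sqrt s - Num.sqrt t) ^+ 2 / 2)).
Proof.
move=> s01 t01; apply: le_trans (expR_ge1Dx _).
rewrite affinityE//; have := sqr_ge0 (Num.sqrt (1 - s) - Num.sqrt (1 - t)); lra.
Qed.

Lemma affinity_le1 s t : 0 <= s <= 1 -> 0 <= t <= 1 -> affinity s t <= 1.
Proof.
move=> s01 t01; apply: (le_trans (affinity_le s01 t01)).
by rewrite expR_le1 oppr_le0 divr_ge0// sqr_ge0.
Qed.

Lemma affinity_ge0 s t : 0 <= affinity s t.
Proof. by rewrite addr_ge0// sqrtr_ge0. Qed.

Lemma affinityC s t : affinity s t = affinity t s.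
Proof. by rewrite /affinity mulrC [(1 - s) * _]mulrC. Qed.

Lemma affinity_refl t : 0 <= t <= 1 -> affinity t t = 1.
Proof. by move=> t01; rewrite affinityE// !subrr expr0n/= addr0 mul0r subr0. Qed.

Lemma sqr_sqrtB s t : 0 <= s -> 0 <= t ->
  (Num.sqrt s - Num.sqrt t) ^+ 2 * (Num.sqrt s + Num.sqrt t) ^+ 2 = (s - t) ^+ 2.
Proof.
by move=> s0 t0; rewrite -exprMn -subr_sqr !sqr_sqrtr.
Qed.

(** The difference [t - r] is the difference of the square roots times their sum. That sum is at
    most [3 sqrt p] unless [sqrt t > 2 sqrt p], and then the square roots differ by at least
    [sqrt p]. *)
Lemma sqrt_far (t r p v : R) : 0 <= t -> 0 <= r -> r <= p -> 0 < p ->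
  0 <= v -> v <= p -> v <= `|t - r| -> v ^+ 2 / (9 * p) <= (Num.sqrt t - Num.sqrt r) ^+ 2.
Proof.
move=> t0 r0 rp p0 v0 vp vtr.
set a := Num.sqrt t; set b := Num.sqrt r; set c := Num.sqrt p.
have a0 : 0 <= a by exact: sqrtr_ge0.
have b0 : 0 <= b by exact: sqrtr_ge0.
have c0 : 0 < c by rewrite sqrtr_gt0.
have bc : b <= c by rewrite ler_wsqrtr.
have c2 : c ^+ 2 = p by rewrite sqr_sqrtr// ltW.
have p9 : 0 < 9 * p by lra.
rewrite ler_pdivrMr//.
have [ac|ac] := leP a (2 * c).
  have : v ^+ 2 <= (a - b) ^+ 2 * (a + b) ^+ 2.
    rewrite sqr_sqrtB// -[leRHS]real_normK ?num_real// ler_sqr ?nnegrE//.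
  move=> /le_trans; apply; rewrite ler_wpM2l ?sqr_ge0//.
  have -> : 9 * p = (3 * c) ^+ 2 by rewrite exprMn c2; lra.
  by rewrite ler_sqr ?nnegrE; lra.
have ab : c <= a - b by lra.
have : p <= (a - b) ^+ 2 by rewrite -c2 ler_sqr ?nnegrE; lra.
have : v ^+ 2 <= p * p by rewrite expr2 ler_pM.
move=> h1 h2; apply: (le_trans h1).
have := ler_wpM2r (ltW p0) h2; have : 0 <= (a - b) ^+ 2 * p by rewrite mulr_ge0 ?sqr_ge0 ?ltW.
lra.
Qed.

(** No [t] is close to both [p] and [q]; this penalises a block that mixes the two levels. *)
Lemma sqrt_sep (t p q : R) :
  (Num.sqrt p - Num.sqrt q) ^+ 2 / 2 <=
  (Num.sqrt t - Num.sqrt p) ^+ 2 + (Num.sqrt t - Num.sqrt q) ^+ 2.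
Proof.
have := sqr_ge0 ((Num.sqrt t - Num.sqrt p) + (Num.sqrt t - Num.sqrt q)); lra.
Qed.

Lemma geom_mean_dist (s t : R) : 0 <= s -> 0 <= t ->
  `|Num.sqrt (s * t) - s| <= `|s - t|.
Proof.
move=> s0 t0; have a0 := sqrtr_ge0 s; have b0 := sqrtr_ge0 t.
rewrite sqrtrM// -{2 3}(sqr_sqrtr s0) -{2}(sqr_sqrtr t0).
have -> : Num.sqrt s * Num.sqrt t - Num.sqrt s ^+ 2 =
  (Num.sqrt s - Num.sqrt t) * - Num.sqrt s by ring.
rewrite subr_sqr !normrM normrN ler_wpM2l// !ger0_norm//; lra.
Qed.

(** Inverse of [1 - y <= expR (- y)], with [(1 - y) (1 + y + 2 y^2) = 1 + y^2 (1 - 2 y)]. *)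
Lemma expR_le_quad (y : R) : y <= 2^-1 -> expR y <= 1 + y + 2 * y ^+ 2.
Proof.
move=> y2; have : 1 - y <= expR (- y) by exact: expR_ge1Dx.
rewrite expRN => ey.
have y0 : 0 < 1 - y by lra.
rewrite -[expR y]invrK; apply: (@le_trans _ _ (1 - y)^-1).
  by rewrite lef_pV2// posrE invr_gt0 expR_gt0.
rewrite -[_^-1]mul1r ler_pdivrMr//.
have : 0 <= y ^+ 2 * (1 - 2 * y) by rewrite mulr_ge0 ?sqr_ge0//; lra.
lra.
Qed.

End Affinity.

(** * Two-sided comparison of [J] with (p - q)^2 / p *)

Section Renyi.
Context {R : realType}.
Variables p q : R.
Hypotheses (q_gt0 : 0 < q) (qp : q < p) (p_le : p <= 4^-1).

Let J := renyi_div p q.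

Lemma affinity_gt0 : 0 < affinity p q.
Proof.
have q0 := q_gt0; have qlp := qp; have p4 := p_le.
rewrite /affinity ltr_pwDl ?sqrtr_ge0// sqrtr_gt0 mulr_gt0//; lra.
Qed.

Lemma renyi_affinity : expR (- (J / 2)) = affinity p q.
Proof.
have q0 := q_gt0; have qlp := qp; have p4 := p_le.
have -> : - (J / 2) = ln (affinity p q) by rewrite /J /renyi_div -/(affinity p q); lra.
by rewrite lnK// posrE affinity_gt0.
Qed.

Lemma renyi_hellinger : (Num.sqrt p - Num.sqrt q) ^+ 2 <= J.
Proof.
have q0 := q_gt0; have qlp := qp; have p4 := p_le.
have p01 : 0 <= p <= 1 by lra.
have q01 : 0 <= q <= 1 by lra.
have := affinity_le p01 q01; rewrite -renyi_affinity ler_expR; lra.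
Qed.

Lemma hellinger_ge : (p - q) ^+ 2 / (4 * p) <= (Num.sqrt p - Num.sqrt q) ^+ 2.
Proof.
have q0 := q_gt0; have qlp := qp; have p4 := p_le.
have p0 : 0 < 4 * p by lra.
rewrite ler_pdivrMr// -sqr_sqrtB; [|lra|lra].
rewrite ler_wpM2l ?sqr_ge0//.
have -> : 4 * p = (2 * Num.sqrt p) ^+ 2 by rewrite exprMn sqr_sqrtr; lra.
have s0 := sqrtr_ge0 p; have t0 := sqrtr_ge0 q.
have : Num.sqrt q <= Num.sqrt p by rewrite ler_wsqrtr// ltW.
by move=> h; rewrite ler_sqr ?nnegrE; lra.
Qed.

Lemma sqr_diff_le_renyi : (p - q) ^+ 2 <= 4 * p * J.
Proof.
have q0 := q_gt0; have qlp := qp; have p4 := p_le.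
have := le_trans hellinger_ge renyi_hellinger.
rewrite ler_pdivrMr; lra.
Qed.

Lemma renyi_gt0 : 0 < J.
Proof.
have q0 := q_gt0; have qlp := qp; have p4 := p_le.
have h := sqr_diff_le_renyi.
have : 0 < (p - q) ^+ 2 by rewrite exprn_gt0// subr_gt0.
move=> /lt_le_trans/(_ h); rewrite pmulr_rgt0//; lra.
Qed.

Lemma affinity_ge : 1 - (p - q) ^+ 2 / p <= affinity p q.
Proof.
have q0 := q_gt0; have qlp := qp; have p4 := p_le.
have p0 : 0 < p by lra.
have p01 : 0 <= p <= 1 by lra.
have q01 : 0 <= q <= 1 by lra.
rewrite affinityE//.
have h1 : (Num.sqrt p - Num.sqrt q) ^+ 2 <= (p - q) ^+ 2 / p.
  rewrite ler_pdivlMr// -(@sqr_sqrtB _ p q); [|lra|lra].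
  rewrite ler_wpM2l ?sqr_ge0//.
  have {1}-> : p = Num.sqrt p ^+ 2 by rewrite sqr_sqrtr; lra.
  have s0 := sqrtr_ge0 p; have t0 := sqrtr_ge0 q.
  by rewrite ler_sqr ?nnegrE; lra.
have h2 : (Num.sqrt (1 - p) - Num.sqrt (1 - q)) ^+ 2 <= (p - q) ^+ 2 / p.
  have -> : (p - q) ^+ 2 = ((1 - p) - (1 - q)) ^+ 2 by ring.
  rewrite ler_pdivlMr// -(@sqr_sqrtB _ (1 - p) (1 - q)); [|lra|lra].
  rewrite ler_wpM2l ?sqr_ge0//.
  have : p <= Num.sqrt (1 - p) ^+ 2 by rewrite sqr_sqrtr; lra.
  move=> /le_trans; apply.
  have s0 := sqrtr_ge0 (1 - p); have t0 := sqrtr_ge0 (1 - q).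
  by rewrite ler_sqr ?nnegrE; lra.
lra.
Qed.

Lemma affinity_ge_half : 2^-1 <= affinity p q.
Proof.
have q0 := q_gt0; have qlp := qp; have p4 := p_le.
apply: le_trans affinity_ge.
have : (p - q) ^+ 2 / p <= p.
  rewrite ler_pdivrMr; last by lra.
  by rewrite -expr2 ler_sqr ?nnegrE; lra.
lra.
Qed.

(** For [x = affinity p q] one has [1 + J / 2 <= expR (J / 2) = 1 / x <= 1 + 2 (1 - x)], the last
    step because [x] is at least 1/2; [affinity_ge] then bounds [1 - x]. *)
Lemma renyi_le : J <= 4 * ((p - q) ^+ 2 / p).
Proof.
have q0 := q_gt0; have qlp := qp; have p4 := p_le.
have a0 := affinity_gt0; have a2 := affinity_ge_half; have a1 := affinity_ge.
have : 1 + J / 2 <= (affinity p q)^-1.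
  by rewrite -renyi_affinity -expRN opprK; exact: expR_ge1Dx.
have : (affinity p q)^-1 <= 1 + 2 * (1 - affinity p q).
  rewrite -[leLHS]mul1r ler_pdivrMr//.
  have : 0 <= (1 - affinity p q) * (2 * affinity p q - 1).
    apply: mulr_ge0; last by lra.
    by rewrite subr_ge0 affinity_le1; lra.
  lra.
lra.
Qed.

(** * Cost of the window for one moved pair *)

Section EdgeFactor.
Variables C delta : R.
Hypotheses (pC : p <= C * q) (d_ge0 : 0 <= delta) (dC : delta * (4 * C) <= 1).
Let w := delta * (p - q).

Lemma window_width : 4 * w <= q.
Proof.
have q0 := q_gt0; have qlp := qp; have p4 := p_le; have pCq := pC.
have d0 := d_ge0; have dC1 := dC.
rewrite /w; have : delta * (p - q) <= delta * (C * q).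
  by rewrite ler_wpM2l//; lra.
have := ler_wpM2r (ltW q_gt0) dC; lra.
Qed.

Lemma C_ge1 : 1 <= C.
Proof.
have q0 := q_gt0; have qlp := qp; have pCq := pC.
have : q < C * q by lra.
by rewrite -{1}[q]mul1r ltr_pM2r// => /ltW.
Qed.

(** [u] bounds [w] times the score of a present edge at either level, and [K], which equals
    [delta (p - q)^2 / q], is the unit in which all error terms are measured. *)
Let u := w / q.
Let K := u * (p - q).

Lemma window_ratio : [/\ 0 <= w, 0 <= u, u <= 4^-1 & u * q = w].
Proof.
have q0 := q_gt0; have qlp := qp; have d0 := d_ge0; have wq := window_width.
have w0 : 0 <= w by rewrite mulr_ge0// subr_ge0 ltW.
split=> //; first by rewrite divr_ge0// ltW.
  by rewrite ler_pdivrMr//; lra.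
by rewrite /u mulfVK// gt_eqF.
Qed.

Lemma scaled_inv_le t : q <= t -> t <= p ->
  0 <= w * t^-1 <= u /\ 0 <= w * (1 - t)^-1 <= 2 * w.
Proof.
have q0 := q_gt0; have qlp := qp; have p4 := p_le.
have [w0 u0 u4 uq] := window_ratio.
move=> qt tp; have t0 : 0 < t by lra.
have t1 : 0 < 1 - t by lra.
have i0 : 0 <= t^-1 by rewrite invr_ge0 ltW.
have i1 : 0 <= (1 - t)^-1 by rewrite invr_ge0 ltW.
rewrite (mulr_ge0 w0 i0) (mulr_ge0 w0 i1) /=; split.
  by rewrite ler_wpM2l// lef_pV2 ?posrE.
rewrite mulrC ler_wpM2r//.
by rewrite -[leLHS]mul1r ler_pdivrMr//; lra.
Qed.

(** The score has mean zero: for [A = t] and [B = 1 - t] the two terms cancel. Only the deviations,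
    at most [p - q], are left, so the first order is of size [delta (p - q)^2 / q], comparable with
    [delta J]. *)
Lemma first_order_le (A B t : R) : q <= t -> t <= p -> `|A - t| <= p - q ->
    `|B - (1 - t)| <= p - q ->
  - (3 / 2 * K) <= A * (w * t^-1) - B * (w * (1 - t)^-1) <= 3 / 2 * K.
Proof.
have q0 := q_gt0; have qlp := qp; have p4 := p_le.
have [w0 u0 u4 uq] := window_ratio.
move=> qt tp At Bt.
have t0 : 0 < t by lra.
have t1 : 0 < 1 - t by lra.
have [/andP[z0 z1] /andP[z2 z3]] := scaled_inv_le qt tp.
have -> : A * (w * t^-1) - B * (w * (1 - t)^-1) =
    (A - t) * (w * t^-1) - (B - (1 - t)) * (w * (1 - t)^-1).
  by field; rewrite !gt_eqF.
have h1 : `|(A - t) * (w * t^-1)| <= K.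
  by rewrite normrM (ger0_norm z0) /K mulrC ler_pM.
have h2 : `|(B - (1 - t)) * (w * (1 - t)^-1)| <= K / 2.
  rewrite normrM (ger0_norm z2) /K mulrC.
  have -> : u * (p - q) / 2 = (u / 2) * (p - q) by ring.
  rewrite ler_pM// (le_trans z3)// -uq.
  have := ler_wpM2l u0 p4; have := ler_wpM2l u0 (ltW qlp); lra.
by move: h1 h2; rewrite !ler_norml => /andP[? ?] /andP[? ?]; apply/andP; split; lra.
Qed.

(** The chain is [A u^2 <= C q u^2 = C w u = C delta K], and [4 C delta <= 1]. *)
Lemma second_order_le (A : R) : 0 <= A -> A <= p -> A * u ^+ 2 <= K / 4.
Proof.
have q0 := q_gt0; have qlp := qp; have pCq := pC; have dC1 := dC.
have [w0 u0 u4 uq] := window_ratio.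
have K0 : 0 <= K by rewrite mulr_ge0// subr_ge0 ltW.
move=> A0 Ap; apply: (@le_trans _ _ (C * q * u ^+ 2)).
  by rewrite ler_wpM2r ?sqr_ge0//; lra.
have -> : C * q * u ^+ 2 = (delta * (4 * C)) * K / 4.
  rewrite expr2 (_ : C * q * (u * u) = C * u * (u * q)); last by ring.
  by rewrite uq /K /w; field.
by have := ler_wpM2r K0 dC1; lra.
Qed.

Lemma second_order1_le : (2 * w) ^+ 2 <= K / 4.
Proof.
have q0 := q_gt0; have qlp := qp; have dC1 := dC; have p4 := p_le.
have d0 := d_ge0; have C1 := C_ge1.
have [w0 u0 u4 uq] := window_ratio.
have K0 : 0 <= K by rewrite mulr_ge0// subr_ge0 ltW.
have d4 : delta <= 4^-1.
  by have := ler_wpM2l d0 C1; lra.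
have -> : (2 * w) ^+ 2 = 4 * (q * delta) * K.
  rewrite expr2 (_ : 2 * w * (2 * w) = 4 * (u * q) * w); last by rewrite uq; ring.
  by rewrite /K /w; ring.
have : q * delta <= 4^-1 * 4^-1 by rewrite ler_pM//; lra.
move=> /(ler_wpM2r K0); lra.
Qed.

Lemma sgnN s : sgn (~~ s) = - sgn s :> R.
Proof. by case: s; rewrite /= ?opprK. Qed.

(** The absolute value of [y] is at most [k + k^2 <= 5/4 k], and [25/8] is twice the square of
    [5/4]. *)
Lemma exponent_le (k e1 e2 : R) (s s' : bool) : 0 <= k <= 4^-1 ->
  0 <= e1 <= k -> 0 <= e2 <= k ->
  let y := (sgn s * e1 - sgn s' * e2 + 2 * e2 ^+ 2) / 2 in
  y <= 2^-1 /\ 2 * y ^+ 2 <= 25 / 8 * k ^+ 2.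
Proof.
move=> /andP[k0 k4] /andP[e10 e1k] /andP[e20 e2k] y.
have s1 : - k <= sgn s * e1 <= k by rewrite /sgn; case: s {y}; lra.
have s2 : - k <= sgn s' * e2 <= k by rewrite /sgn; case: s' {y}; lra.
have e2k2 : 0 <= e2 ^+ 2 <= k * 4^-1 by rewrite sqr_ge0/= expr2 ler_pM//; lra.
have yk : `|y| <= 5 / 4 * k by rewrite ler_norml /y; lra.
split; first by move: yk; rewrite ler_norml; lra.
have : y ^+ 2 <= (5 / 4 * k) ^+ 2.
  by rewrite -[leLHS]real_normK ?num_real// ler_sqr ?nnegrE//; lra.
rewrite exprMn; lra.
Qed.

(** Both exponentials are expanded by [expR_le_quad]. Order zero is the affinity; in order one the
    two outcomes nearly cancel by [first_order_le]; the quadratic terms are multiples of [K]. The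
    constant 9 is not sharp. *)
Lemma edge_factor_add_le (r r' : R) s s' :
  q <= r -> r <= p -> q <= r' -> r' <= p ->
  edge_factor w s s' r r' true + edge_factor w s s' r r' false <=
  affinity r r' + 9 * K.
Proof.
have q0 := q_gt0; have qlp := qp; have p4 := p_le.
move=> rq rp rq' rp'.
have [r0 r0'] : 0 <= r /\ 0 <= r' by lra.
have [r1 r1'] : 0 <= 1 - r /\ 0 <= 1 - r' by lra.
have rr : `|r - r'| <= p - q by rewrite ler_norml; lra.
have [w0 u0 u4 uq] := window_ratio.
have w8 : 0 <= 2 * w <= 4^-1.
  by have := ler_wpM2l u0 p4; have := ler_wpM2l u0 (ltW qlp); lra.
have u4' : 0 <= u <= 4^-1 by rewrite u0.
have [e1 e3] := scaled_inv_le rq rp; have [e2 e4] := scaled_inv_le rq' rp'.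
have [y1h y1q] := exponent_le s s' u4' e1 e2.
have [y0h y0q] := exponent_le (~~ s) (~~ s') w8 e3 e4.
have so := second_order1_le.
rewrite /edge_factor /bern /score /affinity.
(* The score of an absent edge is negative; flipping the sign bits makes this outcome an instance of
   [exponent_le] too. *)
have -> : sgn s * (w * - (1 - r)^-1) = sgn (~~ s) * (w * (1 - r)^-1).
  by rewrite sgnN !mulrN mulNr.
have -> : sgn s' * (w * - (1 - r')^-1) = sgn (~~ s') * (w * (1 - r')^-1).
  by rewrite sgnN !mulrN mulNr.
rewrite mulrN sqrrN.
set y1 := (sgn s * _ - _ + _) / 2 in y1h y1q *.
set y0 := (sgn (~~ s) * _ - _ + _) / 2 in y0h y0q *.
set A := Num.sqrt (r * r'); set B := Num.sqrt ((1 - r) * (1 - r')).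
have A0 : 0 <= A by exact: sqrtr_ge0.
have B0 : 0 <= B by exact: sqrtr_ge0.
have Ap : A <= p.
  rewrite -[leRHS]ger0_norm; last by lra.
  by rewrite -sqrtr_sqr ler_wsqrtr// expr2 ler_pM.
have B1 : B <= 1.
  by rewrite -sqrtr1 ler_wsqrtr// -[leRHS]mulr1 ler_pM//; lra.
have Ey1 : A * expR y1 <= A * (1 + y1 + 2 * y1 ^+ 2).
  by rewrite ler_wpM2l// expR_le_quad.
have Ey0 : B * expR y0 <= B * (1 + y0 + 2 * y0 ^+ 2).
  by rewrite ler_wpM2l// expR_le_quad.
apply: (le_trans (lerD Ey1 Ey0)).
have Ar : `|A - r| <= p - q by rewrite (le_trans _ rr)// geom_mean_dist.
have Ar' : `|A - r'| <= p - q.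
  by rewrite (le_trans _ rr)// (distrC r) /A [r * _]mulrC geom_mean_dist.
have Br : `|B - (1 - r)| <= p - q.
  apply: (le_trans (geom_mean_dist r1 r1')).
  by rewrite (_ : 1 - r - (1 - r') = - (r - r')) ?normrN//; ring.
have Br' : `|B - (1 - r')| <= p - q.
  rewrite /B mulrC; apply: (le_trans (geom_mean_dist r1' r1)).
  by rewrite (_ : 1 - r' - (1 - r) = r - r')//; ring.
have := first_order_le rq rp Ar Br; have := first_order_le rq' rp' Ar' Br'.
have Au := second_order_le A0 Ap.
have q1 := ler_wpM2l A0 y1q.
have q2 := ler_wpM2l B0 y0q.
have Bw : B * (2 * w) ^+ 2 <= K / 4.
  by apply: le_trans so; rewrite ler_piMl// sqr_ge0.
have s1 : A * (w * r'^-1) ^+ 2 <= K / 4.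
  by apply: le_trans Au; rewrite ler_wpM2l// ler_sqr ?nnegrE//; case/andP: e2.
have s0 : B * (w * (1 - r')^-1) ^+ 2 <= K / 4.
  by apply: le_trans Bw; rewrite ler_wpM2l// ler_sqr ?nnegrE//; case/andP: w8; case/andP: e4.
move=> fo' fo.
have lin : A * y1 + B * y0 <= 4 * K.
  have -> : A * y1 + B * y0 =
    sgn s * (A * (w * r^-1) - B * (w * (1 - r)^-1)) / 2
    - sgn s' * (A * (w * r'^-1) - B * (w * (1 - r')^-1)) / 2
    + A * (w * r'^-1) ^+ 2 + B * (w * (1 - r')^-1) ^+ 2.
    rewrite /y1 /y0 !sgnN; clear.
    move: A B (sgn s) (sgn s') (w * r^-1) (w * (1 - r)^-1) (w * r'^-1)
      (w * (1 - r')^-1) => A B s1 s2 a b c d; by field.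
  move: fo fo' s1 s0; clear.
  set X := (A * _ - _); set Y := (A * _ - _).
  set X2 := A * _ ^+ 2; set Y2 := B * _ ^+ 2.
  rewrite /sgn; case: s; case: s'; move: X Y X2 Y2 K => X Y X2 Y2 k; lra.
have K0 : 0 <= K by rewrite mulr_ge0// subr_ge0 ltW.
move: lin q1 q2 Au Bw K0; clear.
rewrite [_ * (25 / 8 * _)]mulrCA [B * (25 / 8 * _)]mulrCA.
move: (A * u ^+ 2) (B * (2 * w) ^+ 2) => X Y.
have -> : A * (1 + y1 + 2 * y1 ^+ 2) = A + A * y1 + A * (2 * y1 ^+ 2) by ring.
have -> : B * (1 + y0 + 2 * y0 ^+ 2) = B + B * y0 + B * (2 * y0 ^+ 2) by ring.
move: (A * (2 * y1 ^+ 2)) (B * (2 * y0 ^+ 2)) (A * y1) (B * y0) K => a1 b1 a2 b2 k; lra.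
Qed.

(** The additive error becomes multiplicative because the affinity is at least 1/2:
    [9 K <= 36 C delta J], which is at most [72 C delta J] times the affinity. *)
Lemma edge_factor_le (r r' : R) s s' :
  (r = p \/ r = q) -> (r' = p \/ r' = q) ->
  edge_factor w s s' r r' true + edge_factor w s s' r r' false <=
  affinity r r' * expR (72 * C * delta * J).
Proof.
have q0 := q_gt0; have qlp := qp; have p4 := p_le; have pCq := pC.
have d0 := d_ge0.
move=> rpq rpq'.
have [rq rp] : q <= r /\ r <= p by case: rpq => ->; lra.
have [rq' rp'] : q <= r' /\ r' <= p by case: rpq' => ->; lra.
have C1 := C_ge1; have C0 : 0 <= C by lra.
have J0 := renyi_gt0.
pose D2 := (p - q) ^+ 2 / q.
have D2J : D2 <= 4 * C * J.
  rewrite /D2 ler_pdivrMr//; apply: (le_trans sqr_diff_le_renyi).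
  have := ler_wpM2r (ltW J0) pC; lra.
have KE : K = delta * D2 by rewrite /K /u /w /D2; ring.
have aff2 : 2^-1 <= affinity r r'.
  have h1 : affinity p p = 1 by apply: affinity_refl; lra.
  have h2 : affinity q q = 1 by apply: affinity_refl; lra.
  have h3 := affinity_ge_half.
  have h4 := affinityC p q.
  by case: rpq => ->; case: rpq' => ->; lra.
apply: (le_trans (edge_factor_add_le s s' rq rp rq' rp')).
apply: (@le_trans _ _ (affinity r r' * (1 + 72 * C * delta * J))); last first.
  by rewrite ler_wpM2l ?affinity_ge0// expR_ge1Dx.
have : K <= delta * (4 * C * J) by rewrite KE ler_wpM2l.
have dCJ : 0 <= delta * (C * J) by rewrite mulr_ge0// mulr_ge0// ltW.
have := ler_wpM2r dCJ aff2; lra.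
Qed.

End EdgeFactor.
End Renyi.

(** * Two connectivity levels *)

Section ProductBounds.
Context {R : realType}.

Lemma min1_sqrt (u : R) : 0 <= u -> Num.min 1 u <= Num.sqrt u.
Proof.
move=> u0; have s0 := sqrtr_ge0 u.
rewrite ge_min; have [s1|s1] := leP 1 (Num.sqrt u); first by [].
by rewrite -{1}(sqr_sqrtr u0) expr2 ler_piMl ?orbT// ltW.
Qed.

(** Every term of the expanded product other than [\prod_c a c] has a factor [b] at some [c0]; the
    sum over [c0] overcounts harmlessly and isolates one bad block at a time. *)
Lemma prod_add_le (T : finType) (a b : T -> R) :
  (forall c, 0 <= a c) -> (forall c, 0 <= b c) ->
  \prod_c (a c + b c) <= \prod_c a c +
    \sum_c0 \prod_c (if c == c0 then b c else a c + b c).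
Proof.
move=> a0 b0.
elim: (index_enum T) (index_enum_uniq T) => [_|x s IH /= /andP[xs us]].
  by rewrite !big_nil addr0.
rewrite !big_cons eqxx.
have t0 c0 : 0 <= \prod_(c <- s) (if c == c0 then b c else a c + b c).
  by apply: prodr_ge0 => c _; case: ifP => _; rewrite ?addr_ge0.
have -> : \prod_(c <- s) (if c == x then b c else a c + b c) =
    \prod_(c <- s) (a c + b c).
  rewrite big_seq [RHS]big_seq; apply: eq_bigr => c cs.
  by case: eqP => // cx; rewrite -cx cs in xs.
have h := ler_wpM2l (a0 x) (IH us).
have : a x * (\sum_(c0 <- s) \prod_(c <- s) (if c == c0 then b c else a c + b c))
   <= \sum_(c0 <- s) \prod_(c <- x :: s) (if c == c0 then b c else a c + b c).
  rewrite mulr_sumr big_seq [leRHS]big_seq; apply: ler_sum => c0 c0s.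
  rewrite big_cons; case: eqP => [xc|_]; first by rewrite xc c0s in xs.
  by rewrite ler_wpM2r// lerDl.
lra.
Qed.

Lemma prodr_expR_const (I : finType) (Q : pred I) (z : R) :
  \prod_(i | Q i) expR z = expR (#|Q|%:R * z).
Proof. by rewrite prodr_const expRM_natl. Qed.

End ProductBounds.

Section TwoLevels.
Context {R : realType}.
Variables (k1 k2 p q C delta : R).
Hypotheses (k1_gt0 : 0 < k1) (k2_gt0 : 0 < k2).
Hypotheses (q_gt0 : 0 < q) (qp : q < p) (p_le : p <= 4^-1) (pC : p <= C * q).
Hypotheses (d_gt0 : 0 < delta) (dC : delta * (4 * C) <= 1).
Variables (E T : finType) (diag : pred T) (bs : E -> T) (M : nat).
Hypothesis EM : (0 < M)%N /\ (2 * #|E| <= M)%N.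
Let w := delta * (p - q).
Hypothesis Mw : M%:R^-1 <= w / 2.

Let J := renyi_div p q.
Definition level (c : T) : R := if diag c then p else q.
Implicit Types b : E -> T.

Let level_cases c : level c = p \/ level c = q.
Proof. by rewrite /level; case: ifP; [left|right]. Qed.

Let level01 c : 0 < level c < 1.
Proof.
have q0 := q_gt0; have qlp := qp; have p4 := p_le.
by case: (level_cases c) => ->; lra.
Qed.

Let w_ge0 : 0 <= w.
Proof. by rewrite mulr_ge0 ?(ltW d_gt0)// subr_ge0 ltW. Qed.

Let w_small c : 2 * w <= level c /\ 2 * w <= 1 - level c.
Proof.
have q0 := q_gt0; have qlp := qp; have p4 := p_le; have w0 := w_ge0.
have := window_width q_gt0 qp p_le pC (ltW d_gt0) dC; rewrite -/w => w4.
by case: (level_cases c) => ->; lra.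
Qed.

Definition ratio b (S : T -> set R) (x : {ffun E -> bool}) : R :=
  weight_on k1 k2 b S x / weight_on k1 k2 bs (@unit_itv R T) x.

Definition moved b : pred E := fun e => b e != bs e.
(** Only changed pairs gain [expR (- (J / 2))], whereas every moved pair pays for the window. *)
Definition changed b : pred E := fun e => diag (b e) != diag (bs e).

Lemma near_expect b :
  \sum_x law level bs x * Num.sqrt (ratio b (window level w) x) <=
  2 ^+ #|T| *
  expR (- (J / 2) * #|changed b|%:R + 72 * C * delta * J * #|moved b|%:R).
Proof.
pose V e := expR (72 * C * delta * J) *
  (if changed b e then expR (- (J / 2)) else 1).
have VE : \prod_(e | moved b e) V e =
    expR (- (J / 2) * #|changed b|%:R + 72 * C * delta * J * #|moved b|%:R).
  rewrite /V big_split/= prodr_expR_const -big_mkcondr/=.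
  rewrite (eq_bigl (changed b)); last first.
    move=> e; rewrite /moved /changed.
    by case: eqVneq => [->|]; rewrite ?eqxx.
  by rewrite prodr_expR_const -expRD addrC ![#|_|%:R * _]mulrC.
rewrite -VE.
apply: (sqrt_weight_window_le k1_gt0 k2_gt0 level01 w_ge0 w_small _ EM).
move=> e s s' De.
have := edge_factor_le q_gt0 qp p_le pC (ltW d_gt0) dC s s'
  (level_cases (b e)) (level_cases (bs e)).
move=> /le_trans; apply; rewrite /V mulrC ler_wpM2l ?expR_ge0//.
have q0 := q_gt0; have qlp := qp; have p4 := p_le.
rewrite /changed /level; case: (diag (b e)); case: (diag (bs e)) => /=.
- by rewrite affinity_refl//; lra.
- by rewrite -/J -(renyi_affinity q_gt0 qp p_le).
- by rewrite affinityC -(renyi_affinity q_gt0 qp p_le).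
- by rewrite affinity_refl//; lra.
Qed.

Definition far_from (c0 c : T) : set R :=
  if c == c0 then `]0, 1[%classic `\` window level w c0 else `]0, 1[%classic.

Definition common b (c : T) : pred E := fun e => (b e == c) && (bs e == c).

(** Pairs in block [c0] under both [b] and [bs] compare the true level with a parameter at distance
    at least [w / 2]; all other affinities are bounded by 1. The constant 288 is the product of 2
    from [affinity_le], 36 from [sqrt_far] at [w / 2] and 4 from [renyi_le]. *)
Lemma far_expect b c0 :
  \sum_x law level bs x * Num.sqrt (ratio b (far_from c0) x) <=
  poly_cst k1 k2 M ^+ #|T| *
  expR (- (delta ^+ 2 * J / 288) * #|common b c0|%:R).
Proof.
have q0 := q_gt0; have qlp := qp; have p4 := p_le; have d0 := d_gt0.
have w0 := w_ge0.
have m01 : measurable (`]0, 1[%classic : set R) by exact: measurable_itv.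
(* A grid point within [1 / M <= w / 2] of a point outside the window is still [w / 2] away from the
   level. *)
pose G c : pred R := fun t => if c == c0 then w / 2 <= `|t - level c0| else true.
apply: (sqrt_weight_ratio_le k1_gt0 k2_gt0 level01 EM (G := G)).
- move=> c; rewrite /far_from; case: ifP => _ //.
  apply: measurableD => //; exact: measurable_window.
- by move=> c; rewrite /far_from; case: ifP => _ // t [].
- move=> c s t; rewrite /far_from /G; case: ifP => // _ [_ nw] st.
  have {}nw : w < `|t - level c0| by rewrite ltNge; apply/negP.
  have : `|t - level c0| <= `|s - t| + `|s - level c0|.
    have -> : t - level c0 = - (s - t) + (s - level c0) by ring.
    by rewrite -(normrN (s - t)) ler_normD.
  have := Mw; lra.
- exact: expR_ge0.
move=> t Gt.
have aff01 e : 0 <= affinity (t (b e)) (level (bs e)) <= 1.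
  rewrite affinity_ge0/= affinity_le1//; first by case: (Gt (b e)).
  by have := level01 (bs e); lra.
apply: (@le_trans _ _ (\prod_(e | common b c0 e) affinity (t (b e)) (level (bs e)))).
  rewrite (bigID (common b c0))/= ler_piMr//; last by apply: prodr_ile1.
  by apply: prodr_ge0 => e _; case/andP: (aff01 e).
rewrite mulrC -prodr_expR_const; apply: ler_prod => e /andP[/eqP be /eqP bse].
have /andP[-> _] /= := aff01 e.
have [tc t01] := Gt c0; rewrite /G eqxx in tc.
have l01 : 0 <= level c0 <= 1 by have := level01 c0; lra.
rewrite be bse; apply: (le_trans (affinity_le t01 l01)).
rewrite ler_expR lerN2.
have p0 : 0 < p by lra.
have lp : level c0 <= p by case: (level_cases c0) => ->; lra.
have w4 := window_width q_gt0 qp p_le pC (ltW d_gt0) dC; rewrite -/w in w4.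
have h : (w / 2) ^+ 2 / (9 * p) <= (Num.sqrt (t c0) - Num.sqrt (level c0)) ^+ 2.
  by apply: sqrt_far => //; [lra|lra|lra|lra].
have : delta ^+ 2 * J <= delta ^+ 2 * (4 * ((p - q) ^+ 2 / p)).
  by rewrite ler_wpM2l ?sqr_ge0// (renyi_le q_gt0 qp p_le).
have -> : delta ^+ 2 * (4 * ((p - q) ^+ 2 / p)) = 4 * (36 * ((w / 2) ^+ 2 / (9 * p))).
  by rewrite /w; field; rewrite gt_eqF.
lra.
Qed.

(** One parameter [t c] has to fit [N] pairs of level [p] and [N] of level [q]. The constant 64
    collects a 4 from [affinity_le] with [sqrt_sep], a 4 from [hellinger_ge] and a 4 from
    [renyi_le]. *)
Lemma mixed_expect b c (N : nat) :
  (N <= #|[pred e | (b e == c) && diag (bs e)]|)%N ->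
  (N <= #|[pred e | (b e == c) && ~~ diag (bs e)]|)%N ->
  \sum_x law level bs x * Num.sqrt (ratio b (@unit_itv R T) x) <=
  poly_cst k1 k2 M ^+ #|T| * expR (- (J / 64) * N%:R).
Proof.
move=> N1 N2.
have q0 := q_gt0; have qlp := qp; have p4 := p_le.
have m01 : measurable (`]0, 1[%classic : set R) by exact: measurable_itv.
apply: (sqrt_weight_ratio_le k1_gt0 k2_gt0 level01 EM (G := fun=> predT)) => //.
  by move=> ? ?.
move=> t Gt.
have t01 c' : 0 <= t c' <= 1 by case: (Gt c').
pose hp := expR (- ((Num.sqrt (t c) - Num.sqrt p) ^+ 2 / 2)).
pose hq := expR (- ((Num.sqrt (t c) - Num.sqrt q) ^+ 2 / 2)).
have hp1 : hp <= 1 by rewrite expR_le1 oppr_le0 divr_ge0// sqr_ge0.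
have hq1 : hq <= 1 by rewrite expR_le1 oppr_le0 divr_ge0// sqr_ge0.
have aff01 e : 0 <= affinity (t (b e)) (level (bs e)) <= 1.
  rewrite affinity_ge0/= affinity_le1//.
  by have := level01 (bs e); lra.
apply: (@le_trans _ _ (hp ^+ N * hq ^+ N)); last first.
  rewrite -exprMn -expRD expRM_natr; apply: lerXn2r; rewrite ?nnegrE ?expR_ge0//= ler_expR.
  have := sqrt_sep (t c) p q.
  have := hellinger_ge q_gt0 qp p_le.
  have := renyi_le q_gt0 qp p_le; rewrite -/J.
  have -> : (p - q) ^+ 2 / (4 * p) = (p - q) ^+ 2 / p / 4.
    by field; rewrite gt_eqF//; lra.
  set a := (Num.sqrt p - Num.sqrt q) ^+ 2.
  have : 0 <= a by exact: sqr_ge0.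
  lra.
rewrite (bigID (fun e => b e == c))/=.
apply: (@le_trans _ _ (\prod_(e | b e == c) affinity (t (b e)) (level (bs e)))).
  rewrite ler_piMr//; last by apply: prodr_ile1.
  by apply: prodr_ge0 => e _; case/andP: (aff01 e).
rewrite (bigID (fun e => diag (bs e)))/=.
have q01 : 0 <= q <= 1 by lra.
have p01 : 0 <= p <= 1 by lra.
apply: ler_pM.
- by apply: prodr_ge0 => e _; case/andP: (aff01 e).
- by apply: prodr_ge0 => e _; case/andP: (aff01 e).
- apply: (@le_trans _ _ (hp ^+ #|[pred e | (b e == c) && diag (bs e)]|)); last first.
    by rewrite ler_wiXn2l// expR_ge0.
  rewrite -prodr_const; apply: ler_prod => e /andP[/eqP be de].
  have /andP[-> _] /= := aff01 e.
  by rewrite be /level de affinity_le.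
- apply: (@le_trans _ _ (hq ^+ #|[pred e | (b e == c) && ~~ diag (bs e)]|)); last first.
    by rewrite ler_wiXn2l// expR_ge0.
  rewrite -prodr_const; apply: ler_prod => e /andP[/eqP be /negbTE de].
  have /andP[-> _] /= := aff01 e.
  by rewrite be /level de affinity_le.
Qed.

Lemma weight_true_pos x : 0 < weight_on k1 k2 bs (@unit_itv R T) x.
Proof. exact: (weight_true_gt0 k1_gt0 k2_gt0 bs level01 EM). Qed.

Lemma mixed_min_expect b c (N : nat) :
  (N <= #|[pred e | (b e == c) && diag (bs e)]|)%N ->
  (N <= #|[pred e | (b e == c) && ~~ diag (bs e)]|)%N ->
  \sum_x law level bs x * Num.min 1 (ratio b (@unit_itv R T) x) <=
  poly_cst k1 k2 M ^+ #|T| * expR (- (J / 64) * N%:R).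
Proof.
move=> N1 N2; apply: le_trans (mixed_expect N1 N2); apply: ler_sum => x _.
rewrite ler_wpM2l ?(ltW (law_gt0 _ level01 _))// min1_sqrt//.
rewrite divr_ge0 ?(ltW (weight_true_pos x))// prodr_ge0// => c' _.
by apply: beta_int_ge0 => //; exact: unit_fun_lik.
Qed.

(* Each Beta integral over ]0, 1[ is split into the window around the true level
   and its complement; a term of the expanded product with a factor outside a
   window is exponentially small. *)
Lemma close_min_expect b :
  \sum_x law level bs x * Num.min 1 (ratio b (@unit_itv R T) x) <=
  2 ^+ #|T| *
  expR (- (J / 2) * #|changed b|%:R + 72 * C * delta * J * #|moved b|%:R) +
  \sum_c poly_cst k1 k2 M ^+ #|T| *
    expR (- (delta ^+ 2 * J / 288) * #|common b c|%:R).
Proof.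
have m01 : measurable (`]0, 1[%classic : set R) by exact: measurable_itv.
apply: (@le_trans _ _ (\sum_x law level bs x * Num.sqrt (ratio b (window level w) x) +
  \sum_c \sum_x law level bs x * Num.sqrt (ratio b (far_from c) x))); last first.
  apply: lerD; first exact: near_expect.
  by apply: ler_sum => c _; exact: far_expect.
rewrite exchange_big/= -big_split/=; apply: ler_sum => x _.
rewrite -mulr_sumr -mulrDr ler_wpM2l ?(ltW (law_gt0 _ level01 _))//.
have W0 := weight_true_pos x.
have winsub c : window level w c `<=` `]0, 1[ by apply: (window_sub level01 w_small).
have mwin c : measurable (window level w c) by exact: measurable_window.
have bi0 S c : S `<=` `]0, 1[ -> 0 <= beta_int k1 k2 S (lik (block b c) x).
  by move=> S01; apply: beta_int_ge0 => //; exact: unit_fun_lik.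
have Wn0 : 0 <= weight_on k1 k2 b (window level w) x.
  by apply: prodr_ge0 => c _; exact: bi0.
have farsub c0 c : far_from c0 c `<=` `]0, 1[.
  by rewrite /far_from; case: ifP => _ // t [].
have Wf0 c0 : 0 <= weight_on k1 k2 b (far_from c0) x.
  by apply: prodr_ge0 => c _; exact: bi0.
have split : weight_on k1 k2 b (@unit_itv R T) x <=
    weight_on k1 k2 b (window level w) x + \sum_c weight_on k1 k2 b (far_from c) x.
  rewrite /weight_on /unit_itv.
  have E1 c : beta_int k1 k2 `]0, 1[ (lik (block b c) x) =
    beta_int k1 k2 (window level w c) (lik (block b c) x) +
    beta_int k1 k2 (`]0, 1[%classic `\` window level w c) (lik (block b c) x).
    by apply: beta_int_split => //; exact: unit_fun_lik.
  under eq_bigr do rewrite E1.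
  apply: le_trans (prod_add_le _ _) _.
  - by move=> c; exact: bi0.
  - by move=> c; apply: bi0 => t [].
  rewrite lerD2l; apply: ler_sum => c0 _.
  rewrite le_eqVlt; apply/orP; left; apply/eqP; apply: eq_bigr => c _.
  by rewrite /far_from; case: eqP => // ->.
have u0 : 0 <= ratio b (@unit_itv R T) x.
  rewrite divr_ge0 ?(ltW W0)// prodr_ge0// => c _; exact: bi0.
apply: (le_trans (min1_sqrt u0)).
apply: (@le_trans _ _ (Num.sqrt (ratio b (window level w) x +
    \sum_c ratio b (far_from c) x))).
  rewrite ler_wsqrtr// /ratio -mulr_suml -mulrDl ler_wpM2r// invr_ge0 ltW//.
have rf0 c : 0 <= ratio b (far_from c) x by rewrite divr_ge0// ltW.
apply: (le_trans (sqrt_add_le _ _)).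
- by rewrite divr_ge0// ltW.
- by apply: sumr_ge0 => c _.
by rewrite lerD2l sqrt_sum_le.
Qed.

End TwoLevels.

(** * Pairs of vertices and their blocks *)

(** The index set is written as in [sbm_adjacency], so that the product rule for independent events
    becomes a product over this type; [block_index] likewise matches the product in
    [posterior_weight]. *)
Definition edge (n : nat) : finType :=
  {ij : 'I_n * 'I_n | ij \in [set ij : 'I_n * 'I_n | (ij.1 < ij.2)%N]%SET}.

Definition block_index (K : nat) : finType :=
  {ab : 'I_K * 'I_K | ab \in [pred ab : 'I_K * 'I_K | (ab.1 <= ab.2)%N]}.

Section Edges.
Local Open Scope nat_scope.
Variable n : nat.
Implicit Types (e : edge n) (i j : 'I_n).

Definition src (e : edge n) : 'I_n := (val e).1.
Definition dst (e : edge n) : 'I_n := (val e).2.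

Lemma edge_lt e : (src e) < (dst e).
Proof. by have := valP e; rewrite inE. Qed.

Lemma sum_edge (F : 'I_n -> 'I_n -> nat) :
  \sum_(ij : 'I_n * 'I_n | ij.1 < ij.2) F ij.1 ij.2 =
  \sum_(e : edge n) F (src e) (dst e).
Proof.
rewrite -(big_sub _ (fun ij : 'I_n * 'I_n => F ij.1 ij.2)).
by apply: eq_bigl => ij; rewrite inE.
Qed.

Lemma sum_pairs_edges (g : 'I_n -> 'I_n -> nat) :
  \sum_i \sum_j g i j =
  \sum_(e : edge n) (g (src e) (dst e) + g (dst e) (src e)) + \sum_i g i i.
Proof.
rewrite pair_bigA/= (bigID (fun ij : 'I_n * 'I_n => ij.1 < ij.2))/=.
rewrite big_split/= sum_edge -addnA; congr (_ + _).
rewrite (bigID (fun ij : 'I_n * 'I_n => ij.2 < ij.1))/=; congr (_ + _).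
  rewrite -(sum_edge (fun i j => g j i)).
  rewrite (reindex_inj (h := fun ij : 'I_n * 'I_n => (ij.2, ij.1)))/=.
    by apply: eq_bigl => -[i j]/=; rewrite -leqNgt; case: ltngtP.
  by move=> [i j] [i' j'] [-> ->].
rewrite (reindex_omap (fun i : 'I_n => (i, i)) (fun ij => Some ij.1))/=.
  by apply: eq_bigl => i; rewrite ltnn eqxx.
move=> [i j] /=; rewrite -!leqNgt => /andP[ji ij].
by have -> : i = j by apply/val_inj/eqP; rewrite eqn_leq ij ji.
Qed.

(** Off the diagonal, an ordered pair in [A] times [B] comes from an edge of [Q]; each edge arises
    at most twice, and the diagonal has [n] points. *)
Lemma pairs_card_le (A B : pred 'I_n) (Q : pred (edge n)) :
  (forall e, A (src e) && B (dst e) -> Q e) ->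
  (forall e, A (dst e) && B (src e) -> Q e) ->
  #|A| * #|B| <= 2 * #|Q| + n.
Proof.
move=> h1 h2.
have -> : #|A| * #|B| = \sum_i \sum_j (A i && B j).
  rewrite -!sum1_card big_distrl/= big_mkcond/=; apply: eq_bigr => i _.
  rewrite mul1n big_mkcond/= unfold_in; case: (A i) => /=.
    by apply: eq_bigr => j _; rewrite unfold_in; case: (B j).
  by rewrite big1.
rewrite sum_pairs_edges; apply: leq_add.
  rewrite -sum1_card big_distrr/= [leqRHS]big_mkcond/=; apply: leq_sum => e _.
  rewrite unfold_in; have := h1 e; have := h2 e.
  case: (A (src e) && _); case: (A (dst e) && _) => //=; case: (Q e) => //= a b;
    by [have := a isT|have := b isT].
rewrite -[leqRHS](card_ord n) -sum1_card; apply: leq_sum => i _.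
by case: (_ && _).
Qed.

Lemma touched_card_le (D : pred 'I_n) (Q : pred (edge n)) :
  (forall e, Q e -> D (src e) || D (dst e)) -> #|Q| <= #|D| * n.
Proof.
move=> h.
have -> : #|D| * n = \sum_i \sum_(j < n) D i.
  rewrite -sum1_card big_distrl/= big_mkcond/=; apply: eq_bigr => i _.
  rewrite sum_nat_const card_ord unfold_in.
  by case: (D i); rewrite ?mul1n ?muln1 ?muln0.
rewrite sum_pairs_edges -sum1_card big_mkcond/=.
apply: leq_trans (leq_addr _ _); apply: leq_sum => e _.
rewrite unfold_in; have := h e; case: (Q e) => // /(_ isT).
by case: (D _); case: (D _).
Qed.

Lemma card_edge_le : #|edge n| <= n * n.
Proof.
rewrite card_sig (leq_trans (max_card _))// card_prod card_ord//.
Qed.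

Section Relabelling.
Variables (K : nat) (Y Z : {ffun 'I_n -> 'I_K}).

Definition mismatch : pred 'I_n := fun i => Y i != Z i.

(** For a mismatched [i] and a matched [j] in class [Z i] or [Y i], exactly one of the two
    labellings puts [i] and [j] together. Restricting to matched [j] prevents counting a pair from
    both ends and costs at most the number of mismatches. *)
Lemma changed_card_ge (l : nat) :
  (forall i, mismatch i ->
    l <= #|[pred j | (Z j == Z i) || (Z j == Y i)]|) ->
  #|mismatch| * (l - #|mismatch|) <=
  #|[pred e : edge n | (Y (src e) == Y (dst e)) != (Z (src e) == Z (dst e))]|.
Proof.
move=> hl.
pose h i j := [&& mismatch i, ~~ mismatch j & (Z j == Z i) || (Z j == Y i)].
apply: (@leq_trans (\sum_i \sum_j h i j)).
  rewrite -sum1_card big_distrl/= big_mkcond/=; apply: leq_sum => i _.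
  rewrite unfold_in mul1n; case: ifP => Di; last by [].
  rewrite leq_subLR (leq_trans (hl _ Di))// -sum1_card big_mkcond/=.
  rewrite [X in _ <= X + _]big_mkcond/= -big_split/=.
  have {}Di : mismatch i by [].
  apply: leq_sum => j _; rewrite /h Di inE unfold_in/=.
  by rewrite /mismatch; case: (Y j != Z j); case: (_ || _).
rewrite sum_pairs_edges [X in _ + X <= _]big1 ?addn0; last first.
  by move=> i _; rewrite /h; case: (mismatch i).
rewrite -sum1_card [leqRHS]big_mkcond/=; apply: leq_sum => e _.
have step i j : h i j -> (Y i == Y j) != (Z i == Z j).
  move=> /and3P[]; rewrite /mismatch negbK => YZi /eqP -> /orP[] /eqP ->.
    by rewrite eqxx (negbTE YZi).
  by rewrite eqxx [Z i == _]eq_sym (negbTE YZi).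
rewrite inE; case: ifP => [_|/negbT].
  rewrite /h; case: (mismatch (src e)); case: (mismatch (dst e)) => //=.
    by case: (_ || _).
  by case: (_ || _).
move=> nch.
have -> : h (src e) (dst e) = false.
  by apply/negbTE/negP => /step; apply/negP.
have -> // : h (dst e) (src e) = false.
apply/negbTE/negP => /step; rewrite eq_sym [Y _ == _]eq_sym [Z _ == _]eq_sym eq_sym.
by apply/negP.
Qed.

End Relabelling.

(** * Unordered pairs of labels and overlaps of two labellings *)

Section Blocks.
Variable K : nat.
Implicit Types (a b k l : 'I_K) (c : block_index K) (Y Z : {ffun 'I_n -> 'I_K}).

Definition sort_pair a b : 'I_K * 'I_K := if a <= b then (a, b) else (b, a).

Lemma sort_pair_sorted a b :
  sort_pair a b \in [pred ab : 'I_K * 'I_K | ab.1 <= ab.2].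
Proof.
rewrite /sort_pair; case: ifP => [ab|/negbT ab]; rewrite inE//=.
by rewrite ltnW// ltnNge.
Qed.

Definition pair_block a b : block_index K :=
  exist _ (sort_pair a b) (sort_pair_sorted a b).

Definition fst_label c : 'I_K := (val c).1.
Definition snd_label c : 'I_K := (val c).2.

Definition diagonal c : bool := fst_label c == snd_label c.

Lemma pair_block_diag a b : diagonal (pair_block a b) = (a == b).
Proof.
by rewrite /diagonal /fst_label /snd_label /= /sort_pair; case: ifP => //= _; rewrite eq_sym.
Qed.

Lemma pair_blockE a b c :
  (pair_block a b == c) = ((a == fst_label c) && (b == snd_label c)) ||
                          ((a == snd_label c) && (b == fst_label c)).
Proof.
case: c => [[x y] xy]; rewrite -val_eqE /fst_label /snd_label /= /sort_pair.
have {xy} : x <= y by have := xy; rewrite inE.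
by case: ifP; rewrite xpair_eqE -!val_eqE /=; lia.
Qed.

Definition label_block Z (e : edge n) : block_index K :=
  pair_block (Z (src e)) (Z (dst e)).

Lemma common_card_ge Y Z c (A := [pred i | ~~ mismatch Y Z i & Z i == fst_label c])
    (B := [pred i | ~~ mismatch Y Z i & Z i == snd_label c]) :
  #|A| * #|B| <=
  2 * #|[pred e | (label_block Y e == c) && (label_block Z e == c)]| + n.
Proof.
apply: pairs_card_le => e; rewrite /A /B !inE /mismatch !negbK /label_block !pair_blockE.
  by move=> /andP[/andP[/eqP -> /eqP ->] /andP[/eqP -> /eqP ->]]; rewrite !eqxx.
by move=> /andP[/andP[/eqP -> /eqP ->] /andP[/eqP -> /eqP ->]]; rewrite !eqxx !orbT.
Qed.

Definition overlap Z Zs a k : nat := #|[pred i | (Z i == a) && (Zs i == k)]|.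

Lemma overlap_row Z Zs a : class_size Z a = \sum_k overlap Z Zs a k.
Proof.
rewrite /class_size -sum1_card (partition_big Zs predT)//=.
by apply: eq_bigr => k _; rewrite /overlap -sum1_card; apply: eq_bigl => i; rewrite !inE.
Qed.

Lemma overlap_col Z Zs k : class_size Zs k = \sum_a overlap Z Zs a k.
Proof.
rewrite /class_size -sum1_card (partition_big Z predT)//=.
apply: eq_bigr => a _; rewrite /overlap -sum1_card; apply: eq_bigl => i.
by rewrite !inE andbC.
Qed.

Lemma exists_heavy (F : 'I_K -> nat) h : 0 < h -> K * h <= \sum_k F k ->
  0 < K -> exists k, h <= F k.
Proof.
move=> h0 hF K0; apply/existsP; apply: contraLR hF; rewrite negb_exists -ltnNge => /forallP hk.
apply: (@leq_ltn_trans (\sum_(k < K) h.-1)).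
  by apply: leq_sum => k _; have := hk k; rewrite -ltnNge; lia.
by rewrite sum_nat_const card_ord; nia.
Qed.

(* If no class of [Z] meets two classes of [Zs] in [h] points each, then every
   class of [Z] has a single heavy class of [Zs]; this map of labels is onto,
   hence a permutation, and only the light overlaps are mismatches. *)
Lemma mixed_or_close Z Zs h : 0 < K -> 0 < h ->
  (forall a, K * h <= class_size Z a) -> (forall k, K * h <= class_size Zs k) ->
  (exists c, h * h <= 2 * #|[pred e | (label_block Z e == c) && diagonal (label_block Zs e)]| + n
        /\ h * h <= 2 * #|[pred e | (label_block Z e == c) && ~~ diagonal (label_block Zs e)]| + n)
  \/ exists s : {perm 'I_K},
       #|mismatch [ffun i => s (Z i)] Zs| <= K * K * h.
Proof.
move=> K0 h0 hZ hZs.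
have [/existsP[a /existsP[k /existsP[l /and3P[kl hk hl]]]]|nomix] :=
    boolP [exists a, exists k, exists l,
      [&& k != l, h <= overlap Z Zs a k & h <= overlap Z Zs a l]].
  (* Under [Zs], two points of the overlap of [a] with [k] share a class, while one of them and a
     point of the overlap with [l] do not; [Z] puts all these pairs in the block of [a] with
     itself. *)
  left; exists (pair_block a a); split.
    apply: (leq_trans (leq_mul hk hk)); apply: pairs_card_le => e;
    rewrite !inE /label_block pair_block_diag => /andP[/andP[/eqP -> /eqP ->] /andP[/eqP -> /eqP ->]];
    by rewrite !eqxx.
  apply: (leq_trans (leq_mul hk hl)); apply: pairs_card_le => e;
  rewrite !inE /label_block pair_block_diag => /andP[/andP[/eqP -> /eqP ->] /andP[/eqP -> /eqP ->]];
  by rewrite eqxx //= eq_sym.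
right.
have uniq_heavy a k l : h <= overlap Z Zs a k -> h <= overlap Z Zs a l -> k = l.
  move=> hk hl; apply/eqP; apply: contraNT nomix => kl.
  apply/existsP; exists a; apply/existsP; exists k; apply/existsP; exists l.
  by rewrite kl hk hl.
have heavy a : {k | h <= overlap Z Zs a k}.
  apply: sigW; apply: exists_heavy => //; by rewrite -overlap_row.
pose sg a := sval (heavy a).
have sgP a : h <= overlap Z Zs a (sg a) := svalP (heavy a).
have onto k : k \in codom sg.
  have [a ha] : exists a, h <= overlap Z Zs a k.
    by apply: exists_heavy => //; rewrite -overlap_col.
  by apply/codomP; exists a; apply: uniq_heavy ha (sgP a).
have sg_inj : injective sg.
  apply/injectiveP; rewrite /injectiveb /dinjectiveb -/(codom sg).
  apply/card_uniqP; rewrite size_codom; apply: eq_card => k; by rewrite onto.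
exists (perm sg_inj).
apply: (@leq_trans (\sum_(ak : 'I_K * 'I_K) h)); last first.
  by rewrite sum_nat_const card_prod card_ord.
rewrite -sum1_card (partition_big (fun i => (Z i, Zs i)) predT)//=.
apply: leq_sum => -[a k] _.
have [ka|ka] := eqVneq k (sg a).
  rewrite big1 // => i; rewrite unfold_in /mismatch ffunE permE.
  by move=> /andP[+ /eqP[Zia Zik]]; rewrite Zia Zik ka eqxx.
apply: (@leq_trans (overlap Z Zs a k)); last first.
  rewrite leqNgt; apply/negP => hk; case/eqP: ka.
  by apply: uniq_heavy (sgP a); exact: ltnW.
rewrite /overlap -sum1_card big_mkcond [leqRHS]big_mkcond; apply: leq_sum => i _.
rewrite inE xpair_eqE; case: (_ && (_ == k)); rewrite ?andbF//.
by case: ifP.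
Qed.

End Blocks.
End Edges.

(** * The posterior as a block model *)

Section Adjacency.
Variable n : nat.
Implicit Types (x : {ffun edge n -> bool}) (i j : 'I_n) (e : edge n).

Definition graph x : 'M[bool]_n := \matrix_(i, j)
  if insub (i, j) is Some e then x e
  else if insub (j, i) is Some e then x e else false.

Lemma insub_edge e : insub (src e, dst e) = Some e.
Proof. by rewrite -surjective_pairing valK. Qed.

Lemma insub_not_edge i j : (j <= i)%N ->
  insub (i, j) = None :> option (edge n).
Proof. by move=> ji; rewrite insubF// inE/= ltnNge ji. Qed.

Lemma graph_edge x e : graph x (src e) (dst e) = x e.
Proof. by rewrite mxE insub_edge. Qed.

Lemma graph_edgeC x e : graph x (dst e) (src e) = x e.
Proof. by rewrite mxE insub_not_edge ?(ltnW (edge_lt e))// insub_edge. Qed.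

Lemma graph_diag x i : graph x i i = false.
Proof. by rewrite mxE insub_not_edge. Qed.

Variable K : nat.
Implicit Types (Z : {ffun 'I_n -> 'I_K}) (c : block_index K).

Lemma num_edges_graph x Z c :
  num_edges (graph x) Z (fst_label c) (snd_label c) =
  (\sum_(e | block (label_block Z) c e) x e)%N.
Proof.
rewrite /num_edges; case: ifP => [/eqP ac|/negbT ac].
  rewrite pair_big_dep/=.
  rewrite (@sum_edge n (fun i j => [&& graph x i j, Z i == fst_label c & Z j == fst_label c] : nat)).
  rewrite [RHS]big_mkcond/=; apply: eq_bigr => e _.
  rewrite graph_edge /block /label_block pair_blockE -ac orbb.
  by case: (_ && (Z (dst e) == _)); rewrite ?andbT ?andbF.
rewrite sum_pairs_edges [X in (_ + X)%N]big1 ?addn0; last first.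
  by move=> i _; rewrite graph_diag.
rewrite [RHS]big_mkcond/=; apply: eq_bigr => e _.
rewrite graph_edge graph_edgeC /block /label_block pair_blockE.
rewrite [(Z (dst e) == _) && _]andbC.
case: (x e) => /=; last by case: ifP.
case: eqVneq => [->|] /=; last by case: (_ && _).
by rewrite (negbTE ac)/= addn0; case: (_ == _).
Qed.

(** Ordered pairs are counted in [nat], where a diagonal block yields each edge twice plus the
    loops; the halving in [num_pairs] is dealt with afterwards in the reals. *)
Lemma num_pairs_blocks (R : realType) Z c :
  num_pairs R Z (fst_label c) (snd_label c) = #|block (label_block Z) c|%:R.
Proof.
have main : (class_size Z (fst_label c) * class_size Z (snd_label c) =
   \sum_(e | block (label_block Z) c e) (1 + diagonal c) +
   (if diagonal c then class_size Z (fst_label c) else 0))%N.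
  have -> : (class_size Z (fst_label c) * class_size Z (snd_label c) =
      \sum_i \sum_j ((Z i == fst_label c) && (Z j == snd_label c)))%N.
    rewrite /class_size -!sum1_card big_distrl/= big_mkcond/=.
    apply: eq_bigr => i _; rewrite mul1n big_mkcond/= inE.
    case: ifP => _; last by rewrite big1.
    by apply: eq_bigr => j _; rewrite inE; case: ifP.
  rewrite sum_pairs_edges; congr (_ + _)%N.
    rewrite [RHS]big_mkcond/=; apply: eq_bigr => e _.
    rewrite /block /label_block pair_blockE /diagonal.
    rewrite [(Z (dst e) == _) && _]andbC.
    case: (eqVneq (fst_label c) (snd_label c)) => [->|ac].
      by rewrite orbb; case: (_ && _).
    case: eqVneq => [->|] /=; last by case: (_ && _).
    by rewrite (negbTE ac)/= ?orbF addn0; case: (_ == _).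
  rewrite /diagonal; case: (eqVneq (fst_label c) (snd_label c)) => [->|ac].
    rewrite /class_size -sum1_card [RHS]big_mkcond/=; apply: eq_bigr => i _.
    by rewrite inE andbb; case: ifP.
  rewrite big1// => i _; case: eqVneq => [->|]//=.
  by rewrite (negbTE ac).
rewrite sum_nat_const in main.
have -> : #|block (label_block Z) c| = #|[pred e | block (label_block Z) c e]|.
  by apply: eq_card.
rewrite /num_pairs -/(diagonal c).
have := congr1 (fun k : nat => k%:R : R) main; rewrite natrM natrD natrM.
move: main => _; case: ifP => dc /=.
  have -> : snd_label c = fst_label c by apply/esym/eqP.
  set m := _%:R; set N := _%:R => mN.
  rewrite mulrBr mulr1 mN; lra.
by rewrite addr0 mulr1 => ->.
Qed.

End Adjacency.

Section PosteriorBlocks.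
Context {R : realType}.
Variables (k1 k2 : R) (n K : nat).
Hypotheses (k1_gt0 : 0 < k1) (k2_gt0 : 0 < k2).
Implicit Types (x : {ffun edge n -> bool}) (Z : {ffun 'I_n -> 'I_K}).

Lemma Beta_beta_int (l m : nat) :
  Beta (l%:R + k1) (m%:R + k2) =
  beta_int k1 k2 `]0, 1[ (fun t => t ^+ l * (1 - t) ^+ m).
Proof.
apply: eq_Rintegral => t; rewrite inE/= in_itv/= => /andP[t0 t1].
have s0 : 0 < 1 - t by rewrite subr_gt0.
rewrite /beta_density -!addrA !powRD ?(gt_eqF t0) ?(gt_eqF s0) ?implybT//.
rewrite !powR_mulrn ?(ltW t0) ?(ltW s0)//; ring.
Qed.

Definition weight Z x : R :=
  weight_on k1 k2 (label_block Z) (@unit_itv R (block_index K)) x.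

Lemma posterior_weight_graph Z x :
  posterior_weight k1 k2 (graph x) Z = weight Z x.
Proof.
rewrite /posterior_weight -[LHS]/(\prod_(ab in [pred ab : 'I_K * 'I_K | (ab.1 <= ab.2)%N]) _).
rewrite big_sub; apply: eq_bigr => c _.
rewrite -/(fst_label c) -/(snd_label c) num_edges_graph num_pairs_blocks.
have -> : #|block (label_block Z) c| =
    (\sum_(e | block (label_block Z) c e) x e +
     \sum_(e | block (label_block Z) c e) ~~ x e)%N.
  rewrite -big_split/= -sum1_card; apply: eq_bigr => e _.
  by case: (x e).
have addBK (u v : R) : u + v - u = v by ring.
rewrite natrD addBK.
rewrite Beta_beta_int; congr (beta_int _ _ _ _); apply/funext => t.
by rewrite lik_count.
Qed.

(** Relabelling permutes the blocks through [phi], and the weight is symmetric in the blocks because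
    all have the same prior. *)
Lemma weight_perm Z (s : {perm 'I_K}) x : weight [ffun i => s (Z i)] x = weight Z x.
Proof.
pose phi (c : block_index K) : block_index K :=
  pair_block (s (fst_label c)) (s (snd_label c)).
have phi_inj : injective phi.
  move=> c c' /eqP; rewrite /phi pair_blockE.
  have fp (u : {perm 'I_K}) c1 : fst_label (pair_block (u (fst_label c1)) (u (snd_label c1)))
      = u (fst_label c1) /\ snd_label (pair_block (u (fst_label c1)) (u (snd_label c1)))
      = u (snd_label c1) \/ fst_label (pair_block (u (fst_label c1)) (u (snd_label c1)))
      = u (snd_label c1) /\ snd_label (pair_block (u (fst_label c1)) (u (snd_label c1)))
      = u (fst_label c1).
    rewrite /fst_label /snd_label /= /sort_pair; case: ifP => _; [by left|by right].
  have lc : pair_block (fst_label c) (snd_label c) = c by apply/eqP; rewrite pair_blockE !eqxx.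
  move=> H; rewrite -lc; apply/eqP; rewrite pair_blockE; move: H.
  case: (fp s c') => -[-> ->]; rewrite !(inj_eq perm_inj)//.
  by rewrite orbC.
rewrite /weight /weight_on.
rewrite [LHS](reindex_inj phi_inj).
apply: eq_bigr => c _.
congr (beta_int _ _ _ _); apply/funext => t; apply: eq_bigl => e.
rewrite /block -[RHS](inj_eq phi_inj); congr (_ == _).
apply/eqP; rewrite /label_block !ffunE /phi pair_blockE.
rewrite /fst_label /snd_label /= /sort_pair.
case: ifP => _; case: ifP => _ /=; by rewrite !eqxx ?orbT.
Qed.

Lemma weight_gt0 Z x : 0 < weight Z x.
Proof.
have h : (0 < (2 * #|edge n|).+1)%N /\ (2 * #|edge n| <= (2 * #|edge n|).+1)%N by [].
have r2 (c : block_index K) : 0 < (2^-1 : R) < 1 by lra.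
exact: (weight_true_gt0 k1_gt0 k2_gt0 (label_block Z) r2 h).
Qed.

Variable alpha : R.

Lemma posterior_ge0 (A : 'M[bool]_n) Z : 0 <= posterior alpha k1 k2 A Z.
Proof.
have w0 Z' : 0 <= posterior_weight k1 k2 A Z'.
  apply: prodr_ge0 => ab _; apply: Rintegral_ge0 => t _.
  by rewrite mulr_ge0 ?powR_ge0.
rewrite /posterior; case: ifP => // _; rewrite divr_ge0// sumr_ge0//.
Qed.

(** The normalising sum contains the terms of both [Z] and [Zs], so the posterior probability of [Z]
    is at most 1 and at most the ratio of the two weights. *)
Lemma posterior_mass_ge (D : {set {ffun 'I_n -> 'I_K}}) Zs x :
  balanced alpha Zs ->
  1 - \sum_(Z | balanced alpha Z && (Z \notin D)) Num.min 1 (weight Z x / weight Zs x)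
    <= posterior_mass alpha k1 k2 (graph x) D.
Proof.
move=> bZs.
set W := \sum_(Z : {ffun 'I_n -> 'I_K} | balanced alpha Z) weight Z x.
have Wge Z : balanced alpha Z -> weight Z x <= W.
  move=> bZ; rewrite /W (bigD1 Z)//= lerDl; apply: sumr_ge0 => Z' _.
  exact/ltW/weight_gt0.
have W0 : 0 < W by apply: lt_le_trans (weight_gt0 Zs x) (Wge _ bZs).
have postE Z : posterior alpha k1 k2 (graph x) Z =
    if balanced alpha Z then weight Z x / W else 0.
  rewrite /posterior posterior_weight_graph; case: ifP => // _.
  by under eq_bigr do rewrite posterior_weight_graph.
have sum1 : \sum_(Z : {ffun 'I_n -> 'I_K}) posterior alpha k1 k2 (graph x) Z = 1.
  under eq_bigr do rewrite postE.
  by rewrite -big_mkcond/= -mulr_suml mulfV// gt_eqF.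
rewrite lerBlDr -[leLHS]sum1 (bigID (mem D))/= /posterior_mass lerD2l.
under eq_bigr do rewrite postE.
rewrite -big_mkcondr/= (eq_bigl (fun Z => balanced alpha Z && (Z \notin D))); last first.
  by move=> Z; rewrite andbC.
apply: ler_sum => Z /andP[bZ _]; rewrite le_min ler_pdivrMr// mul1r Wge//=.
rewrite ler_wpM2l ?(ltW (weight_gt0 _ _))// lef_pV2 ?posrE ?weight_gt0//.
exact: Wge.
Qed.

End PosteriorBlocks.

(** * Law of the observed graph *)

Section Expectation.
Context {R : realType} {d : measure_display} {Om : measurableType d}.
Variables (P : probability Om R) (n K : nat) (p q : R).
Variables (Zs : {ffun 'I_n -> 'I_K}) (A : 'I_n -> 'I_n -> {RV P >-> bool}).
Hypotheses (q_gt0 : 0 < q) (qp : q < p) (p_lt1 : p < 1).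
Hypothesis sbm : sbm_adjacency (sbm_conn K p q) Zs A.

Definition observed (w : Om) : {ffun edge n -> bool} :=
  [ffun e => A (src e) (dst e) w].

Lemma adjacency_graph w : adjacency_mx A w = graph (observed w).
Proof.
have [Asym Adiag _ _] := sbm.
apply/matrixP => i j; rewrite !mxE.
case: insubP => [e _ eE|].
  by rewrite ffunE /src /dst eE.
rewrite inE /= -leqNgt => ji.
case: insubP => [e _ eE|].
  by rewrite ffunE /src /dst eE /= Asym.
rewrite inE /= -leqNgt => ij.
by have -> : i = j by [apply/val_inj/eqP; rewrite eqn_leq ij ji]; rewrite Adiag.
Qed.

Definition sbm_law (x : {ffun edge n -> bool}) : R :=
  law (level p q (@diagonal K)) (label_block Zs) x.

Lemma edge_probability e (y : bool) :
  P (A (src e) (dst e) @^-1` [set y]) =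
  (bern (level p q (@diagonal K) (label_block Zs e)) y)%:E.
Proof.
have [_ _ Alaw _] := sbm.
have := congr1 (fun m : set bool -> \bar R => m [set y]) (Alaw _ _ (edge_lt e)).
rewrite /distribution /pushforward/= => ->.
rewrite /bernoulli_prob /sbm_conn mxE.
have -> : (if Zs (src e) == Zs (dst e) then p else q) =
    level p q (@diagonal K) (label_block Zs e).
  by rewrite /level pair_block_diag.
set t := level _ _ _ _.
have -> : 0 <= t <= 1.
  by rewrite /t /level; case: ifP => _; apply/andP; split; rewrite ltW//; [apply: lt_trans qp|apply: lt_trans p_lt1].
by rewrite fsbig_set1.
Qed.

Lemma observed_probability x : P (observed @^-1` [set x]) = (sbm_law x)%:E.
Proof.
have [_ _ _ Aind] := sbm.
pose D := [set ij : 'I_n * 'I_n | (ij.1 < ij.2)%N]%SET.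
pose Ev (ij : 'I_n * 'I_n) : set bool :=
  if insub ij is Some e then [set x e] else setT.
have := Aind D Ev (subxx _) (fun _ => I).
have -> : \bigcap_(i in [set` D]) (A i.1 i.2 @^-1` Ev i) = observed @^-1` [set x].
  apply/seteqP; split=> w.
    move=> H; apply/ffunP => e; rewrite ffunE.
    have := H (val e) (valP e).
    by rewrite /Ev valK.
  move=> /= ox ij ijD; rewrite /Ev /= -ox.
  by case: insubP => [e _ <-|//]; rewrite ffunE.
move=> ->; rewrite big_sub /sbm_law /law.
rewrite -prodEFin; apply: eq_bigr => e _.
by rewrite /Ev valK edge_probability.
Qed.

Lemma expectation_graph (F : 'M[bool]_n -> R) : (forall M, 0 <= F M) ->
  ('E_P[fun w => F (adjacency_mx A w)] =
   (\sum_x sbm_law x * F (graph x))%R%:E)%E.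
Proof.
move=> F0.
have mobs x : measurable (observed @^-1` [set x]).
  have -> : observed @^-1` [set x] =
      \bigcap_(e in [set: edge n]) (A (src e) (dst e) @^-1` [set x e]).
    apply/seteqP; split=> w.
      by move=> /= <- e _; rewrite /= ffunE.
    by move=> H; apply/ffunP => e; rewrite ffunE; exact: H.
  apply: fin_bigcap_measurable => // e _.
  rewrite -[X in measurable X]setTI; exact: measurable_funP.
rewrite unlock.
have -> : (\int[P]_w (F (adjacency_mx A w))%:E =
    \int[P]_w \sum_x ((F (graph x))%:E * (\1_(observed @^-1` [set x]) w)%:E))%E.
  apply: eq_integral => w _; rewrite adjacency_graph.
  rewrite (bigD1 (observed w))//= indicE mem_set// mule1 big1 ?adde0//.
  move=> x xw; rewrite indicE memNset ?mule0//= => /esym/eqP; exact/negP.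
rewrite ge0_integral_sum//=.
- rewrite -sumEFin; apply: eq_bigr => x _.
  rewrite ge0_integralZl_EFin//.
  + transitivity ((F (graph x))%:E * P (observed @^-1` [set x]))%E.
      by rewrite integral_indic// setIT.
    by rewrite observed_probability -EFinM mulrC.
  + apply/measurable_EFinP; exact: measurable_indic.
- move=> x; apply: emeasurable_funM => //.
  by apply/measurable_EFinP; exact: measurable_indic.
- by move=> x w _; rewrite mule_ge0// lee_fin.
Qed.

End Expectation.

(** * A bound for fixed n *)

Section Counting.
Context {R : realType}.

(** Generating function of the Hamming distance to [Zs]: each coordinate keeps its label, with
    weight 1, or takes one of [K - 1] others, with weight [y]. *)
Lemma sum_pow_mismatch (n K : nat) (Zs : {ffun 'I_n -> 'I_K}) (y : R) : (0 < K)%N ->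
  \sum_(Y : {ffun 'I_n -> 'I_K}) y ^+ #|mismatch Y Zs| = (1 + K.-1%:R * y) ^+ n.
Proof.
move=> K0.
transitivity (\sum_(Y : {ffun 'I_n -> 'I_K}) \prod_i (if Y i != Zs i then y else 1)).
  by apply: eq_bigr => Y _; rewrite -big_mkcond/= prodr_const.
rewrite -(bigA_distr_bigA (fun i k => if k != Zs i then y else 1)).
rewrite -[in RHS](card_ord n) -prodr_const; apply: eq_bigr => i _.
rewrite (bigD1 (Zs i))//= eqxx; congr (_ + _).
rewrite (eq_bigr (fun=> y)); last by move=> k ->.
rewrite sumr_const mulr_natl; congr (_ *+ _).
by rewrite cardC1 card_ord.
Qed.

Lemma pow1D_le (z : R) (n : nat) : 0 <= z -> n%:R * z <= 2^-1 ->
  (1 + z) ^+ n <= 1 + 2 * (n%:R * z).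
Proof.
move=> z0 nz; have nz0 : 0 <= n%:R * z by rewrite mulr_ge0.
apply: (@le_trans _ _ (expR (n%:R * z))).
  rewrite expRM_natl; apply: lerXn2r; rewrite ?nnegrE ?expR_ge0 ?expR_ge1Dx//; lra.
apply: (le_trans (expR_le_quad nz)).
have := ler_wpM2l nz0 nz; lra.
Qed.

Lemma ord2_cases (K : nat) (a b : 'I_K) : K = 2 -> a != b ->
  forall c, (c == a) || (c == b).
Proof.
move=> K2 ab c; move: (ltn_ord a) (ltn_ord b) (ltn_ord c) ab.
by rewrite -!val_eqE /=; lia.
Qed.

End Counting.

Section FiniteBound.
Context {R : realType}.
Variables (alpha beta k1 k2 p q C delta kappa : R) (n K h : nat).
Hypotheses (k1_gt0 : 0 < k1) (k2_gt0 : 0 < k2).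
Hypotheses (q_gt0 : 0 < q) (qp : q < p) (p_le : p <= 4^-1) (pC : p <= C * q).
Hypotheses (d_gt0 : 0 < delta) (dC : delta * (4 * C) <= 1).
Variable Zs : {ffun 'I_n -> 'I_K}.
Hypotheses (K2 : (2 <= K)%N) (h_gt0 : (0 < h)%N) (n_gt0 : (0 < n)%N).
Hypotheses (beta_ge1 : 1 <= beta) (alpha_beta : beta < alpha).
Hypothesis bal : balanced beta Zs.
Hypothesis hK : (K * h)%:R <= n%:R / (alpha * K%:R).

Let M := (2 * (n * n))%N.
Let J := renyi_div p q.
Hypothesis Mw : M%:R^-1 <= delta * (p - q) / 2.

Let eps := (K * K * h)%:R / n%:R : R.
Hypothesis eps_small : (eps / 2 + 72 * C * delta) * n%:R <= kappa * nbar K beta n.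
(** A single exponent for both crude regimes; its two hypotheses use counts in the form delivered by
    [pairs_card_le]. *)
Variable L : R.
Hypothesis L_mixed : forall N : nat, (h * h <= 2 * N + n)%N -> L <= J / 64 * N%:R.
Hypothesis L_common : forall N a b : nat,
  n%:R / (2 * beta * K%:R) <= a%:R -> n%:R / (2 * beta * K%:R) <= b%:R ->
  (a * b <= 2 * N + n)%N -> L <= delta ^+ 2 * J / 288 * N%:R.
Hypothesis eps_half : eps <= (2 * beta * K%:R)^-1.

Let T := block_index K.
Let poly := poly_cst k1 k2 M ^+ #|T| : R.
Let y := expR (- ((1 - kappa) * nbar K beta n * J)).

Definition error_of (Y : {ffun 'I_n -> 'I_K}) : R :=
  \sum_x sbm_law p q Zs x * Num.min 1 (weight k1 k2 Y x / weight k1 k2 Zs x).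

Let EM : (0 < M)%N /\ (2 * #|edge n| <= M)%N.
Proof. by split; [rewrite /M !muln_gt0 n_gt0|rewrite leq_mul2l/= card_edge_le]. Qed.

Let J0 : 0 < J.
Proof. exact: (renyi_gt0 q_gt0 qp p_le). Qed.

Let n0 : 0 < n%:R :> R. Proof. by rewrite ltr0n. Qed.
Let Kr0 : 0 < K%:R :> R. Proof. by rewrite ltr0n; apply: leq_trans K2. Qed.

Lemma poly_ge0 : 0 <= poly.
Proof. by rewrite exprn_ge0// mulr_ge0// sqrtr_ge0. Qed.

Lemma mixed_error Z c : let Q1 := [pred e | (label_block Z e == c) && diagonal (label_block Zs e)] in
  let Q2 := [pred e | (label_block Z e == c) && ~~ diagonal (label_block Zs e)] in
  (h * h <= 2 * #|Q1| + n)%N -> (h * h <= 2 * #|Q2| + n)%N ->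
  error_of Z <= poly * expR (- L).
Proof.
move=> Q1 Q2 h1 h2.
pose N := minn #|Q1| #|Q2|.
have := mixed_min_expect k1_gt0 k2_gt0 q_gt0 qp p_le EM (geq_minl #|Q1| #|Q2|) (geq_minr #|Q1| #|Q2|).
move=> /le_trans; apply; rewrite ler_wpM2l ?poly_ge0// ler_expR mulNr lerN2.
apply: L_mixed; rewrite /N; case: (leqP #|Q1| #|Q2|) => _ //.
Qed.

Lemma class_size_nbar a b : a != b ->
  2 * nbar K beta n <= (class_size Zs a + class_size Zs b)%:R.
Proof.
move=> ab; rewrite /nbar; case: ifP => [/eqP K2e|_].
  have -> : (class_size Zs a + class_size Zs b = n)%N.
    have hab c := ord2_cases K2e ab c.
    rewrite /class_size -[RHS](card_ord n) -(cardID [pred i | Zs i == a] predT); congr (_ + _)%N.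
    apply: eq_card => i; rewrite !inE /= andbT; have := hab (Zs i).
    by have [->|_] := eqVneq (Zs i) a; rewrite ?(negbTE ab)//= => ->.
  lra.
have b1 := beta_ge1; have kr := Kr0.
have hc c : n%:R / (K%:R * beta) <= (class_size Zs c)%:R.
  have /forallP/(_ c)/andP[hc _] := bal.
  by rewrite mulrC [_ * beta]mulrC mulrC.
rewrite natrD; have := hc a; have := hc b; lra.
Qed.

(** With [m] mismatches at least [m (2 nbar - m)] pairs are changed and at most [m n] are moved;
    [eps_small] charges the lost [m^2] and the window cost to [kappa nbar]. *)
Lemma close_error Y : (#|mismatch Y Zs| <= K * K * h)%N ->
  error_of Y <= 2 ^+ #|T| * y ^+ #|mismatch Y Zs| + #|T|%:R * (poly * expR (- L)).
Proof.
move=> mh; set m := #|mismatch Y Zs|.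
have mE : m%:R <= eps * n%:R :> R by rewrite /eps mulfVK ?gt_eqF// ler_nat.
have J00 := J0; have d0 := d_gt0.
have C1 := C_ge1 q_gt0 qp pC.
have := close_min_expect k1_gt0 k2_gt0 q_gt0 qp p_le pC d_gt0 dC
   (@diagonal K) (label_block Zs) EM Mw (label_block Y).
move=> /le_trans; apply; apply: lerD.
  rewrite ler_wpM2l ?exprn_ge0// /y -expRM_natl ler_expR.
  set ch := #|changed _ _ _|; set mv := #|moved _ _|.
  have mvm : mv%:R <= m%:R * n%:R :> R.
    rewrite -natrM ler_nat; apply: touched_card_le => e.
    rewrite /moved /mismatch /label_block; apply: contraR.
    by rewrite negb_or !negbK => /andP[/eqP -> /eqP ->].
  (* [changed_card_ge] needs a natural number, so [l] is the ceiling of [2 nbar]; by minimality it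
     still bounds the integer class sizes from below. *)
  have exl : exists l : nat, 2 * nbar K beta n <= l%:R.
    by exists (Num.truncn (2 * nbar K beta n)).+1; exact/ltW/truncnS_gt.
  have [l lE lmin] := ex_minnP exl.
  have chm : (m * (l - m) <= ch)%N.
    have -> : ch = #|[pred e : edge n | (Y (src e) == Y (dst e)) != (Zs (src e) == Zs (dst e))]|.
      by apply: eq_card => e; rewrite unfold_in /changed /label_block !pair_block_diag inE.
    apply: changed_card_ge => i; rewrite /mismatch eq_sym => Di.
    apply: (@leq_trans (class_size Zs (Zs i) + class_size Zs (Y i))).
      by apply: lmin; exact: class_size_nbar.
    rewrite /class_size -cardUI [X in (_ + X)%N]eq_card0 ?addn0; last first.
      move=> j; rewrite !inE; apply/negbTE/negP => /andP[/eqP -> /eqP E].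
      by rewrite E eqxx in Di.
    by apply: eq_leq; apply: eq_card => j; rewrite !inE.
  have chR : m%:R * (2 * nbar K beta n - m%:R) <= ch%:R.
    apply: (@le_trans _ _ (m * (l - m))%:R); last by rewrite ler_nat.
    rewrite natrM ler_wpM2l//.
    have : l%:R - m%:R <= (l - m)%:R :> R.
      by rewrite lerBlDr -natrD ler_nat addnC -leq_subLR leqnn.
    lra.
  have h1 := ler_wpM2l (ltW J0) chR.
  have C0 : 0 <= C by lra.
  have CdJ : 0 <= C * delta * J := mulr_ge0 (mulr_ge0 C0 (ltW d0)) (ltW J0).
  have h2 := ler_wpM2l CdJ mvm.
  have mJ : 0 <= m%:R * J by rewrite mulr_ge0// ltW.
  have h3 : m%:R * J * ((m%:R / 2 + 72 * C * delta * n%:R)) <= m%:R * J * (kappa * nbar K beta n).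
    rewrite ler_wpM2l//; apply: le_trans eps_small; lra.
  rewrite -/J; move: h1 h2 h3.
  move: J (nbar K beta n) ch%:R mv%:R m%:R n%:R => j nb a b c e; lra.
rewrite [leRHS]mulr_natl -sumr_const; apply: ler_sum => c _.
rewrite ler_wpM2l ?poly_ge0// ler_expR mulNr lerN2.
have b1 := beta_ge1; have kr := Kr0.
(* By [eps_half] the mismatches take at most half of the guaranteed size of a true class, so every
   block keeps order [n^2] common pairs. *)
have count a : n%:R / (2 * beta * K%:R) <=
    #|[pred i | ~~ mismatch Y Zs i & Zs i == a]|%:R :> R.
  have : (class_size Zs a <= m + #|[pred i | ~~ mismatch Y Zs i & Zs i == a]|)%N.
    rewrite /class_size -(cardID (mismatch Y Zs)) leq_add//.
    by rewrite /m; apply: subset_leq_card; apply/fintype.subsetP => i /andP[].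
  rewrite -(ler_nat R) natrD => h1.
  have /forallP/(_ a)/andP[h2 _] := bal.
  have h3 : m%:R <= n%:R / (2 * beta * K%:R).
    apply: (le_trans mE); rewrite mulrC ler_wpM2l//.
  have h4 : n%:R / (beta * K%:R) = 2 * (n%:R / (2 * beta * K%:R)) :> R.
    field; rewrite !gt_eqF//; lra.
  rewrite h4 in h2; lra.
apply: L_common (count (fst_label c)) (count (snd_label c)) _.
have -> : #|common (label_block Zs) (label_block Y) c| =
    #|[pred e | (label_block Y e == c) && (label_block Zs e == c)]|.
  by apply: eq_card => e; rewrite inE.
have := common_card_ge Y Zs c; by [].
Qed.

Lemma error_of_ge0 Y : 0 <= error_of Y.
Proof.
have l01 c : 0 < level p q (@diagonal K) c < 1.
  have q0 := q_gt0; have qlp := qp; have p4 := p_le.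
  by rewrite /level; case: ifP => _; lra.
apply: sumr_ge0 => x _; rewrite mulr_ge0 ?(ltW (law_gt0 _ l01 _))//.
by rewrite le_min ler01 divr_ge0 ?ltW ?weight_gt0.
Qed.

Lemma error_of_perm (Z : {ffun 'I_n -> 'I_K}) (s : {perm 'I_K}) : error_of [ffun i => s (Z i)] = error_of Z.
Proof. by apply: eq_bigr => x _; rewrite weight_perm. Qed.

Lemma relabel_inj (s : {perm 'I_K}) :
  injective (fun Z : {ffun 'I_n -> 'I_K} => [ffun i => s (Z i)]).
Proof.
move=> Z Z' /ffunP H; apply/ffunP => i.
by have := H i; rewrite !ffunE => /perm_inj.
Qed.

Lemma balanced_le : balanced alpha Zs.
Proof.
have b1 := beta_ge1; have ab := alpha_beta.
apply/forallP => a; have /forallP/(_ a)/andP[h1 h2] := bal; apply/andP; split.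
  apply: le_trans h1; rewrite ler_wpM2l// lef_pV2 ?posrE ?mulr_gt0//; try lra.
  by rewrite ler_wpM2r// ltW.
apply: (le_trans h2); rewrite !ler_wpM2r ?invr_ge0 ?ler0n ?ltW//.
Qed.

(** The permutation bringing a close [Z] near [Zs] depends on [Z], so [Z] is charged to all its
    relabellings, and reindexing each inner sum yields the factor [K] factorial. Mixed labellings
    are covered by [E1], paid once for each of the [K ^ n] labellings. *)
Lemma total_error_le (ny : n%:R * (K%:R * y) <= 2^-1) :
  1 - (\sum_x sbm_law p q Zs x * posterior_mass alpha k1 k2 (graph x) (Gamma Zs)) <=
  K`!%:R * 2 ^+ #|T| * (2 * (n%:R * (K%:R * y))) +
  (1 + K`!%:R * #|T|%:R) * (K ^ n)%:R * (poly * expR (- L)).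
Proof.
have l01 c : 0 < level p q (@diagonal K) c < 1.
  have q0 := q_gt0; have qlp := qp; have p4 := p_le.
  by rewrite /level; case: ifP => _; lra.
set G := Gamma Zs; set t := #|T|.
have step1 : 1 - (\sum_x sbm_law p q Zs x * posterior_mass alpha k1 k2 (graph x) G) <=
    \sum_(Z | balanced alpha Z && (Z \notin G)) error_of Z.
  rewrite /error_of exchange_big/= lerBlDr -[leLHS](sum_law (level p q (@diagonal K)) (label_block Zs)).
  rewrite -big_split/=; apply: ler_sum => x _.
  rewrite -mulr_sumr -mulrDr -[leLHS]mulr1 ler_wpM2l ?(ltW (law_gt0 _ l01 _))//.
  by have := posterior_mass_ge k1_gt0 k2_gt0 G x balanced_le; lra.
apply: (le_trans step1).
pose E1 := poly * expR (- L).
have E10 : 0 <= E1 by rewrite mulr_ge0 ?poly_ge0 ?expR_ge0.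
(* [Y = Zs] is left out because a relabelling of [Z] equal to [Zs] would put [Z] in [Gamma Zs]; this
   removes the term 1 of the generating function. *)
pose f (Y : {ffun 'I_n -> 'I_K}) : R :=
  if (Y != Zs) && (#|mismatch Y Zs| <= K * K * h)%N then error_of Y else 0.
have f0 Y : 0 <= f Y by rewrite /f; case: ifP => _ //; exact: error_of_ge0.
have step2 Z : balanced alpha Z && (Z \notin G) ->
    error_of Z <= E1 + \sum_(s : {perm 'I_K}) f [ffun i => s (Z i)].
  move=> /andP[bZ ZG].
  have hcls (Z' : {ffun 'I_n -> 'I_K}) a : balanced alpha Z' -> (K * h <= class_size Z' a)%N.
    move=> /forallP/(_ a)/andP[h1 _]; rewrite -(ler_nat R); exact: le_trans hK h1.
  have K0 : (0 < K)%N by apply: leq_trans K2.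
  have [[c [h1 h2]]|[s hs]] := mixed_or_close K0 h_gt0 (fun a => hcls Z a bZ)
      (fun a => hcls Zs a balanced_le).
    apply: (le_trans (mixed_error h1 h2)).
    by rewrite lerDl; apply: sumr_ge0 => s _.
  apply: (@le_trans _ _ (f [ffun i => s (Z i)])); last first.
    rewrite (bigD1 s)//= addrCA lerDl addr_ge0//; apply: sumr_ge0 => s' _; exact: f0.
  rewrite /f hs andbT; case: eqP => [sZ|_] /=; last by rewrite error_of_perm.
  case/negP: ZG; apply/imsetP; exists (s^-1)%g => //.
  by rewrite -sZ; apply/ffunP => i; rewrite !ffunE permK.
apply: (le_trans (ler_sum _ step2)).
apply: (@le_trans _ _ (\sum_(Z : {ffun 'I_n -> 'I_K}) (E1 + \sum_(s : {perm 'I_K}) f [ffun i => s (Z i)]))).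
  rewrite big_mkcond/=; apply: ler_sum => Z _; case: ifP => // _.
  by rewrite addr_ge0// sumr_ge0.
rewrite big_split/= sumr_const exchange_big/=.
have -> : \sum_(s : {perm 'I_K}) \sum_(Z : {ffun 'I_n -> 'I_K}) f [ffun i => s (Z i)] =
    K`!%:R * \sum_Y f Y.
  rewrite (eq_bigr (fun=> \sum_Y f Y)); last first.
    by move=> s _; rewrite [RHS](reindex_inj (@relabel_inj s)).
  by rewrite sumr_const mulr_natl; congr (_ *+ _); rewrite -[RHS]card_Sn.
have fb : \sum_Y f Y <= 2 ^+ t * (2 * (n%:R * (K%:R * y))) + (K ^ n)%:R * (t%:R * E1).
  apply: (@le_trans _ _ (\sum_(Y | Y != Zs) (2 ^+ t * y ^+ #|mismatch Y Zs| + t%:R * E1))).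
    rewrite [leRHS]big_mkcond/=; apply: ler_sum => Y _; rewrite /f.
    have y0 : 0 <= 2 ^+ t * y ^+ #|mismatch Y Zs| + t%:R * E1.
      apply: addr_ge0; first by rewrite mulr_ge0 ?exprn_ge0 ?expR_ge0.
      exact: mulr_ge0 (ler0n _ _) E10.
    case: (Y != Zs) => //=; case: ifP => // ?; exact: close_error.
  rewrite big_split/=; apply: lerD.
    rewrite -mulr_sumr ler_wpM2l ?exprn_ge0//.
    have := sum_pow_mismatch Zs y (leq_trans _ K2); rewrite (bigD1 Zs)//=.
    rewrite (_ : #|mismatch Zs Zs| = 0%N) ?expr0; last first.
      by apply: eq_card0 => i; rewrite unfold_in /mismatch eqxx.
    move=> /(_ isT) H.
    have y0 : 0 <= y by exact: expR_ge0.
    have KK : K.-1%:R * y <= K%:R * y by rewrite ler_wpM2r// ler_nat leq_pred.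
    have := @pow1D_le R (K.-1%:R * y) n; rewrite -H mulr_ge0// => /(_ isT).
    have := ler_wpM2l (ler0n R n) KK => KKn.
    have -> : n%:R * (K.-1%:R * y) <= 2^-1 by lra.
    move=> /(_ isT); lra.
  apply: (@le_trans _ _ (\sum_(Y : {ffun 'I_n -> 'I_K}) (t%:R * E1))).
    rewrite [leLHS]big_mkcond/=; apply: ler_sum => Y _; case: ifP => // _.
    by rewrite mulr_ge0.
  by rewrite sumr_const card_ffun !card_ord [leRHS]mulr_natl.
have := ler_wpM2l (ler0n R K`!) fb.
rewrite card_ffun !card_ord -/poly -/E1 -[E1 *+ _]mulr_natl.
move: (\sum_Y f Y) (E1) (K ^ n)%:R K`!%:R t%:R (2 ^+ t) (2 * _) => F e k kf t1 t2 z; lra.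
Qed.

End FiniteBound.

(** * Large n *)

Section Asymptotics.
Context {R : realType}.

Lemma sqr_le_expR (n : nat) : (8 * (n * n))%:R <= expR (8 * n%:R) :> R.
Proof.
have n0 : 0 <= n%:R :> R by [].
have h : 3 * n%:R <= expR (4 * n%:R) :> R.
  by apply: le_trans (expR_ge1Dx _); lra.
have -> : 8 * n%:R = 4 * n%:R + 4 * n%:R :> R by ring.
rewrite expRD natrM natrM; apply: (@le_trans _ _ ((3 * n%:R) * (3 * n%:R))).
  have : 0 <= n%:R * n%:R :> R by rewrite mulr_ge0.
  lra.
by rewrite ler_pM// mulr_ge0.
Qed.

Lemma lower_cst_ge (k1 k2 : R) (n : nat) : 0 < k1 -> 0 < k2 -> (0 < n)%N ->
  expR (- (8 * n%:R * (k1 + k2 + 1))) <= lower_cst k1 k2 (2 * (n * n)).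
Proof.
move=> k10 k20 n0.
have nn0 : 0 < (8 * (n * n))%:R :> R by rewrite ltr0n !muln_gt0 n0.
have hE : (2 * (n * n))%:R^-1 / 4 = (8 * (n * n))%:R^-1 :> R.
  rewrite -invfM -natrM; congr (_%:R^-1); lia.
have base : expR (- (8 * n%:R)) <= (8 * (n * n))%:R^-1 :> R.
  by rewrite expRN lef_pV2 ?posrE ?expR_gt0// sqr_le_expR.
have e0 : 0 <= expR (- (8 * n%:R)) :> R by exact: expR_ge0.
have pw k : 0 < k -> expR (- (8 * n%:R) * k) <= (8 * (n * n))%:R^-1 `^ k :> R.
  by move=> k0; rewrite expRM ge0_ler_powR ?nnegrE ?invr_ge0 ?(ltW k0).
rewrite /lower_cst hE.
have -> : - (8 * n%:R * (k1 + k2 + 1)) = - (8 * n%:R) * k1 + - (8 * n%:R) * k2 + - (8 * n%:R).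
  by ring.
by rewrite !expRD ler_pM ?mulr_ge0 ?expR_ge0// ler_pM ?expR_ge0// pw.
Qed.

(** Contributions of the total mass of the density, of the lower constant, which is [1 / (8 n^2)] to
    the power [k1 + k2 + 1], and of the number of grid points. An exponent linear in [n] is harmless
    against [c n^2 J] when [n J] is large. *)
Definition growth (k1 k2 : R) : R :=
  2 * beta_int k1 k2 `]0, 1[ (cst 1) + 8 * (k1 + k2 + 2).

Lemma poly_cst_le (k1 k2 : R) (n : nat) : 0 < k1 -> 0 < k2 -> (0 < n)%N ->
  poly_cst k1 k2 (2 * (n * n)) <= expR (growth k1 k2 * n%:R).
Proof.
move=> k10 k20 n0; rewrite /poly_cst /growth.
set B := beta_int _ _ _ _; set l := lower_cst _ _ _.
have B0 : 0 <= B.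
  apply: beta_int_ge0 => //.
  by split; [exact: measurable_cst|move=> t _; rewrite ler01 lexx].
have n1 : 1 <= n%:R :> R by rewrite ler1n.
have l0 : 0 < l by apply: lower_cst_gt0; rewrite !muln_gt0 n0.
pose e := expR (8 * n%:R * (k1 + k2 + 1)).
have el : l^-1 <= e.
  rewrite /e -[X in expR X]opprK expRN lef_pV2 ?posrE ?expR_gt0//.
  exact: lower_cst_ge.
have e1 : 1 <= e.
  rewrite -expR0 ler_expR !mulr_ge0//; lra.
have h1 : Num.sqrt (2 * B / l) <= expR (2 * B * n%:R) * e.
  have Bl0 : 0 <= 2 * B / l by rewrite divr_ge0 ?mulr_ge0// ltW.
  apply: (@le_trans _ _ (1 + 2 * B / l)).
    have s0 := sqrtr_ge0 (2 * B / l).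
    rewrite -{2}(sqr_sqrtr Bl0); have := sqr_ge0 (Num.sqrt (2 * B / l) - 1); lra.
  apply: (@le_trans _ _ ((1 + 2 * B) * e)).
    have : 2 * B / l <= 2 * B * e by rewrite ler_wpM2l ?mulr_ge0.
    lra.
  rewrite ler_wpM2r ?(le_trans _ e1)//.
  apply: le_trans (expR_ge1Dx _).
  have : 2 * B <= 2 * B * n%:R by rewrite ler_peMr ?mulr_ge0.
  lra.
have h2 : (2 * (n * n)).+1%:R <= expR (8 * n%:R) :> R.
  by apply: le_trans (sqr_le_expR n); rewrite ler_nat; nia.
apply: (@le_trans _ _ (expR (2 * B * n%:R) * e * expR (8 * n%:R))).
  by rewrite ler_pM ?sqrtr_ge0.
rewrite /e -!expRD ler_expR; lra.
Qed.

Lemma ln_near (A : R) : \forall n \near \oo, A <= ln (n%:R : R).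
Proof.
near=> n.
have h : expR A <= n%:R by near: n; exact: nbhs_infty_ger.
by rewrite -ler_expR lnK// posrE (lt_le_trans (expR_gt0 A)).
Unshelve. all: by end_near. Qed.

Lemma natr_le_expR (m : nat) : m%:R <= expR m%:R :> R.
Proof. by apply: le_trans (expR_ge1Dx _); rewrite lerDr. Qed.

Variables (K : nat) (alpha beta k1 k2 C kappa eps0 : R).
Hypotheses (k1_gt0 : 0 < k1) (k2_gt0 : 0 < k2) (K2 : (2 <= K)%N).
Hypotheses (beta_ge1 : 1 <= beta) (alpha_beta : beta < alpha) (C_ge_1 : 1 <= C).
Hypotheses (kappa_gt0 : 0 < kappa) (kappa_le : 2 * kappa <= 1).
Hypotheses (eps0_gt0 : 0 < eps0) (kappa_eps : 1 + eps0 / 2 <= (1 - kappa) * (1 + eps0)).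

Let Kr2 : 2 <= K%:R :> R. Proof. by rewrite ler_nat. Qed.

(** Chosen so that [72 C delta = kappa / (2 beta K)]: the window then uses at most half of the
    allowance [kappa nbar]. *)
Let delta := kappa / (144 * C * K%:R * beta).
(** The overlap threshold is about [gam n]. As [K^2 gam = kappa / (2 alpha K)], the at most [K^2 h]
    mismatches fit the allowance, and [K h] stays below the least class size in [balanced alpha]. *)
Let gam := kappa / (2 * alpha * K%:R * K%:R * K%:R).
(** 5000 exceeds the product of the 288 of [far_expect] and the 16 of [count_ge]. *)
Let c := delta ^+ 2 * gam ^+ 2 / 5000.
Let t := #|block_index K|.
Let a : R := K`!%:R * 2 ^+ t * 2 * K%:R.
Let b : nat := (1 + K`! * t)%N.
Let C0 : R := b%:R + K%:R + t%:R * growth k1 k2.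

Let delta_gt0 : 0 < delta.
Proof.
have ? := kappa_gt0; have ? := C_ge_1; have ? := Kr2; have ? := beta_ge1.
by rewrite divr_gt0// !mulr_gt0//; lra.
Qed.

Let gam_gt0 : 0 < gam.
Proof.
have ? := kappa_gt0; have ? := Kr2; have ? := beta_ge1; have ? := alpha_beta.
by rewrite divr_gt0// !mulr_gt0//; lra.
Qed.

Lemma nbar_bounds (n : nat) : n%:R <= K%:R * beta * nbar K beta n /\ nbar K beta n <= n%:R.
Proof.
have hK := Kr2; have b1 := beta_ge1; have n0 : 0 <= n%:R :> R by [].
have Kb : K%:R <= K%:R * beta by rewrite ler_peMr//; lra.
rewrite /nbar; case: ifP => _.
  have : 2 * (n%:R / 2) <= K%:R * beta * (n%:R / 2) by rewrite ler_wpM2r//; lra.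
  lra.
rewrite mulrC divfK; last by rewrite gt_eqF// mulr_gt0//; lra.
split=> //; rewrite ler_pdivrMr; last by lra.
by rewrite ler_peMr//; lra.
Qed.

Lemma delta_C : delta * (4 * C) <= 1.
Proof.
have ? := kappa_gt0; have kl := kappa_le; have c1 := C_ge_1; have hK := Kr2; have b1 := beta_ge1.
have Kb : 1 <= K%:R * beta by rewrite -[leLHS]mulr1 ler_pM//; lra.
have -> : delta * (4 * C) = kappa / (36 * (K%:R * beta)).
  by rewrite /delta; field; rewrite !gt_eqF//; lra.
rewrite ler_pdivrMr; lra.
Qed.

Lemma ratio_alpha_beta :
  [/\ 0 < 2 * alpha * K%:R, 0 < 2 * beta * K%:R,
      kappa / (2 * alpha * K%:R) <= kappa / (2 * beta * K%:R) &
      kappa / (2 * beta * K%:R) <= (2 * beta * K%:R)^-1].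
Proof.
have kg := kappa_gt0; have kl := kappa_le; have hK := Kr2; have b1 := beta_ge1; have ab := alpha_beta.
have hK0 : 0 < K%:R :> R by lra.
have bK : 0 < 2 * beta * K%:R by rewrite !mulr_gt0//; lra.
have aK : 0 < 2 * alpha * K%:R by rewrite !mulr_gt0//; lra.
split=> //.
  rewrite ler_wpM2l ?(ltW kg)// lef_pV2 ?posrE// ler_wpM2r ?(ltW hK0)//; lra.
by rewrite ler_piMl ?invr_ge0 ?(ltW bK)//; lra.
Qed.

Lemma gam_scaled : K%:R * K%:R * gam = kappa / (2 * alpha * K%:R).
Proof.
have [aK _ _ _] := ratio_alpha_beta; have hK := Kr2; have b1 := beta_ge1; have ab := alpha_beta.
have a0 : alpha != 0 by rewrite gt_eqF//; lra.
have hK0 : K%:R != 0 :> R by rewrite gt_eqF//; lra.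
by rewrite /gam; field; rewrite a0 hK0.
Qed.

Lemma gam_le : gam <= (2 * beta * K%:R)^-1.
Proof.
have [_ _ h1 h2] := ratio_alpha_beta; have hK := Kr2; have g0 := gam_gt0.
have KK : 1 <= K%:R * K%:R :> R by rewrite -[leLHS]mulr1 ler_pM//; lra.
have := ler_wpM2r (ltW g0) KK; rewrite gam_scaled; lra.
Qed.

Lemma delta_scaled : 72 * C * delta = kappa / (2 * beta * K%:R).
Proof.
have hK := Kr2; have b1 := beta_ge1; have c1 := C_ge_1.
have b0 : beta != 0 by rewrite gt_eqF//; lra.
have hC : C != 0 by rewrite gt_eqF//; lra.
have hK0 : K%:R != 0 :> R by rewrite gt_eqF//; lra.
by rewrite /delta; field; rewrite b0 hK0 hC.
Qed.

Lemma delta_le1 : delta <= 1.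
Proof.
have h1 := delta_C; have d0 := delta_gt0; have c1 := C_ge_1.
have : delta * 1 <= delta * (4 * C) by rewrite ler_wpM2l ?(ltW d0)//; lra.
lra.
Qed.

(** * The overlap threshold and the pair counts it guarantees *)

Section Threshold.
Variable n : nat.
Hypotheses (n1 : 2 / gam <= n%:R) (n2 : 8 / gam ^+ 2 <= n%:R).
Let h := Num.truncn (gam * n%:R).

Let nr0 : 0 < n%:R :> R.
Proof. by apply: lt_le_trans n1; rewrite divr_gt0. Qed.

Lemma threshold_bounds : [/\ gam * n%:R / 2 <= h%:R, h%:R <= gam * n%:R & (0 < h)%N].
Proof.
have gn2 : 2 <= gam * n%:R by rewrite mulrC -ler_pdivrMr.
have gn0 : 0 <= gam * n%:R by lra.
have /andP[h1 h2] := truncn_itv gn0; rewrite -/h -natr1 in h1 h2.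
have hge : gam * n%:R / 2 <= h%:R by lra.
by split=> //; rewrite -(ltr0n R); lra.
Qed.

Lemma threshold_alpha : (K * h)%:R <= n%:R / (alpha * K%:R).
Proof.
have [_ hg _] := threshold_bounds.
have [aK _ _ _] := ratio_alpha_beta; have kl := kappa_le.
have hK := Kr2; have b1 := beta_ge1; have ab := alpha_beta.
have aK0 : 0 < alpha * K%:R by rewrite mulr_gt0//; lra.
have hK0 : 0 <= K%:R :> R by lra.
rewrite natrM ler_pdivlMr//.
have : K%:R * h%:R * (alpha * K%:R) <= K%:R * (gam * n%:R) * (alpha * K%:R).
  by rewrite ler_wpM2r ?(ltW aK0)// ler_wpM2l.
move=> /le_trans; apply.
have -> : K%:R * (gam * n%:R) * (alpha * K%:R) = (K%:R * K%:R * gam) * alpha * n%:R by ring.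
rewrite gam_scaled ler_piMl ?(ltW nr0)//.
have a0 : alpha != 0 by rewrite gt_eqF//; lra.
have K0 : K%:R != 0 :> R by rewrite gt_eqF//; lra.
have -> : kappa / (2 * alpha * K%:R) * alpha = kappa / (2 * K%:R) by field; rewrite a0 K0.
rewrite ler_pdivrMr; lra.
Qed.

Lemma threshold_eps : (K * K * h)%:R / n%:R <= kappa / (2 * beta * K%:R).
Proof.
have [_ hg _] := threshold_bounds; have [_ _ h1 _] := ratio_alpha_beta.
apply: le_trans h1; rewrite -gam_scaled ler_pdivrMr// !natrM.
have -> : K%:R * K%:R * gam * n%:R = K%:R * K%:R * (gam * n%:R) by ring.
by rewrite ler_wpM2l.
Qed.

Lemma threshold_eps_nbar :
  ((K * K * h)%:R / n%:R / 2 + 72 * C * delta) * n%:R <= kappa * nbar K beta n.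
Proof.
have [nKb _] := nbar_bounds n; have he := threshold_eps; have hd := delta_scaled.
have hK := Kr2; have b1 := beta_ge1; have kg := kappa_gt0.
have [_ bK0 _ _] := ratio_alpha_beta.
have b0 : beta != 0 by rewrite gt_eqF//; lra.
have K0 : K%:R != 0 :> R by rewrite gt_eqF//; lra.
have kE : kappa / (K%:R * beta) = 2 * (kappa / (2 * beta * K%:R)).
  by field; rewrite b0 K0.
have k0 : 0 <= kappa / (2 * beta * K%:R) by rewrite divr_ge0 ?ltW.
have : (K * K * h)%:R / n%:R / 2 + 72 * C * delta <= kappa / (K%:R * beta) by lra.
move=> /(ler_wpM2r (ltW nr0)) /le_trans; apply.
have kb0 : 0 <= kappa / (K%:R * beta) by lra.
have := ler_wpM2l kb0 nKb.
have -> // : kappa / (K%:R * beta) * (K%:R * beta * nbar K beta n) = kappa * nbar K beta n.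
by field; rewrite b0 K0.
Qed.

(** The diagonal term [n] is absorbed: [gam^2 n >= 8] makes it at most half of [gam^2 n^2 / 4]. *)
Lemma count_ge (N : nat) (u : R) : gam ^+ 2 * n%:R ^+ 2 / 4 <= u ->
  u <= 2 * N%:R + n%:R -> gam ^+ 2 * n%:R ^+ 2 / 16 <= N%:R.
Proof.
move=> hu hN.
have g20 : 0 < gam ^+ 2 by rewrite exprn_gt0.
have : 8 <= gam ^+ 2 * n%:R by rewrite mulrC -ler_pdivrMr.
move=> /(ler_wpM2r (ltW nr0)); rewrite -[_ * _ * n%:R]mulrA -[n%:R * n%:R]expr2.
move: hu hN; move: (gam ^+ 2 * _) => z; lra.
Qed.

Lemma exponent_count (N : nat) (J : R) : 0 < J -> gam ^+ 2 * n%:R ^+ 2 / 16 <= N%:R ->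
  c * n%:R ^+ 2 * J <= J / 64 * N%:R /\
  c * n%:R ^+ 2 * J <= delta ^+ 2 * J / 288 * N%:R.
Proof.
move=> J0; set G := gam ^+ 2 * n%:R ^+ 2 / 16 => hN.
have G0 : 0 <= G by rewrite /G; apply: divr_ge0 => //; apply: mulr_ge0; exact: sqr_ge0.
have d20 : 0 <= delta ^+ 2 by rewrite sqr_ge0.
have -> : c * n%:R ^+ 2 * J = delta ^+ 2 * J * G / (5000 / 16).
  by rewrite /G /c; field.
have d2 : delta ^+ 2 <= 1 by rewrite expr_le1 ?delta_le1// ltW.
have dJ : delta ^+ 2 * J <= J by rewrite ler_piMl// ltW.
have h3 : J * G <= J * N%:R by rewrite ler_wpM2l// ltW.
have dJ0 : 0 <= delta ^+ 2 * J by rewrite mulr_ge0// ltW.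
have h4 : delta ^+ 2 * J * G <= delta ^+ 2 * J * N%:R by rewrite ler_wpM2l.
have h5 := ler_wpM2r G0 dJ.
have h6 : 0 <= delta ^+ 2 * J * N%:R by rewrite mulr_ge0.
have h7 : 0 <= J * N%:R by rewrite mulr_ge0// ltW.
move: h3 h4 h5 h6 h7; move: (delta ^+ 2 * J) => z; split; lra.
Qed.

Lemma mixed_exponent (N : nat) (J : R) : 0 < J -> (h * h <= 2 * N + n)%N ->
  c * n%:R ^+ 2 * J <= J / 64 * N%:R.
Proof.
move=> J0; have [hg _ _] := threshold_bounds.
rewrite -(ler_nat R) natrM natrD natrM => hN.
suff hc : gam ^+ 2 * n%:R ^+ 2 / 16 <= N%:R by case: (exponent_count J0 hc).
apply: count_ge hN.
have gn0 : 0 <= gam * n%:R / 2 by rewrite divr_ge0// mulr_ge0// ltW.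
have : gam * n%:R / 2 * (gam * n%:R / 2) <= h%:R * h%:R by rewrite ler_pM.
by rewrite !expr2; lra.
Qed.

Lemma common_exponent (N m1 m2 : nat) (J : R) : 0 < J ->
  n%:R / (2 * beta * K%:R) <= m1%:R -> n%:R / (2 * beta * K%:R) <= m2%:R ->
  (m1 * m2 <= 2 * N + n)%N -> c * n%:R ^+ 2 * J <= delta ^+ 2 * J / 288 * N%:R.
Proof.
move=> J0 hm1 hm2; rewrite -(ler_nat R) natrM natrD natrM => hN.
suff hc : gam ^+ 2 * n%:R ^+ 2 / 16 <= N%:R by case: (exponent_count J0 hc).
have gn : gam * n%:R <= n%:R / (2 * beta * K%:R).
  by rewrite mulrC ler_wpM2l ?(ltW nr0)// gam_le.
have gn0 : 0 <= gam * n%:R by rewrite mulr_ge0// ltW.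
have gm1 := le_trans gn hm1; have gm2 := le_trans gn hm2.
apply: count_ge hN.
have : gam * n%:R * (gam * n%:R) <= m1%:R * m2%:R by rewrite ler_pM.
have : 0 <= gam ^+ 2 * n%:R ^+ 2 by rewrite mulr_ge0 ?sqr_ge0.
by rewrite !expr2; lra.
Qed.

End Threshold.

Lemma poly_total_le (n : nat) : (0 < n)%N ->
  (1 + K`!%:R * t%:R) * (K ^ n)%:R * poly_cst k1 k2 (2 * (n * n)) ^+ t <=
  expR (C0 * n%:R).
Proof.
move=> n0; have n1 : 1 <= n%:R :> R by rewrite ler1n.
have pc := poly_cst_le k1_gt0 k2_gt0 n0.
have pc0 : 0 <= poly_cst k1 k2 (2 * (n * n)) by rewrite mulr_ge0// sqrtr_ge0.
have -> : C0 * n%:R = b%:R * n%:R + K%:R * n%:R + t%:R * (growth k1 k2 * n%:R).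
  by rewrite /C0; ring.
rewrite !expRD; apply: ler_pM; rewrite ?mulr_ge0 ?addr_ge0 ?exprn_ge0//.
  apply: ler_pM; rewrite ?addr_ge0 ?mulr_ge0//.
    have -> : 1 + K`!%:R * t%:R = b%:R :> R by rewrite /b natrD natrM.
    apply: (le_trans (natr_le_expR b)); rewrite ler_expR ler_peMr//.
  rewrite natrX expRM_natr; apply: lerXn2r; rewrite ?nnegrE ?expR_ge0//.
  exact: natr_le_expR.
rewrite expRM_natl; apply: lerXn2r; rewrite ?nnegrE ?expR_ge0//.
Qed.

Lemma c_gt0 : 0 < c.
Proof.
apply: divr_gt0; last by rewrite ltr0n.
by apply: mulr_gt0; apply: exprn_gt0; [exact: delta_gt0|exact: gam_gt0].
Qed.

(** Half of [c n^2 J] pays for [(C0 + 1) n] and the other half for [n J]; the surplus [n] supplies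
    the factor 1/2. *)
Lemma remainder_le (n : nat) (J : R) : (0 < n)%N -> 2 / c <= n%:R ->
  2 * (C0 + 1) / c <= n%:R * J -> 0 < n%:R * J ->
  (1 + K`!%:R * t%:R) * (K ^ n)%:R *
    (poly_cst k1 k2 (2 * (n * n)) ^+ t * expR (- (c * n%:R ^+ 2 * J))) <=
  expR (- (n%:R * J)) / 2.
Proof.
move=> nn0 n4 l4 nJ0; have c0 := c_gt0.
have nr0 : 0 <= n%:R :> R by [].
rewrite mulrA.
apply: (@le_trans _ _ (expR (C0 * n%:R) * expR (- (c * n%:R ^+ 2 * J)))).
  by apply: ler_wpM2r; [exact: expR_ge0|exact: poly_total_le].
have ex : C0 * n%:R + - (c * n%:R ^+ 2 * J) <= - (n%:R * J) - n%:R.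
  have cn : 2 <= c * n%:R by rewrite mulrC -ler_pdivrMr.
  have cl : 2 * (C0 + 1) <= c * (n%:R * J) by rewrite [leRHS]mulrC -ler_pdivrMr.
  have h1 := ler_wpM2r nr0 cl.
  have h2 := ler_wpM2r (ltW nJ0) cn.
  rewrite expr2; move: h1 h2; move: (C0) (c) => u v; lra.
rewrite -expRD; apply: (@le_trans _ _ (expR (- (n%:R * J) - n%:R))).
  by rewrite ler_expR.
have half : expR (- n%:R) <= 2^-1 :> R.
  rewrite expRN lef_pV2 ?posrE ?expR_gt0//.
  have nr1 : 1 <= n%:R :> R by rewrite ler1n.
  by apply: le_trans (expR_ge1Dx _); lra.
by rewrite expRD; apply: ler_wpM2l; [exact: expR_ge0|exact: half].
Qed.

(** The constant [2 a] is absorbed by one more [kappa nb J] of the exponent, hence the [2 kappa] in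
    the rate. *)
Lemma leading_le (n : nat) (y J nb : R) : ln (2 * a) <= kappa * (nb * J) ->
  y = expR (- ((1 - kappa) * nb * J)) ->
  K`!%:R * 2 ^+ t * (2 * (n%:R * (K%:R * y))) <=
  n%:R * expR (- ((1 - 2 * kappa) * nb * J)) / 2.
Proof.
move=> l3 yE; have a0 : 0 < a.
  by rewrite /a !mulr_gt0 ?exprn_gt0 ?ltr0n ?fact_gt0//; apply: leq_trans K2.
have hk : 2 * a <= expR (kappa * (nb * J)).
  by rewrite -[leLHS]lnK ?posrE ?ler_expR//; lra.
set goal := n%:R * expR (- ((1 - 2 * kappa) * nb * J)).
have gE : goal = n%:R * y * expR (kappa * (nb * J)).
  by rewrite /goal yE -[RHS]mulrA -expRD; congr (_ * expR _); ring.
have ny0 : 0 <= n%:R * y by rewrite yE mulr_ge0 ?expR_ge0.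
have := ler_wpM2l ny0 hk; rewrite -gE /a.
move: (goal) (2 ^+ t) (K`!%:R) => g u v; lra.
Qed.

Lemma error_eventually (n : nat) (p q : R) (Zs : {ffun 'I_n -> 'I_K})
    (lnn := ln (n%:R : R)) :
  0 < q -> q < p -> p <= 4^-1 -> p <= C * q -> balanced beta Zs ->
  (1 + eps0) * lnn <= nbar K beta n * renyi_div p q ->
  2 / gam <= n%:R -> 8 / gam ^+ 2 <= n%:R -> 4 / delta <= n%:R -> 2 / c <= n%:R ->
  1 <= lnn -> ln (2 * K%:R) <= eps0 / 2 * lnn -> ln (2 * a) <= kappa * lnn ->
  2 * (C0 + 1) / c <= lnn ->
  1 - \sum_x sbm_law p q Zs x * posterior_mass alpha k1 k2 (graph x) (Gamma Zs) <=
  n%:R * expR (- ((1 - 2 * kappa) * nbar K beta n * renyi_div p q)).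
Proof.
move=> q0 qp p4 pC bal hJ n1 n2 n3 n4 l1 l2 l3 l4.
have e0 := eps0_gt0; have kg := kappa_gt0; have kl := kappa_le.
set J := renyi_div p q in hJ *; set nb := nbar K beta n in hJ *.
have J0 : 0 < J := renyi_gt0 q0 qp p4.
have nr0 : 0 < n%:R :> R by apply: lt_le_trans n1; rewrite divr_gt0.
have nn0 : (0 < n)%N by rewrite -(ltr0n R).
have [nKb nbn] := nbar_bounds n; rewrite -/nb in nKb nbn.
have lnJ : lnn <= nb * J.
  apply: le_trans hJ; have : 0 <= eps0 * lnn by rewrite mulr_ge0//; lra.
  lra.
have nbJ : nb * J <= n%:R * J by rewrite ler_wpM2r// ltW.
have nJ1 : 1 <= n%:R * J by lra.
(* From [n J >= 1] and [J <= 4 (p - q)] follows [p - q >= 1 / (4 n)], so a mesh of order [n^-2]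
   resolves the window once [delta n >= 4]. *)
have Mw : (2 * (n * n))%:R^-1 <= delta * (p - q) / 2.
  have pqJ : J <= 4 * (p - q).
    apply: (le_trans (renyi_le q0 qp p4)); rewrite ler_wpM2l//.
    rewrite ler_pdivrMr; last by lra.
    by rewrite expr2 ler_wpM2l; lra.
  rewrite -[leLHS]mul1r ler_pdivrMr; last by rewrite ltr0n !muln_gt0 nn0.
  rewrite !natrM.
  have d4 : 4 <= delta * n%:R by rewrite mulrC -ler_pdivrMr.
  have pqn : 1 <= 4 * (p - q) * n%:R.
    by apply: (le_trans nJ1); rewrite mulrC ler_wpM2r// ltW.
  have : 4 * 1 <= delta * n%:R * (4 * (p - q) * n%:R) by rewrite ler_pM.
  move: (delta) => dl; lra.
pose y := expR (- ((1 - kappa) * nb * J)).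
have nE : n%:R = expR lnn by rewrite /lnn lnK// posrE.
have hK := Kr2.
(* [kappa_eps] makes [n y] at most [n] to the power [- eps0 / 2], which is below [1 / (2 K)] for
   large [n]. *)
have ny : n%:R * (K%:R * y) <= 2^-1.
  have -> : n%:R * (K%:R * y) = K%:R * (n%:R * y) by ring.
  rewrite nE /y -expRD.
  have h3 : (1 - kappa) * ((1 + eps0) * lnn) <= (1 - kappa) * (nb * J) by rewrite ler_wpM2l//; lra.
  have h4 : (1 + eps0 / 2) * lnn <= (1 - kappa) * (1 + eps0) * lnn.
    by rewrite ler_wpM2r//; lra.
  have hE : expR (lnn + - ((1 - kappa) * nb * J)) <= expR (- ln (2 * K%:R)).
    by rewrite ler_expR; lra.
  rewrite expRN lnK ?posrE in hE; last by lra.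
  apply: (le_trans (ler_wpM2l (ler0n R K) hE)).
  have -> // : K%:R / (2 * K%:R) = 2^-1 :> R.
  by field; rewrite gt_eqF//; lra.
have [_ _ h0] := threshold_bounds n1.
have eps_half := le_trans (threshold_eps n1) (let: And4 _ _ _ h := ratio_alpha_beta in h).
apply: (le_trans (total_error_le k1_gt0 k2_gt0 q0 qp p4 pC delta_gt0 delta_C K2 h0 nn0
  beta_ge1 alpha_beta bal (threshold_alpha n1) Mw (threshold_eps_nbar n1)
  (fun N => @mixed_exponent n n1 n2 N J J0)
  (fun N m1 m2 => @common_exponent n n1 n2 N m1 m2 J J0) eps_half ny)).
rewrite -/J -/nb -/y -/t.
have nbJ0 : 0 <= nb * J by lra.
rewrite [leRHS]splitr; apply: lerD.
  apply: leading_le => //; apply: (le_trans l3); apply: ler_wpM2l => //; exact: ltW.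
have nJ0 : 0 < n%:R * J by lra.
apply: (le_trans (remainder_le nn0 n4 (le_trans l4 (le_trans lnJ nbJ)) nJ0)).
apply: ler_wpM2r => //; rewrite -[leLHS]mul1r; apply: ler_pM; rewrite ?ler1n ?expR_ge0//.
rewrite ler_expR lerN2 -mulrA.
have k1l : 1 - 2 * kappa <= 1 by lra.
have := ler_wpM2r nbJ0 k1l; lra.
Qed.

(** The threshold on [n] is uniform in [p], [q] and [Zs], so sequences can be substituted
    afterwards. *)
Lemma error_near : \forall n \near \oo,
  forall (p q : R) (Zs : {ffun 'I_n -> 'I_K}),
  0 < q -> q < p -> p <= 4^-1 -> p <= C * q -> balanced beta Zs ->
  (1 + eps0) * ln (n%:R : R) <= nbar K beta n * renyi_div p q ->
  1 - \sum_x sbm_law p q Zs x * posterior_mass alpha k1 k2 (graph x) (Gamma Zs) <=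
  n%:R * expR (- ((1 - 2 * kappa) * nbar K beta n * renyi_div p q)).
Proof.
have e2 : 0 < eps0 / 2 by rewrite divr_gt0.
near=> n => p q Zs q0 qp p4 pC bal hJ.
apply: error_eventually => //.
- by near: n; exact: nbhs_infty_ger.
- by near: n; exact: nbhs_infty_ger.
- by near: n; exact: nbhs_infty_ger.
- by near: n; exact: nbhs_infty_ger.
- by near: n; exact: ln_near.
- by rewrite -ler_pdivrMl//; near: n; exact: ln_near.
- by rewrite -ler_pdivrMl//; near: n; exact: ln_near.
- by near: n; exact: ln_near.
Unshelve. all: by end_near. Qed.

End Asymptotics.

(** * Consistency *)

Lemma limn_einf_gt (R : realType) (u : (\bar R)^nat) (l : \bar R) :
  (l < limn_einf u)%E -> \forall n \near \oo, (l < u n)%E.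
Proof.
rewrite limn_einf_lim (cvg_lim _ (@cvg_einfs_sup _ u))//.
move=> /ereal_sup_gt[_ [N _ <-]] lN; exists N => // n /= Nn.
by apply: (lt_le_trans lN); apply: ereal_inf_lbound; exists n.
Qed.

Lemma limn_einf_gt1 (R : realType) (u : R^nat) :
  (1%:E < limn_einf (fun n => (u n)%:E))%E ->
  exists2 e : R, 0 < e & \forall n \near \oo, 1 + e < u n.
Proof.
move=> h; suff [e e0 he] : exists2 e : R, 0 < e & ((1 + e)%:E < limn_einf (fun n => (u n)%:E))%E.
  by exists e => //; apply: filterS (limn_einf_gt he) => n; rewrite lte_fin.
move: h; case: (limn_einf _) => [r||//].
  rewrite lte_fin => r1; exists ((r - 1) / 2); first by lra.
  by rewrite lte_fin; lra.
by move=> _; exists 1 => //; rewrite ltry.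
Qed.

(* [eta n] is [k0 / m.+1] for the largest [m <= n] whose threshold is at most [n]. *)
Lemma diagonal_near (R : realType) (G : R -> nat -> Prop) (k0 : R) : 0 < k0 ->
  (forall k, 0 < k -> k <= k0 -> \forall n \near \oo, G k n) ->
  exists eta : nat -> R, [/\ forall n, 0 < eta n, eta @ \oo --> (0 : R) &
    \forall n \near \oo, G (eta n) n].
Proof.
move=> k0_gt0 hG.
have thr (m : nat) : exists N : nat, forall n, (N <= n)%N -> G (k0 / m.+1%:R) n.
  have [|N _ hN] := hG (k0 / m.+1%:R) (divr_gt0 k0_gt0 (ltr0Sn _ _)).
    by rewrite ler_pdivrMr// ler_peMr ?ler1n// ltW.
  by exists N => n; exact: hN.
have [N hN] := choice thr.
pose m n := (\max_(j < n.+1 | (N j <= n)%N) j)%N.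
exists (fun n => k0 / (m n).+1%:R); split.
- by move=> n; rewrite divr_gt0.
- apply/cvgrPdist_le => e e0.
  pose M := Num.truncn (k0 / e).
  exists (maxn M (N M)) => // n /=; rewrite geq_max => /andP[Mn Nn].
  have Mm : (M <= m n)%N by exact: (@leq_bigmax_cond _ _ _ (Ordinal (Mn : (M < n.+1)%N))).
  rewrite sub0r normrN ger0_norm ?divr_ge0 ?(ltW k0_gt0)//.
  rewrite ler_pdivrMr// -ler_pdivrMl// mulrC.
  have ke : 0 <= k0 / e by rewrite divr_ge0 ?ltW.
  have /andP[_ /ltW h] := truncn_itv ke; rewrite -/M in h.
  by apply: (le_trans h); rewrite ler_nat.
- exists (N 0) => // n /= N0n; apply: hN.
  have c0 : (0 < #|[pred j : 'I_n.+1 | (N j <= n)%N]|)%N.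
    by apply/card_gt0P; exists ord0.
  have [j hj mE] := eq_bigmax_cond (fun j : 'I_n.+1 => j : nat) c0.
  by have -> : m n = j by rewrite -mE /m; apply: eq_bigl.
Qed.

Lemma cvg0_near_le (R : realType) (u : nat -> R) (e : R) :
  u @ \oo --> (0 : R) -> 0 < e -> \forall n \near \oo, u n <= e.
Proof.
move=> /cvgrPdist_le u0 e0; have := u0 e e0; apply: filterS => n.
by rewrite sub0r normrN; exact: le_trans (ler_norm _).
Qed.

Section Consistency.
Context {R : realType}.
Variables (K : nat) (alpha beta kappa1 kappa2 C e : R) (p q : nat -> R).
Variable (Zs : forall n : nat, {ffun 'I_n -> 'I_K}).
Variables (d : nat -> measure_display) (Om : forall n, measurableType (d n)).
Variables (P : forall n, probability (Om n) R).
Variable (A : forall n, 'I_n -> 'I_n -> {RV (P n) >-> bool}).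
Hypotheses (K2 : (2 <= K)%N) (beta1 : 1 <= beta) (ab : beta < alpha).
Hypotheses (k10 : 0 < kappa1) (k20 : 0 < kappa2).
Hypothesis pq : forall n, 0 < q n /\ q n < p n /\ p n < 1.
Hypotheses (p0 : p @ \oo --> (0 : R)) (pC : forall n, p n / q n <= C).
Hypothesis sbm : forall n, sbm_adjacency (sbm_conn K (p n) (q n)) (Zs n) (@A n).
Hypothesis e0 : 0 < e.
Hypothesis signal : \forall n \near \oo,
  1 + e < nbar K beta n * renyi_div (p n) (q n) / ln n%:R.

Let J n := nbar K beta n * renyi_div (p n) (q n).

Lemma signal_ln : \forall n \near \oo, (1 + e) * ln n%:R <= J n.
Proof.
near=> n.
have l0 : 0 < ln (n%:R : R).
  by apply: (@lt_le_trans _ _ 1) => //; near: n; exact: ln_near.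
by rewrite -ler_pdivlMr//; apply: ltW; near: n.
Unshelve. all: by end_near. Qed.

Lemma expectation_near (k : R) : 0 < k -> 2 * k <= 1 ->
  1 + e / 2 <= (1 - k) * (1 + e) ->
  \forall n \near \oo, balanced beta (Zs n) ->
   ((1 - n%:R * expR (- ((1 - 2 * k) * nbar K beta n * renyi_div (p n) (q n))))%:E <=
    'E_(P n)[fun w => posterior_mass alpha kappa1 kappa2
                               (adjacency_mx (@A n) w) (Gamma (Zs n))])%E.
Proof.
move=> k0 k1 ke.
have C1 : 1 <= C.
  have [q0 [qp _]] := pq 0; apply: le_trans (pC 0).
  by rewrite ler_pdivlMr// mul1r ltW.
near=> n => bal.
have [q0 [qp p1]] := pq n.
have mass0 M : 0 <= (posterior_mass alpha kappa1 kappa2)^~ (Gamma (Zs n)) M.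
  by apply: sumr_ge0 => Z _; exact: posterior_ge0.
rewrite (expectation_graph q0 qp p1 (sbm n) mass0).
rewrite lee_fin lerBlDr -lerBlDl.
have pn4 : p n <= 4^-1.
  by near: n; apply: (cvg0_near_le p0); rewrite invr_gt0.
have pCq : p n <= C * q n by rewrite -ler_pdivrMr.
have sg : (1 + e) * ln n%:R <= J n by near: n; exact: signal_ln.
rewrite /J in sg; move: q0 qp pn4 pCq bal sg; move: (p n) (q n) (Zs n).
near: n; exact: (error_near k10 k20 K2 beta1 ab C1 k0 k1 e0 ke).
Unshelve. all: by end_near. Qed.

(** Once [eta <= e / (2 (1 + e))], the exponent is at least [(1 + e / 2) ln n], which leaves [n] to
    the power [- e / 2]. *)
Lemma error_bound_cvg (eta : nat -> R) : eta @ \oo --> (0 : R) ->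
  error_bound K beta p q eta @ \oo --> (0 : R).
Proof.
move=> eta0; apply/cvgrPdist_le => x x0.
near=> n.
have n0 : 0 < n%:R :> R by near: n; exact: nbhs_infty_gtr.
have l0 : 0 <= ln (n%:R : R) by near: n; exact: ln_near.
rewrite sub0r normrN ger0_norm ?mulr_ge0 ?expR_ge0//.
rewrite /error_bound -{1}(lnK (n0 : n%:R \is Num.pos)) -expRD.
rewrite -[leRHS](lnK (x0 : x \is Num.pos)) ler_expR -mulrA -/(J n).
have sg : (1 + e) * ln n%:R <= J n by near: n; exact: signal_ln.
have he : eta n <= e / (2 * (1 + e)).
  near: n; apply: (cvg0_near_le eta0); rewrite divr_gt0// mulr_gt0//.
  by have := e0; lra.
have hx : - ln x / (e / 2) <= ln (n%:R : R) by near: n; exact: ln_near.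
have e2 : 0 < e / 2 by rewrite divr_gt0.
rewrite ler_pdivrMr// in hx.
have e0' := e0.
have e1 : e / (2 * (1 + e)) <= 2^-1 by rewrite ler_pdivrMr; lra.
have h1 : (1 - e / (2 * (1 + e))) * (1 + e) = 1 + e / 2 by field; rewrite gt_eqF//; lra.
have h2 : (1 - e / (2 * (1 + e))) * J n <= (1 - eta n) * J n.
  apply: ler_wpM2r; last by lra.
  by apply: le_trans sg; rewrite mulr_ge0//; lra.
have h3 : (1 - e / (2 * (1 + e))) * ((1 + e) * ln n%:R) <= (1 - e / (2 * (1 + e))) * J n.
  by apply: ler_wpM2l => //; lra.
move: h3; rewrite mulrA h1; lra.
Unshelve. all: by end_near. Qed.

End Consistency.

Theorem theorem2p1 (R : realType) (K : nat) (alpha beta kappa1 kappa2 : R)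
    (p q : nat -> R)
    (Zs : forall n : nat, {ffun 'I_n -> 'I_K})
    (d : nat -> measure_display) (Om : forall n, measurableType (d n))
    (P : forall n, probability (Om n) R)
    (A : forall n, 'I_n -> 'I_n -> {RV (P n) >-> bool}) :
  (2 <= K)%N -> 1 <= beta -> beta < alpha -> 0 < kappa1 -> 0 < kappa2 ->
  (forall n, 0 < q n /\ q n < p n /\ p n < 1) ->
  p @ \oo --> (0 : R) -> q @ \oo --> (0 : R) ->
  (exists C : R, forall n, p n / q n <= C) ->
  (forall n, sbm_adjacency (sbm_conn K (p n) (q n)) (Zs n) (A n)) ->
  (1%:E < limn_einf (fun n =>
     (nbar K beta n * renyi_div (p n) (q n) / ln n%:R)%:E))%E ->
  exists eta : nat -> R,
    [/\ forall n, 0 < eta n,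
        eta @ \oo --> (0 : R),
        (* the labels need only be balanced at the n under consideration:
           for some beta (e.g. beta = 1) no balanced labels exist when
           K does not divide n *)
        \forall n \near \oo, balanced beta (Zs n) ->
          ((1 - error_bound K beta p q eta n)%:E <=
           'E_(P n)[fun w => posterior_mass alpha kappa1 kappa2
                               (adjacency_mx (A n) w) (Gamma (Zs n))])%E
      & error_bound K beta p q eta @ \oo --> (0 : R)].
Proof.
move=> K2 beta1 ab k10 k20 pq p0 _ [C pC] sbm /limn_einf_gt1[e e0 signal].
pose G k n := balanced beta (Zs n) ->
  ((1 - n%:R * expR (- ((1 - k) * nbar K beta n * renyi_div (p n) (q n))))%:E <=
   'E_(P n)[fun w => posterior_mass alpha kappa1 kappa2
                       (adjacency_mx (A n) w) (Gamma (Zs n))])%E.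
(* [k <= e / (1 + e)] is equivalent to the last condition of [expectation_near] at [k / 2]; the
   halving matches the [2 k] lost in its rate. *)
have k0 : 0 < e / (1 + e) by rewrite divr_gt0//; lra.
have [k k_gt0 ke|eta [eta_gt0 eta0 hG]] := @diagonal_near R G _ k0.
  have -> : k = 2 * (k / 2) by lra.
  rewrite ler_pdivlMr in ke; last by lra.
  have k1 : k <= 1.
    by rewrite -(ler_pM2r (_ : 0 < 1 + e)); lra.
  by apply: (expectation_near K2 beta1 ab k10 k20 pq p0 pC sbm e0 signal); lra.
exists eta; split=> //.
exact: (error_bound_cvg e0 signal eta0).
Qed.
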